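(* For $x,y\in\mathbb{C}$ and integers $m\ge 0$, define \[ F_{\mathrm{even}}(x,y,m) = -\frac{(4x^2-1)y^2}{8(x^2-1)(4y^2-1)}\cdot \frac{(1)_m^2\,(\tfrac32-x)_m(\tfrac32+x)_m(1-y)_m(1+y)_m}{(2)_m(2-x)_m(2+x)_m(\tfrac32-y)_m(\tfrac32+y)_m}\cdot\frac{1}{m!}, \] \[ F_{\mathrm{odd}}(x,y,m) = -\frac{y^2}{4y^2-1}\cdot \frac{(\tfrac12)_m(1)_m(\tfrac12-x)_m(\tfrac12+x)_m(1-y)_m(1+y)_m}{(\tfrac32)_m(1-x)_m(1+x)_m(\tfrac32-y)_m(\tfrac32+y)_m}\cdot\frac{1}{m!}. \] Then for all $x,y\in\mathbb{C}$ (away from the poles of either side), \[ \sum_{m\ge0}\big(F_{\mathrm{even}}(x,y,m)+F_{\mathrm{odd}}(x,y,m)\big) \] equals \begin{align*} &\tfrac18\psi(1+x+y)+\tfrac18\psi(1+x-y)-\tfrac14\psi(1+x)+\tfrac14\psi(1+y)-\tfrac12\psi(1+2y)+\frac{1}{8x}-\frac{\gamma}{4}+\frac{\pi}{8}\tan\pi y\\ &+\frac{\cot\pi x\tan\pi y-1}{16(x-y)}-\frac{\cot\pi x\tan\pi y+1}{16(x+y)}+\tfrac18\cot\pi x\tan\pi y\,\big(\psi(1+x+y)-\psi(1+x-y)\big). \end{align*}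
   Context: $(a)_m = a(a+1)\cdots(a+m-1)$ is the ascending Pochhammer symbol (with $(a)_0=1$); $\psi=\Gamma'/\Gamma$ is the digamma function; $\gamma$ is the Euler–Mascheroni constant. Equivalently, $\sum_m F_{\mathrm{even}} = -\frac{(4x^2-1)y^2}{8(x^2-1)(4y^2-1)}\,{}_6F_5\!\left(\begin{smallmatrix}1,1,\frac32-x,\frac32+x,1-y,1+y\\ 2,2-x,2+x,\frac32-y,\frac32+y\end{smallmatrix};1\right)$ and $\sum_m F_{\mathrm{odd}} = -\frac{y^2}{4y^2-1}\,{}_6F_5\!\left(\begin{smallmatrix}\frac12,1,\frac12-x,\frac12+x,1-y,1+y\\ \frac32,1-x,1+x,\frac32-y,\frac32+y\end{smallmatrix};1\right)$. *)

(* Defs.v *)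
From Stdlib Require Import Reals Factorial.
From Coquelicot Require Import Coquelicot.
Open Scope R_scope.
Open Scope C_scope.

Definition Cexp (z : C) : C :=
  (exp (Re z) * cos (Im z), exp (Re z) * sin (Im z))%R.

Definition Ccos (z : C) : C := (Cexp (Ci * z) + Cexp (- (Ci * z))) / 2.
Definition Csin (z : C) : C := (Cexp (Ci * z) - Cexp (- (Ci * z))) / (2 * Ci).
Definition Ctan (z : C) : C := Csin z / Ccos z.
Definition Ccot (z : C) : C := Ccos z / Csin z.

Fixpoint pochhammer (a : C) (m : nat) : C :=
  match m with
  | O => 1
  | S k => pochhammer a k * (a + INR k)
  end.

Definition C_Lim_seq (u : nat -> C) : C :=
  (real (Lim_seq (fun n => Re (u n))), real (Lim_seq (fun n => Im (u n)))).

(* Euler-Gauss product n! n^z / (z (z+1) ... (z+n)); its limit is Gamma on all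
   of C minus the nonpositive integers, so no analytic continuation is needed. *)
Definition CGamma (z : C) : C :=
  C_Lim_seq (fun n =>
    INR (fact n) * Cexp (z * ln (INR n)) / pochhammer z (S n)).

(* C_derive takes the limit of the difference quotient along the real direction;
   it is the complex derivative wherever the function is holomorphic, as Gamma is
   off its poles. *)
Definition digamma (z : C) : C := C_derive CGamma z / CGamma z.

Definition Euler_gamma : R :=
  real (Lim_seq (fun n => sum_n_m (fun k => / INR k) 1 n - ln (INR n))%R).

Definition not_Gamma_pole (z : C) : Prop := forall n : nat, z <> - INR n.

Definition F_even (x y : C) (m : nat) : C :=
  - (((4 * x ^ 2 - 1) * y ^ 2) / (8 * (x ^ 2 - 1) * (4 * y ^ 2 - 1)))
  * ((pochhammer 1 m ^ 2 * pochhammer (3 / 2 - x) m * pochhammer (3 / 2 + x) m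
      * pochhammer (1 - y) m * pochhammer (1 + y) m)
     / (pochhammer 2 m * pochhammer (2 - x) m * pochhammer (2 + x) m
        * pochhammer (3 / 2 - y) m * pochhammer (3 / 2 + y) m))
  * (1 / INR (fact m)).

Definition F_odd (x y : C) (m : nat) : C :=
  - (y ^ 2 / (4 * y ^ 2 - 1))
  * ((pochhammer (1 / 2) m * pochhammer 1 m
      * pochhammer (1 / 2 - x) m * pochhammer (1 / 2 + x) m
      * pochhammer (1 - y) m * pochhammer (1 + y) m)
     / (pochhammer (3 / 2) m * pochhammer (1 - x) m * pochhammer (1 + x) m
        * pochhammer (3 / 2 - y) m * pochhammer (3 / 2 + y) m))
  * (1 / INR (fact m)).

(* Main.v *)
(* The terms are [y^2/(1-4y^2) Q_m(y) (P_m(x)/(2m+1) + P_{m+1}(x)/(2m+2))] with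
   [P_m(x) = prod_{k<m} ((k+1/2)^2-x^2)/((k+1)^2-x^2)] and
   [Q_m(y) = prod_{k<m} ((k+1)^2-y^2)/((k+3/2)^2-y^2)].  The difference of the series
   at [x+1] and at [x] telescopes in [m] (Gosper); the boundary term at infinity is
   evaluated by the sine and cosine products and gives exactly the increment of the
   right-hand side, so the difference [D(x)] of the two sides is 1-periodic in [x].
   As [N] tends to infinity, both the series and the right-hand side at [x+N] tend to
   limits independent of [x] (dominated convergence), hence [D] is constant; and
   [D(1/2) = 0] because the series then reduces to its first term, while the
   right-hand side is computed by the duplication and reflection formulas for the
   digamma function.

   The digamma function itself is controlled by the estimate
   [|Gamma(z+s)/Gamma(z) - 1 - s psi(z)| <= K |s|^2], obtained from the Gauss product;
   the sine and cosine products come from the Wallis-type recurrence for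
   [int_0^{pi/2} cos(2zt) (cos t)^n dt], which holds for complex [z]. *)

Require Import Defs.
From Stdlib Require Import Reals Factorial Lra Lia Psatz.
From Coquelicot Require Import Coquelicot.
Set Bullet Behavior "Strict Subproofs".
Open Scope R_scope.
Open Scope C_scope.

(** * Convergence in C, infinite products *)

(** The obstacle to dominated convergence is uniformity in N: at x + N the factors of P_m with index
    below N can exceed 1 in modulus. For [0 <= Re x] and N >= 1 their product still grows at most
    like sqrt(m + 1), with a constant independent of N, while Q_m decays like 1/m and the
    denominators give another 1/m; the majorant is a multiple of (m + 1)^(-3/2). This bound covers
    only points shifted to the right, so at a general [x] both convergence and value are brought
    back from such a point through the telescoped difference, together with an unknown constant [d].
    The constant is found by comparing with 1/2: the difference of the two shifted series tends to
    0.

    Complex logarithms are avoided throughout. An infinite product is differentiated by a quadratic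
    remainder estimate on its partial products, applied twice: to the Gauss quotient, which gives
    the series of the digamma function, and to the quotient of two cosine products, which gives the
    tangent series and from it the reflection formula. *)

Definition Ccv (u : nat -> C) (l : C) : Prop :=
  is_lim_seq (fun n => Cmod (u n - l)) 0%R.

(** The index [n] is excluded, so inductions start from the empty sum; Coquelicot's [sum_n f n] is
    [Csum f (S n)]. *)
Fixpoint Csum (f : nat -> C) (n : nat) : C :=
  match n with O => 0 | S k => Csum f k + f k end.

Fixpoint Cprod (f : nat -> C) (n : nat) : C :=
  match n with O => 1 | S k => Cprod f k * f k end.

Fixpoint Rsum (f : nat -> R) (n : nat) : R :=
  match n with O => 0 | S k => Rsum f k + f k end.

Lemma Ccv_squeeze (u : nat -> C) (l : C) (v : nat -> R) :
  (forall n, Cmod (u n - l) <= v n)%R -> is_lim_seq v 0%R -> Ccv u l.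
Proof.
  intros Huv Hv. apply (is_lim_seq_le_le (fun _ => 0%R) _ v).
  - intros n; split; [apply Cmod_ge_0 | apply Huv].
  - apply is_lim_seq_const.
  - exact Hv.
Qed.

Lemma Ccv_ext (u v : nat -> C) (l : C) :
  (forall n, u n = v n) -> Ccv u l -> Ccv v l.
Proof.
  intros E H. apply (is_lim_seq_ext (fun n => Cmod (u n - l))); auto.
  intros n; now rewrite E.
Qed.

Lemma Ccv_limit_eq (u : nat -> C) (k l : C) : k = l -> Ccv u k -> Ccv u l.
Proof. now intros ->. Qed.

Lemma Ccv_const (l : C) : Ccv (fun _ => l) l.
Proof.
  apply (is_lim_seq_ext (fun _ => 0%R)).
  - intros n. replace (l - l) with (RtoC 0) by ring. now rewrite Cmod_0.
  - apply is_lim_seq_const.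
Qed.

Lemma is_lim_seq_plus_0 (a b : nat -> R) :
  is_lim_seq a 0%R -> is_lim_seq b 0%R -> is_lim_seq (fun n => a n + b n)%R 0%R.
Proof.
  intros Ha Hb.
  replace (Finite 0) with (Finite (0 + 0)) by (f_equal; ring).
  now apply is_lim_seq_plus'.
Qed.

Lemma is_lim_seq_scal_0 (k : R) (a : nat -> R) :
  is_lim_seq a 0%R -> is_lim_seq (fun n => k * a n)%R 0%R.
Proof.
  intros Ha. replace (Finite 0) with (Rbar_mult k 0%R) by (simpl; f_equal; ring).
  now apply is_lim_seq_scal_l.
Qed.

Lemma Ccv_plus (u v : nat -> C) (l k : C) :
  Ccv u l -> Ccv v k -> Ccv (fun n => u n + v n) (l + k).
Proof.
  intros Hu Hv.
  apply (Ccv_squeeze _ _ (fun n => Cmod (u n - l) + Cmod (v n - k))%R).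
  - intros n. replace (u n + v n - (l + k)) with ((u n - l) + (v n - k)) by ring.
    apply Cmod_triangle.
  - now apply is_lim_seq_plus_0.
Qed.

Lemma Ccv_mult (u v : nat -> C) (l k : C) :
  Ccv u l -> Ccv v k -> Ccv (fun n => u n * v n) (l * k).
Proof.
  intros Hu Hv.
  apply (Ccv_squeeze _ _ (fun n => Cmod (u n - l) * Cmod (v n - k)
     + (Cmod l * Cmod (v n - k) + Cmod k * Cmod (u n - l)))%R).
  - intros n.
    replace (u n * v n - l * k)
      with ((u n - l) * (v n - k) + (l * (v n - k) + k * (u n - l))) by ring.
    rewrite <- !Cmod_mult.
    eapply Rle_trans; [apply Cmod_triangle|].
    apply Rplus_le_compat_l, Cmod_triangle.
  - apply is_lim_seq_plus_0; [|apply is_lim_seq_plus_0; now apply is_lim_seq_scal_0].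
    replace (Finite 0) with (Finite (0 * 0)) by (f_equal; ring).
    now apply is_lim_seq_mult'.
Qed.

Lemma Ccv_scal (a : C) (u : nat -> C) (l : C) :
  Ccv u l -> Ccv (fun n => a * u n) (a * l).
Proof. intros Hu. apply (Ccv_mult (fun _ => a) u); [apply Ccv_const | exact Hu]. Qed.

Lemma Ccv_opp (u : nat -> C) (l : C) : Ccv u l -> Ccv (fun n => - u n) (- l).
Proof.
  intros Hu. replace (- l) with (- (1) * l) by ring.
  apply (Ccv_ext (fun n => - (1) * u n)); [intros; ring | now apply Ccv_scal].
Qed.

Lemma Ccv_minus (u v : nat -> C) (l k : C) :
  Ccv u l -> Ccv v k -> Ccv (fun n => u n - v n) (l - k).
Proof. intros Hu Hv. apply Ccv_plus; [exact Hu | now apply Ccv_opp]. Qed.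

Lemma Cmod_minus_sym (a b : C) : Cmod (a - b) = Cmod (b - a).
Proof. rewrite <- Cmod_opp. f_equal. ring. Qed.

Lemma Cmod_triangle_minus (a b : C) : (Cmod (a - b) <= Cmod a + Cmod b)%R.
Proof.
  replace (a - b) with (a + - b) by ring.
  rewrite <- (Cmod_opp b). apply Cmod_triangle.
Qed.

Lemma Cmod_triangle_rev (a b : C) : (Cmod a - Cmod b <= Cmod (a - b))%R.
Proof.
  pose proof (Cmod_triangle (a - b) b) as H.
  replace (a - b + b) with a in H by ring. lra.
Qed.

Lemma Ccv_Cmod (u : nat -> C) (l : C) :
  Ccv u l -> is_lim_seq (fun n => Cmod (u n)) (Cmod l).
Proof.
  intros Hu. apply is_lim_seq_spec; apply is_lim_seq_spec in Hu.
  intros eps. destruct (Hu eps) as [N HN]. exists N. intros n Hn.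
  specialize (HN n Hn). rewrite Rminus_0_r, Rabs_pos_eq in HN by apply Cmod_ge_0.
  pose proof (Cmod_triangle_rev (u n) l). pose proof (Cmod_triangle_rev l (u n)).
  rewrite (Cmod_minus_sym l) in H0. apply Rabs_def1; lra.
Qed.

Lemma Ccv_unique (u : nat -> C) (l k : C) : Ccv u l -> Ccv u k -> l = k.
Proof.
  intros Hl Hk. apply Ceq_minus, Cmod_eq_0.
  pose proof (Ccv_Cmod _ _ (Ccv_minus _ _ _ _ Hl Hk)) as H.
  apply is_lim_seq_unique in H.
  rewrite (Lim_seq_ext _ (fun _ => 0%R)) in H.
  - rewrite Lim_seq_const in H. injection H; auto.
  - intros n. replace (u n - u n) with (RtoC 0) by ring. apply Cmod_0.
Qed.

Lemma Ccv_bounded_by (u : nat -> C) (l : C) (B : R) :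
  Ccv u l -> (forall n, Cmod (u n) <= B)%R -> (Cmod l <= B)%R.
Proof.
  intros Hu HB.
  exact (is_lim_seq_le _ _ _ _ HB (Ccv_Cmod _ _ Hu) (is_lim_seq_const B)).
Qed.

Lemma Ccv_bounded (u : nat -> C) (l : C) :
  Ccv u l -> exists B, (0 < B)%R /\ forall n, (Cmod (u n) <= B)%R.
Proof.
  intros Hu. apply Ccv_Cmod in Hu.
  assert (Hb : bound (fun r => exists n, r = Cmod (u n))).
  { apply is_lim_seq_Reals in Hu.
    destruct (maj_by_pos (fun n => Cmod (u n))) as [B [HB0 HB]].
    - now exists (Cmod l).
    - exists B. intros r [n ->]. specialize (HB n).
      now rewrite Rabs_pos_eq in HB by apply Cmod_ge_0. }
  destruct Hb as [B HB]. exists (Rmax B 1). split.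
  - eapply Rlt_le_trans; [|apply Rmax_r]; lra.
  - intros n. eapply Rle_trans; [|apply Rmax_l]. apply HB. now exists n.
Qed.

Lemma Ccv_inv (u : nat -> C) (l : C) :
  l <> 0 -> (forall n, u n <> 0) -> Ccv u l -> Ccv (fun n => / u n) (/ l).
Proof.
  intros Hl Hn Hu.
  assert (Hinv : is_lim_seq (fun n => / Cmod (u n))%R (/ Cmod l)%R).
  { replace (Finite (/ Cmod l)) with (Rbar_inv (Cmod l)) by reflexivity.
    apply is_lim_seq_inv; [now apply Ccv_Cmod|].
    intros E; injection E; intros E'. now apply Hl, Cmod_eq_0. }
  apply (is_lim_seq_ext (fun n => / Cmod (u n) * (/ Cmod l * Cmod (u n - l)))%R).
  - intros n. replace (/ u n - / l) with (/ u n * (/ l * (l - u n))) by (field; auto).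
    now rewrite !Cmod_mult, !Cmod_inv, (Cmod_minus_sym l) by auto.
  - replace (Finite 0) with (Finite (/ Cmod l * 0)) by (f_equal; ring).
    apply is_lim_seq_mult'; [exact Hinv|].
    now apply is_lim_seq_scal_0.
Qed.

Lemma Ccv_S (u : nat -> C) (l : C) : Ccv u l <-> Ccv (fun n => u (S n)) l.
Proof. apply (is_lim_seq_incr_1 (fun n => Cmod (u n - l))). Qed.

Lemma Ccv_subseq (u : nat -> C) (l : C) (phi : nat -> nat) :
  (forall n, n <= phi n)%nat -> Ccv u l -> Ccv (fun n => u (phi n)) l.
Proof.
  intros Hp Hu. apply is_lim_seq_spec; apply is_lim_seq_spec in Hu.
  intros eps. destruct (Hu eps) as [N HN]. exists N. intros n Hn.
  apply HN. specialize (Hp n). lia.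
Qed.

Lemma Ccv_components (u : nat -> C) (l : C) :
  is_lim_seq (fun n => Re (u n)) (Re l) -> is_lim_seq (fun n => Im (u n)) (Im l) ->
  Ccv u l.
Proof.
  intros Hr Hi.
  apply (Ccv_squeeze _ _
    (fun n => Rabs (Re (u n) - Re l) + Rabs (Im (u n) - Im l))%R).
  - intros n.
    replace (u n - l) with (RtoC (Re (u n) - Re l) + Ci * RtoC (Im (u n) - Im l)).
    + eapply Rle_trans; [apply Cmod_triangle|].
      rewrite Cmod_mult, Cmod_Ci, !Cmod_R. lra.
    + apply injective_projections; simpl; unfold Re, Im; ring.
  - apply is_lim_seq_plus_0; apply (proj1 (is_lim_seq_abs_0 _)).
    + replace (Finite 0) with (Finite (Re l - Re l)) by (f_equal; ring).
      apply is_lim_seq_minus'; [exact Hr | apply is_lim_seq_const].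
    + replace (Finite 0) with (Finite (Im l - Im l)) by (f_equal; ring).
      apply is_lim_seq_minus'; [exact Hi | apply is_lim_seq_const].
Qed.

Lemma im_le_Cmod (z : C) : (Rabs (Im z) <= Cmod z)%R.
Proof. eapply Rle_trans; [apply Rmax_r | apply Rmax_Cmod]. Qed.

Lemma Ccv_Re (u : nat -> C) (l : C) :
  Ccv u l -> is_lim_seq (fun n => Re (u n)) (Re l).
Proof.
  intros Hu. apply is_lim_seq_spec; apply is_lim_seq_spec in Hu.
  intros eps. destruct (Hu eps) as [N HN]. exists N. intros n Hn.
  specialize (HN n Hn). rewrite Rminus_0_r, Rabs_pos_eq in HN by apply Cmod_ge_0.
  eapply Rle_lt_trans; [|exact HN].
  exact (re_le_Cmod (u n - l)).
Qed.

Lemma Ccv_Im (u : nat -> C) (l : C) :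
  Ccv u l -> is_lim_seq (fun n => Im (u n)) (Im l).
Proof.
  intros Hu. apply is_lim_seq_spec; apply is_lim_seq_spec in Hu.
  intros eps. destruct (Hu eps) as [N HN]. exists N. intros n Hn.
  specialize (HN n Hn). rewrite Rminus_0_r, Rabs_pos_eq in HN by apply Cmod_ge_0.
  eapply Rle_lt_trans; [|exact HN].
  exact (im_le_Cmod (u n - l)).
Qed.

Lemma Ccv_C_Lim_seq (u : nat -> C) (l : C) : Ccv u l -> C_Lim_seq u = l.
Proof.
  intros Hu. unfold C_Lim_seq.
  rewrite (is_lim_seq_unique _ _ (Ccv_Re _ _ Hu)).
  rewrite (is_lim_seq_unique _ _ (Ccv_Im _ _ Hu)).
  now destruct l.
Qed.

Lemma Ccv_RtoC (u : nat -> R) (l : R) :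
  is_lim_seq u l -> Ccv (fun n => RtoC (u n)) (RtoC l).
Proof.
  intros Hu. apply Ccv_components; [exact Hu | apply is_lim_seq_const].
Qed.

Lemma Rsum_sum_n (f : nat -> R) (n : nat) : Rsum f (S n) = sum_n f n.
Proof.
  induction n as [|n IH].
  - rewrite sum_O. simpl. ring.
  - rewrite sum_Sn, <- IH. reflexivity.
Qed.

Lemma Csum_sum_n (f : nat -> C) (n : nat) : Csum f (S n) = sum_n f n.
Proof.
  induction n as [|n IH].
  - rewrite sum_O. simpl. ring.
  - rewrite sum_Sn, <- IH. reflexivity.
Qed.

Lemma Ccv_is_series (f : nat -> C) (l : C) : Ccv (Csum f) l -> is_series f l.
Proof.
  intros H. apply Ccv_S in H.
  apply (filterlim_ext (fun n => Csum f (S n))); [apply Csum_sum_n|].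
  apply filterlim_locally_ball_norm. intros eps.
  apply is_lim_seq_spec in H. destruct (H eps) as [N HN]. exists N. intros n Hn.
  specialize (HN n Hn). rewrite Rminus_0_r, Rabs_pos_eq in HN by apply Cmod_ge_0.
  exact HN.
Qed.

Lemma Rsum_le_Series (c : nat -> R) (n : nat) :
  (forall k, 0 <= c k)%R -> ex_series c -> (Rsum c n <= Series c)%R.
Proof.
  intros Hc Hs.
  assert (H : forall m, (Rsum c m <= Rsum c (S m))%R).
  { intros m. simpl. specialize (Hc m). lra. }
  eapply Rle_trans; [apply H|]. rewrite Rsum_sum_n.
  apply (is_lim_seq_incr_compare (sum_n c) (Series c)).
  - now apply Series_correct in Hs.
  - intros m. rewrite <- !Rsum_sum_n. apply H.
Qed.

(** The partial sums of [c] increase and stay below [v O]. This stands in for the integral test,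
    with [v] in the role of the antiderivative. *)
Lemma ex_series_telescope (c v : nat -> R) :
  (forall k, 0 <= c k <= v k - v (S k))%R -> (forall k, 0 <= v k)%R -> ex_series c.
Proof.
  intros Hc Hv.
  destruct (ex_finite_lim_seq_incr (sum_n c) (v O)) as [l Hl].
  - intros n. rewrite <- !Rsum_sum_n. simpl. specialize (Hc (S n)). lra.
  - intros n. rewrite <- Rsum_sum_n.
    assert (H : forall m, (Rsum c m <= v O - v m)%R).
    { induction m as [|m IH]; simpl; [lra|]. specialize (Hc m). lra. }
    specialize (H (S n)). specialize (Hv (S n)). lra.
  - now exists l.
Qed.

(** The common majorant of the infinite products and of the digamma and tangent series; the shift by
    one makes it finite at [k = 0]. *)
Definition inv_sq (k : nat) : R := (/ (INR k + 1) ^ 2)%R.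

Lemma inv_sq_pos (k : nat) : (0 < inv_sq k)%R.
Proof. apply Rinv_0_lt_compat, pow_lt. pose proof (pos_INR k). lra. Qed.

Lemma ex_series_inv_sq : ex_series inv_sq.
Proof.
  (* The increment is 2/((k+1)(k+2)), at least 1/(k+1)^2 because k + 2 <= 2(k + 1). *)
  apply (ex_series_telescope _ (fun k => 2 / (INR k + 1))%R).
  - intros k. split; [apply Rlt_le, inv_sq_pos|].
    unfold inv_sq. rewrite S_INR. pose proof (pos_INR k) as Hk.
    set (x := INR k) in *.
    replace (2 / (x + 1) - 2 / (x + 1 + 1))%R
      with (/ (x + 1) ^ 2 + x / ((x + 1) ^ 2 * (x + 2)))%R by (field; lra).
    assert (0 <= x / ((x + 1) ^ 2 * (x + 2)))%R; [|lra].
    apply Rdiv_le_0_compat; [lra|]. apply Rmult_lt_0_compat; [apply pow_lt|]; lra.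
  - intros k. apply Rlt_le, Rdiv_lt_0_compat; [lra|]. pose proof (pos_INR k). lra.
Qed.

Lemma Ccv_summable_steps (u : nat -> C) (d : nat -> R) :
  (forall n, Cmod (u (S n) - u n) <= d n)%R -> ex_series d -> exists l, Ccv u l.
Proof.
  intros Hd Hs.
  (* [f] stands for [Re] and [Im]: compatibility with subtraction and [Rabs (f a) <= Cmod a] reduce
     the claim to absolute convergence of a real series. *)
  assert (H : forall f : C -> R, (forall a b : C, f (a - b)%C = (f a - f b)%R) ->
    (forall a, Rabs (f a) <= Cmod a)%R ->
    exists l : R, is_lim_seq (fun n => f (u n)) l).
  { intros f Hf Hfm.
    destruct (ex_series_le (fun n => f (u (S n) - u n)) d) as [l Hl].
    - intros n. eapply Rle_trans; [apply Hfm | apply Hd].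
    - exact Hs.
    - exists (l + f (u O))%R. apply is_lim_seq_incr_1.
      apply (is_lim_seq_ext (fun n => sum_n (fun n => f (u (S n) - u n)%C) n + f (u O))%R).
      + intros n. rewrite <- Rsum_sum_n. generalize (S n). intros m.
        induction m as [|m IH]; simpl; [ring|].
        rewrite Hf. lra.
      + apply is_lim_seq_plus'; [exact Hl | apply is_lim_seq_const]. }
  destruct (H Re) as [lr Hr]; [reflexivity | apply re_le_Cmod |].
  destruct (H Im) as [li Hi]; [reflexivity | apply im_le_Cmod |].
  exists (lr, li). now apply Ccv_components.
Qed.

Lemma Cmod_Csum_le (f : nat -> C) (c : nat -> R) (n : nat) :
  (forall k, (k < n)%nat -> Cmod (f k) <= c k)%R -> (Cmod (Csum f n) <= Rsum c n)%R.
Proof.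
  induction n as [|n IH]; intros H; simpl; [rewrite Cmod_0; lra|].
  eapply Rle_trans; [apply Cmod_triangle|].
  apply Rplus_le_compat; [apply IH; intros; apply H; lia | apply H; lia].
Qed.

Lemma Rsum_scal (a : R) (f : nat -> R) (n : nat) :
  Rsum (fun k => a * f k)%R n = (a * Rsum f n)%R.
Proof. induction n as [|n IH]; simpl; [ring|]. rewrite IH. ring. Qed.

Lemma Csum_ext (f g : nat -> C) (n : nat) :
  (forall k, (k < n)%nat -> f k = g k) -> Csum f n = Csum g n.
Proof.
  induction n as [|n IH]; intros H; simpl; [reflexivity|].
  rewrite IH, H; auto.
Qed.

Lemma Csum_scal (a : C) (f : nat -> C) (n : nat) :
  Csum (fun k => a * f k) n = a * Csum f n.
Proof. induction n as [|n IH]; simpl; [ring|]. rewrite IH. ring. Qed.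

Lemma Csum_minus (f g : nat -> C) (n : nat) :
  Csum (fun k => f k - g k) n = Csum f n - Csum g n.
Proof. induction n as [|n IH]; simpl; [ring|]. rewrite IH. ring. Qed.

Lemma Cprod_ext (f g : nat -> C) (n : nat) :
  (forall k, (k < n)%nat -> f k = g k) -> Cprod f n = Cprod g n.
Proof.
  induction n as [|n IH]; intros H; simpl; [reflexivity|].
  rewrite IH, H; auto.
Qed.

Lemma Cprod_mult (f g : nat -> C) (n : nat) :
  Cprod (fun k => f k * g k) n = Cprod f n * Cprod g n.
Proof. induction n as [|n IH]; simpl; [ring|]. rewrite IH. ring. Qed.

Lemma Cprod_neq_0 (f : nat -> C) (n : nat) :
  (forall k, (k < n)%nat -> f k <> 0) -> Cprod f n <> 0.
Proof.
  induction n as [|n IH]; intros H; simpl; [apply C1_nz|].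
  apply Cmult_neq_0; auto.
Qed.

Lemma Csum_abs_cv (f : nat -> C) (c : nat -> R) :
  (forall k, Cmod (f k) <= c k)%R -> ex_series c -> exists l, Ccv (Csum f) l.
Proof.
  intros Hf Hc. apply (Ccv_summable_steps _ c); [|exact Hc].
  intros n. simpl. replace (Csum f n + f n - Csum f n) with (f n) by ring. apply Hf.
Qed.

(** * Infinite products: convergence and first-order expansion *)

Lemma exp_le (a b : R) : (a <= b -> exp a <= exp b)%R.
Proof.
  intros [H | ->]; [apply Rlt_le, exp_increasing, H | apply Rle_refl].
Qed.

Lemma Cprod_bound (a : nat -> C) (c : nat -> R) (n : nat) :
  (forall k, (k < n)%nat -> Cmod (a k) <= c k)%R ->
  (Cmod (Cprod (fun k => 1 + a k)%C n) <= exp (Rsum c n))%R.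
Proof.
  induction n as [|n IH]; intros H; simpl.
  - rewrite Cmod_1, exp_0. lra.
  - rewrite Cmod_mult, exp_plus.
    apply Rmult_le_compat; try apply Cmod_ge_0.
    + apply IH. intros; apply H; lia.
    + eapply Rle_trans; [apply Cmod_triangle|]. rewrite Cmod_1.
      eapply Rle_trans; [|apply exp_ineq1_le]. apply Rplus_le_compat_l, H. lia.
Qed.

(** Consecutive partial products differ by the current product times [a n], and the products are
    bounded by [exp (Series c)], so the steps are absolutely summable. The limit may be zero; where
    it must not be, a separate argument is given. *)
Lemma Cprod_cv (a : nat -> C) (c : nat -> R) :
  (forall k, Cmod (a k) <= c k)%R -> ex_series c ->
  exists l, Ccv (Cprod (fun k => 1 + a k)%C) l.
Proof.
  intros Ha Hc.
  apply (Ccv_summable_steps _ (fun n => exp (Series c) * c n)%R).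
  - intros n. simpl.
    replace (Cprod (fun k => 1 + a k)%C n * (1 + a n) - Cprod (fun k => 1 + a k)%C n)
      with (Cprod (fun k => 1 + a k)%C n * a n) by ring.
    rewrite Cmod_mult. apply Rmult_le_compat; try apply Cmod_ge_0; [|apply Ha].
    eapply Rle_trans; [apply Cprod_bound; intros; apply Ha|].
    apply exp_le. apply Rsum_le_Series; [|exact Hc].
    intros k. eapply Rle_trans; [apply Cmod_ge_0 | apply Ha].
  - now apply (ex_series_scal (exp (Series c)) c).
Qed.

(** Expanding the product leaves terms of degree at least one, respectively two, in the [a k]; their
    moduli are at most the same terms in the [c k], which the exponential series of [Rsum c n]
    dominates. The two bounds go together because the induction step of the second multiplies [a n]
    by the quantity bounded in the first. *)
Lemma Cprod_second_order (a : nat -> C) (c : nat -> R) (n : nat) :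
  (forall k, (k < n)%nat -> Cmod (a k) <= c k)%R ->
  (Cmod (Cprod (fun k => 1 + a k)%C n - 1) <= exp (Rsum c n) - 1)%R /\
  (Cmod (Cprod (fun k => 1 + a k)%C n - 1 - Csum a n)
     <= exp (Rsum c n) - 1 - Rsum c n)%R.
Proof.
  induction n as [|n IH]; intros H; simpl.
  - rewrite exp_0. replace (1 - 1) with (RtoC 0) by ring.
    replace (0 - 0) with (RtoC 0) by ring. rewrite Cmod_0. lra.
  - destruct IH as [IH1 IH2]; [intros; apply H; lia|].
    set (p := Cprod (fun k => 1 + a k)%C n) in *. set (s := Csum a n) in *.
    set (r := Rsum c n) in *.
    assert (Hc : (Cmod (a n) <= c n)%R) by (apply H; lia).
    pose proof (Cmod_ge_0 (a n)).
    assert (Hp : (Cmod p <= exp r)%R)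
      by (apply Cprod_bound; intros; apply H; lia).
    assert (He : (exp r * (1 + c n) <= exp (r + c n))%R).
    { rewrite exp_plus. apply Rmult_le_compat_l; [apply Rlt_le, exp_pos|].
      apply exp_ineq1_le. }
    split.
    + replace (p * (1 + a n) - 1) with ((p - 1) + p * a n) by ring.
      eapply Rle_trans; [apply Cmod_triangle|]. rewrite Cmod_mult.
      assert (Cmod p * Cmod (a n) <= exp r * c n)%R
        by (apply Rmult_le_compat; auto; apply Cmod_ge_0). lra.
    + replace (p * (1 + a n) - 1 - (s + a n))
        with ((p - 1 - s) + (p - 1) * a n) by ring.
      eapply Rle_trans; [apply Cmod_triangle|]. rewrite Cmod_mult.
      assert (Cmod (p - 1) * Cmod (a n) <= (exp r - 1) * c n)%R
        by (apply Rmult_le_compat; auto; apply Cmod_ge_0). lra.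
Qed.

(** From (1 - s) e^s <= 1 comes e^s - 1 <= s e^s; using it twice gives e^s - 1 - s <= s (e^s - 1) <=
    s^2 e^s. *)
Lemma exp_second_order (s : R) : (0 <= s -> exp s - 1 - s <= s ^ 2 * exp s)%R.
Proof.
  intros Hs. pose proof (exp_ineq1_le (- s)) as H. rewrite exp_Ropp in H.
  pose proof (exp_pos s) as Hp.
  assert (H1 : ((1 + - s) * exp s <= 1)%R).
  { replace 1%R with (/ exp s * exp s)%R at 2 by (field; lra).
    apply Rmult_le_compat_r; lra. }
  nra.
Qed.

(** If every factor is 1 + s b_k up to an error of order |s|^2/k^2, the product is 1 + s B +
    O(|s|^2): it is differentiable at s = 0 with derivative the sum of the [b k]. The quadratic
    remainder is proved on partial products, uniformly in their length, and passed to the limit. *)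
Lemma infinite_product_derivative (a : C -> nat -> C) (b : nat -> C)
    (h : C -> C) (B : C) (K delta : R) :
  (0 < delta <= 1)%R ->
  (forall s k, (Cmod s <= delta)%R ->
     (Cmod (a s k - s * b k) <= K * Cmod s ^ 2 * inv_sq k)%R) ->
  (forall k, (Cmod (b k) <= K * inv_sq k)%R) ->
  (forall s, (Cmod s <= delta)%R -> Ccv (Cprod (fun k => 1 + a s k)%C) (h s)) ->
  Ccv (Csum b) B ->
  exists K', forall s, (Cmod s <= delta)%R ->
    (Cmod (h s - 1 - s * B) <= K' * Cmod s ^ 2)%R.
Proof.
  intros Hd Ha Hb Hh HB.
  assert (HK : (0 <= K)%R).
  { specialize (Hb O). pose proof (inv_sq_pos O). pose proof (Cmod_ge_0 (b O)). nra. }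
  set (Z := Series inv_sq).
  assert (HZ : forall n, (Rsum inv_sq n <= Z)%R).
  { intros n. apply Rsum_le_Series; [intros; apply Rlt_le, inv_sq_pos|].
    apply ex_series_inv_sq. }
  assert (HZ0 : (0 <= Z)%R) by apply (HZ O).
  (* The first summand bounds the terms of degree at least two of the expanded product, since each
     [a s k] is at most [2 * K * Cmod s * inv_sq k]; the second bounds the accumulated errors
     [a s k - s * b k]. *)
  exists ((2 * K * Z) ^ 2 * exp (2 * K * Z) + K * Z)%R.
  intros s Hs.
  pose proof (Cmod_ge_0 s) as Hs0.
  apply (Ccv_bounded_by (fun n => Cprod (fun k => 1 + a s k)%C n - 1 - s * Csum b n)).
  { apply Ccv_minus; [apply Ccv_minus; [apply Hh, Hs | apply Ccv_const]|].
    now apply Ccv_scal. }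
  intros n.
  assert (Hak : forall k, (Cmod (a s k) <= 2 * K * Cmod s * inv_sq k)%R).
  { intros k. replace (a s k) with ((a s k - s * b k) + s * b k) by ring.
    eapply Rle_trans; [apply Cmod_triangle|]. rewrite Cmod_mult.
    specialize (Ha s k Hs). specialize (Hb k).
    assert (H1 : (Cmod s * Cmod (b k) <= Cmod s * (K * inv_sq k))%R)
      by (apply Rmult_le_compat_l; auto).
    assert (H2 : (Cmod s * (Cmod s * (K * inv_sq k)) <= 1 * (Cmod s * (K * inv_sq k)))%R).
    { pose proof (inv_sq_pos k). apply Rmult_le_compat_r; [|lra].
      repeat apply Rmult_le_pos; lra. }
    nra. }
  destruct (Cprod_second_order (a s) (fun k => 2 * K * Cmod s * inv_sq k)%R n)
    as [_ H2]; [intros; apply Hak|].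
  rewrite Rsum_scal in H2.
  replace (Cprod (fun k => 1 + a s k)%C n - 1 - s * Csum b n)
    with ((Cprod (fun k => 1 + a s k)%C n - 1 - Csum (a s) n)
          + Csum (fun k => a s k - s * b k) n)
    by (rewrite Csum_minus, Csum_scal; ring).
  eapply Rle_trans; [apply Cmod_triangle|].
  rewrite Rmult_plus_distr_r. apply Rplus_le_compat.
  - eapply Rle_trans; [exact H2|].
    set (r := Rsum inv_sq n) in *. specialize (HZ n). fold r in HZ.
    assert (Hr0 : (0 <= r)%R).
    { unfold r. clear. induction n; simpl; [lra|]. pose proof (inv_sq_pos n). lra. }
    assert (Ht : (0 <= 2 * K * Cmod s * r <= 2 * K * Z * Cmod s)%R).
    { split; [repeat apply Rmult_le_pos; lra|].
      replace (2 * K * Z * Cmod s)%R with (2 * K * Cmod s * Z)%R by ring.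
      apply Rmult_le_compat_l; [repeat apply Rmult_le_pos; lra | exact HZ]. }
    eapply Rle_trans; [apply exp_second_order; lra|].
    replace ((2 * K * Z) ^ 2 * exp (2 * K * Z) * Cmod s ^ 2)%R
      with ((2 * K * Z * Cmod s) ^ 2 * exp (2 * K * Z))%R by ring.
    apply Rmult_le_compat; [apply pow2_ge_0 | apply Rlt_le, exp_pos | |].
    + apply pow_incr. exact Ht.
    + apply exp_le. eapply Rle_trans; [apply Ht|].
      rewrite <- (Rmult_1_r (2 * K * Z)) at 2. apply Rmult_le_compat_l; [|lra].
      repeat apply Rmult_le_pos; lra.
  - eapply Rle_trans.
    + apply (Cmod_Csum_le _ (fun k => K * Cmod s ^ 2 * inv_sq k)%R). intros; now apply Ha.
    + rewrite Rsum_scal.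
      replace (K * Z * Cmod s ^ 2)%R with (K * Cmod s ^ 2 * Z)%R by ring.
      apply Rmult_le_compat_l; [|apply HZ].
      apply Rmult_le_pos; [lra | apply pow2_ge_0].
Qed.

(** * The Gamma and digamma functions *)

Lemma Cexp_plus (a b : C) : Cexp (a + b) = Cexp a * Cexp b.
Proof.
  unfold Cexp. destruct a as [a1 a2], b as [b1 b2]. simpl.
  rewrite exp_plus, cos_plus, sin_plus.
  apply injective_projections; simpl; ring.
Qed.

Lemma Cexp_0 : Cexp 0 = 1.
Proof.
  unfold Cexp. simpl. rewrite exp_0, cos_0, sin_0.
  apply injective_projections; simpl; ring.
Qed.

Lemma Cexp_opp_l (a : C) : Cexp (- a) * Cexp a = 1.
Proof.
  rewrite <- Cexp_plus. replace (- a + a) with (RtoC 0) by ring. apply Cexp_0.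
Qed.

(** * Second-order estimates for the sine and the exponential *)

Lemma Rabs_sin_le (x : R) : (Rabs (sin x) <= Rabs x)%R.
Proof.
  assert (H : forall x, (0 <= x -> Rabs (sin x) <= x)%R).
  { clear x. intros x Hx. destruct (Rle_lt_dec x 1) as [H1 | H1].
    - destruct Hx as [Hx | <-]; [|rewrite sin_0, Rabs_R0; lra].
      assert (0 < sin x)%R.
      { apply sin_gt_0; [lra|]. pose proof PI2_1. lra. }
      rewrite Rabs_pos_eq by lra. apply Rlt_le, sin_lt_x, Hx.
    - pose proof (SIN_bound x). apply Rabs_le. lra. }
  destruct (Rle_lt_dec 0 x) as [Hx | Hx].
  - rewrite (Rabs_pos_eq x) by lra. now apply H.
  - rewrite (Rabs_left x) by lra. rewrite <- Rabs_Ropp, <- sin_neg. apply H. lra.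
Qed.

Lemma one_minus_cos_le (x : R) : (0 <= 1 - cos x <= x ^ 2 / 2 /\ 1 - cos x <= Rabs x)%R.
Proof.
  assert (E : (1 - cos x = 2 * (Rabs (sin (x / 2)) * Rabs (sin (x / 2))))%R).
  { rewrite <- Rabs_mult, Rabs_pos_eq by apply Rle_0_sqr.
    replace x with (2 * (x / 2))%R at 1 by field.
    rewrite cos_2a_sin. ring. }
  rewrite E.
  pose proof (Rabs_sin_le (x / 2)) as H.
  pose proof (Rabs_pos (sin (x / 2))) as H0.
  assert (H1 : (Rabs (sin (x / 2)) <= 1)%R)
    by (apply Rabs_le; pose proof (SIN_bound (x / 2)); lra).
  assert (E2 : Rabs (x / 2) = (Rabs x / 2)%R).
  { unfold Rdiv. rewrite Rabs_mult, (Rabs_pos_eq (/ 2)) by lra. reflexivity. }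
  rewrite E2 in H.
  assert (E3 : (x ^ 2 = Rabs x ^ 2)%R) by (rewrite pow2_abs; reflexivity).
  rewrite E3. pose proof (Rabs_pos x). repeat split; nra.
Qed.

(** For x >= 0 the function t^2 + sin t - t increases from 0, since its derivative 2t + cos t - 1 is
    nonnegative by 1 - cos t <= t. *)
Lemma sin_second_order (x : R) : (Rabs (sin x - x) <= x ^ 2)%R.
Proof.
  assert (H : forall x, (0 <= x -> Rabs (sin x - x) <= x ^ 2)%R).
  { clear x. intros x Hx.
    pose proof (Rabs_sin_le x) as Hs. rewrite (Rabs_pos_eq x) in Hs by lra.
    assert (Hs' : (sin x <= x)%R) by (eapply Rle_trans; [apply Rle_abs | exact Hs]).
    destruct Hx as [Hx | <-]; [|rewrite sin_0; simpl; rewrite Rminus_0_r, Rabs_R0; lra].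
    destruct (MVT_gen (fun t => t ^ 2 + sin t - t)%R 0 x
                (fun t => 2 * t + cos t - 1)%R) as [c [Hc E]].
    - intros t _. auto_derive; [trivial | ring].
    - intros t _. apply continuity_pt_filterlim.
      apply (ex_derive_continuous (fun t => t ^ 2 + sin t - t)%R). auto_derive. trivial.
    - rewrite Rmin_left, Rmax_right in Hc by lra. rewrite sin_0 in E.
      pose proof (one_minus_cos_le c) as [_ H]. rewrite Rabs_pos_eq in H by lra.
      rewrite Rabs_left1 by lra.
      assert (0 <= (2 * c + cos c - 1) * (x - 0))%R by (apply Rmult_le_pos; lra).
      simpl in *. lra. }
  destruct (Rle_lt_dec 0 x) as [Hx | Hx]; [now apply H|].
  specialize (H (- x)%R). rewrite sin_neg in H.
  replace (- sin x - - x)%R with (- (sin x - x))%R in H by ring.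
  rewrite Rabs_Ropp in H. replace ((- x) ^ 2)%R with (x ^ 2)%R in H by ring.
  apply H. lra.
Qed.

Lemma Rabs_exp_second_order (a : R) :
  (Rabs (exp a - 1) <= Rabs a * exp (Rabs a) /\
   Rabs (exp a - 1 - a) <= a ^ 2 * exp (Rabs a))%R.
Proof.
  pose proof (exp_ineq1_le a) as H1. pose proof (exp_ineq1_le (- a)) as H2.
  pose proof (exp_pos a) as Hp. rewrite exp_Ropp in H2.
  destruct (Rle_lt_dec 0 a) as [Ha | Ha].
  - rewrite (Rabs_pos_eq a) by lra.
    assert (H3 : ((1 + - a) * exp a <= 1)%R).
    { replace 1%R with (/ exp a * exp a)%R at 2 by (field; lra).
      apply Rmult_le_compat_r; lra. }
    rewrite !Rabs_pos_eq by lra. split; [lra|]. now apply exp_second_order.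
  - rewrite (Rabs_left a) by lra.
    assert (H3 : ((1 + - a) * exp a <= 1)%R).
    { replace 1%R with (/ exp a * exp a)%R at 2 by (field; lra).
      apply Rmult_le_compat_r; lra. }
    assert (H4 : (1 <= exp (- a))%R) by (pose proof (exp_ineq1_le (- a)); lra).
    rewrite (Rabs_left1 (exp a - 1)) by nra. rewrite Rabs_pos_eq by lra. split.
    + nra.
    + assert (exp a - 1 - a <= a ^ 2)%R by nra.
      pose proof (pow2_ge_0 a). nra.
Qed.

Lemma Cmod_le_Re_Im (z : C) : (Cmod z <= Rabs (Re z) + Rabs (Im z))%R.
Proof.
  replace z with (RtoC (Re z) + Ci * RtoC (Im z)) at 1.
  - eapply Rle_trans; [apply Cmod_triangle|].
    rewrite Cmod_mult, Cmod_Ci, !Cmod_R. lra.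
  - apply injective_projections; simpl; unfold Re, Im; ring.
Qed.

Lemma Cexp_second_order (M : R) (w : C) :
  (Cmod w <= M)%R -> (Cmod (Cexp w - 1 - w) <= 4 * exp M * Cmod w ^ 2)%R.
Proof.
  intros HM. set (a := Re w). set (b := Im w).
  pose proof (re_le_Cmod w : (Rabs a <= Cmod w)%R) as Ha.
  pose proof (im_le_Cmod w : (Rabs b <= Cmod w)%R) as Hb.
  (* With w = a + ib, the remainder is split into e^a ((cos b - 1) + i (sin b - b)), e^a - 1 - a and
     i b (e^a - 1). They contribute 2, 1 and 1 to the constant 4. *)
  replace (Cexp w - 1 - w)
    with (RtoC (exp a) * (cos b - 1, sin b - b)%R
          + (RtoC (exp a - 1 - a) + Ci * RtoC (b * (exp a - 1)))).
  2: { unfold Cexp. fold a b. apply injective_projections; simpl;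
       [change (fst w) with a | change (snd w) with b]; ring. }
  destruct (Rabs_exp_second_order a) as [E1 E2].
  assert (HeM : (exp (Rabs a) <= exp M)%R) by (apply exp_le; lra).
  assert (Hea : (exp a <= exp M)%R)
    by (apply exp_le; pose proof (Rle_abs a); lra).
  pose proof (exp_pos a). pose proof (exp_pos M).
  set (m := Cmod w) in *. pose proof (Rabs_pos a). pose proof (Rabs_pos b).
  assert (Sa : (a ^ 2 <= m ^ 2)%R) by (rewrite <- pow2_abs; apply pow_incr; lra).
  assert (Sb : (b ^ 2 <= m ^ 2)%R) by (rewrite <- pow2_abs; apply pow_incr; lra).
  eapply Rle_trans; [apply Cmod_triangle|].
  eapply Rle_trans; [apply Rplus_le_compat_l, Cmod_triangle|].
  rewrite !Cmod_mult, Cmod_Ci, !Cmod_R, Rabs_mult.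
  rewrite (Rabs_pos_eq (exp a)) by lra.
  assert (T1 : (Cmod (cos b - 1, sin b - b)%R <= 2 * m ^ 2)%R).
  { eapply Rle_trans; [apply Cmod_le_Re_Im|]. simpl Re; simpl Im.
    pose proof (sin_second_order b). pose proof (one_minus_cos_le b).
    rewrite (Rabs_left1 (cos b - 1)) by lra. lra. }
  assert (T1' : (exp a * Cmod (cos b - 1, sin b - b)%R <= exp M * (2 * m ^ 2))%R)
    by (apply Rmult_le_compat; try apply Cmod_ge_0; lra).
  assert (T2 : (Rabs (exp a - 1 - a) <= m ^ 2 * exp M)%R).
  { eapply Rle_trans; [exact E2|].
    apply Rmult_le_compat; try lra; [apply pow2_ge_0 | apply Rlt_le, exp_pos]. }
  assert (T3 : (Rabs b * Rabs (exp a - 1) <= m * (m * exp M))%R).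
  { apply Rmult_le_compat; try lra; [apply Rabs_pos|].
    eapply Rle_trans; [exact E1|].
    apply Rmult_le_compat; try lra. apply Rlt_le, exp_pos. }
  lra.
Qed.

(** The increment of ln(n + 1). It distributes the power n^s of the Gauss product over the
    individual factors. *)
Definition log_step (k : nat) : R := ln ((INR k + 2) / (INR k + 1)).

Lemma Rsum_log_step (n : nat) : Rsum log_step n = ln (INR n + 1).
Proof.
  induction n as [|n IH].
  - simpl. rewrite Rplus_0_l, ln_1. reflexivity.
  - cbn [Rsum]. rewrite IH, S_INR. unfold log_step. pose proof (pos_INR n).
    rewrite <- ln_mult; [f_equal; field; lra | lra |].
    apply Rdiv_lt_0_compat; lra.
Qed.

(** Applying 1 + t <= e^t to the ratio and to its inverse places the logarithm between 1/(k+2) and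
    1/(k+1), whose gap is below 1/(k+1)^2. *)
Lemma log_step_bounds (k : nat) :
  (0 <= log_step k <= / (INR k + 1) /\ / (INR k + 1) - log_step k <= inv_sq k)%R.
Proof.
  pose proof (pos_INR k) as Hk. unfold log_step, inv_sq. set (x := INR k) in *.
  assert (H1 : (ln ((x + 2) / (x + 1)) <= / (x + 1))%R).
  { rewrite <- (ln_exp (/ (x + 1))). apply ln_le; [apply Rdiv_lt_0_compat; lra|].
    eapply Rle_trans; [|apply exp_ineq1_le]. right. field. lra. }
  assert (H2 : (/ (x + 2) <= ln ((x + 2) / (x + 1)))%R).
  { assert (Hm : (ln ((x + 1) / (x + 2)) <= - / (x + 2))%R).
    { rewrite <- (ln_exp (- / (x + 2))). apply ln_le; [apply Rdiv_lt_0_compat; lra|].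
      eapply Rle_trans; [|apply exp_ineq1_le]. right. field. lra. }
    replace ((x + 2) / (x + 1))%R with (/ ((x + 1) / (x + 2)))%R by (field; lra).
    rewrite ln_Rinv by (apply Rdiv_lt_0_compat; lra). lra. }
  assert (H3 : (0 < / (x + 2))%R) by (apply Rinv_0_lt_compat; lra).
  repeat split; try lra.
  assert (H4 : (/ (x + 1) - / (x + 2) <= / (x + 1) ^ 2)%R); [|lra].
  replace (/ (x + 1) - / (x + 2))%R with (/ (x + 1) ^ 2 - / ((x + 1) ^ 2 * (x + 2)))%R
    by (field; lra).
  assert (0 < / ((x + 1) ^ 2 * (x + 2)))%R; [|lra].
  apply Rinv_0_lt_compat, Rmult_lt_0_compat; [apply pow_lt|]; lra.
Qed.

Lemma not_Gamma_pole_neq_0 (z : C) (k : nat) : not_Gamma_pole z -> z + INR k <> 0.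
Proof.
  intros Hz E. apply (Hz k).
  replace z with (z + INR k - INR k) by ring. rewrite E. ring.
Qed.

Lemma not_Gamma_pole_lower_bound (z : C) : not_Gamma_pole z ->
  exists c, (0 < c)%R /\ forall k, (c * (INR k + 1) <= Cmod (z + INR k))%R.
Proof.
  intros Hz.
  assert (H : forall N, exists c, (0 < c)%R /\
    forall k, (k < N)%nat -> (c * (INR k + 1) <= Cmod (z + INR k))%R).
  { induction N as [|N [c [Hc IH]]].
    - exists 1%R. split; [lra | intros; lia].
    - pose proof (pos_INR N).
      assert (Hp : (0 < Cmod (z + INR N) / (INR N + 1))%R).
      { apply Rdiv_lt_0_compat; [|lra]. now apply Cmod_gt_0, not_Gamma_pole_neq_0. }
      exists (Rmin c (Cmod (z + INR N) / (INR N + 1))).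
      split; [now apply Rmin_glb_lt|].
      intros k Hk. pose proof (pos_INR k).
      destruct (Nat.eq_dec k N) as [-> | Hn].
      + apply Rle_trans with (Cmod (z + INR N) / (INR N + 1) * (INR N + 1))%R.
        * apply Rmult_le_compat_r; [lra | apply Rmin_r].
        * right. field. lra.
      + apply Rle_trans with (c * (INR k + 1))%R; [|apply IH; lia].
        apply Rmult_le_compat_r; [lra | apply Rmin_l]. }
  (* For k > N one has 2 |z| + 1 < k, hence |z + k| >= k - |z| > (k + 1)/4; the finitely many
     smaller k are covered by the minimum in [H]. *)
  destruct (nfloor_ex (2 * Cmod z + 1)) as [N [_ HN]];
    [pose proof (Cmod_ge_0 z); lra|].
  destruct (H (S N)) as [c [Hc Hk]].
  exists (Rmin c (/ 4)). split; [apply Rmin_glb_lt; lra|].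
  intros k. pose proof (pos_INR k).
  destruct (Nat.lt_ge_cases k (S N)) as [Hlt | Hge].
  - eapply Rle_trans; [|apply Hk, Hlt]. apply Rmult_le_compat_r; [lra | apply Rmin_l].
  - apply Rle_trans with (/ 4 * (INR k + 1))%R.
    + apply Rmult_le_compat_r; [lra | apply Rmin_r].
    + apply le_INR in Hge. rewrite S_INR in Hge.
      pose proof (Cmod_triangle_rev (INR k) (- z)) as T.
      replace (INR k - - z) with (z + INR k) in T by ring.
      rewrite Cmod_opp, Cmod_R, Rabs_pos_eq in T by lra. lra.
Qed.

(* Factor of the Euler-Gauss quotient Gamma (z + s) / Gamma z, minus 1. *)
Definition gauss_defect (z s : C) (k : nat) : C :=
  Cexp (s * log_step k) * (z + INR k) / (z + s + INR k) - 1.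

(** The derivative of [gauss_defect z s k] in [s] at 0. With [log_step k] in place of 1/(k+1), the
    digamma series carries no separate Euler constant. *)
Definition psi_term (z : C) (k : nat) : C := log_step k - / (z + INR k).

Lemma psi_term_bound (z : C) (c : R) (k : nat) :
  (0 < c)%R -> (c * (INR k + 1) <= Cmod (z + INR k))%R ->
  (Cmod (psi_term z k) <= (1 + Cmod (z - 1) / c) * inv_sq k)%R.
Proof.
  intros Hc Hk. pose proof (pos_INR k) as Hk0. unfold psi_term.
  destruct (log_step_bounds k) as [H1 H2].
  assert (Hz : z + INR k <> 0).
  { intros E. rewrite E, Cmod_0 in Hk.
    assert (0 < c * (INR k + 1))%R by (apply Rmult_lt_0_compat; lra). lra. }
  assert (Hk1 : RtoC (INR k) + 1 <> 0).
  { rewrite <- RtoC_plus. intros E. apply RtoC_inj in E. lra. }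
  (* Inserting 1/(k+1) separates the real error of [log_step] from 1/(k+1) - 1/(z+k) =
     (z-1)/((k+1)(z+k)). *)
  replace (log_step k - / (z + INR k))
    with (RtoC (log_step k - / (INR k + 1)) + (z - 1) * (/ (INR k + 1) * / (z + INR k))).
  2: { rewrite RtoC_minus, RtoC_inv, RtoC_plus by lra. field. auto. }
  eapply Rle_trans; [apply Cmod_triangle|].
  rewrite Rmult_plus_distr_r. apply Rplus_le_compat.
  - rewrite Cmod_R, Rabs_left1 by lra. lra.
  - rewrite !Cmod_mult, !Cmod_inv by auto.
    rewrite <- RtoC_plus, Cmod_R, Rabs_pos_eq by lra.
    unfold Rdiv. rewrite Rmult_assoc. apply Rmult_le_compat_l; [apply Cmod_ge_0|].
    unfold inv_sq.
    apply Rle_trans with (/ (INR k + 1) * / (c * (INR k + 1)))%R.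
    + apply Rmult_le_compat_l; [apply Rlt_le, Rinv_0_lt_compat; lra|].
      apply Rinv_le_contravar; [apply Rmult_lt_0_compat; lra | exact Hk].
    + right. field. lra.
Qed.

Lemma gauss_defect_bound (z s : C) (c M : R) (k : nat) :
  (0 < c)%R -> (c * (INR k + 1) <= Cmod (z + INR k))%R ->
  (c * (INR k + 1) <= Cmod (z + s + INR k))%R -> (Cmod s <= M)%R ->
  (Cmod (gauss_defect z s k - s * psi_term z k) <=
     (/ c ^ 2 + 4 * exp M + / c + 4 * exp M * M / c) * Cmod s ^ 2 * inv_sq k)%R.
Proof.
  intros Hc Hk Hks HM. pose proof (pos_INR k) as Hk0.
  destruct (log_step_bounds k) as [H1 _].
  assert (Hck : (0 < c * (INR k + 1))%R) by (apply Rmult_lt_0_compat; lra).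
  assert (Hz : z + INR k <> 0) by (intros E; rewrite E, Cmod_0 in Hk; lra).
  assert (Hzs : z + s + INR k <> 0) by (intros E; rewrite E, Cmod_0 in Hks; lra).
  unfold gauss_defect, psi_term.
  set (l := log_step k) in *. set (w := s * l).
  assert (Hw : (Cmod w = Cmod s * l)%R).
  { unfold w. rewrite Cmod_mult, Cmod_R, Rabs_pos_eq; [reflexivity | apply H1]. }
  pose proof (Cmod_ge_0 s) as Hs0.
  set (q := (/ (INR k + 1))%R) in *.
  assert (Hq : (0 < q <= 1)%R).
  { split; [apply Rinv_0_lt_compat; lra|].
    rewrite <- Rinv_1. apply Rinv_le_contravar; lra. }
  assert (Hwq : (Cmod w <= Cmod s * q)%R) by (rewrite Hw; apply Rmult_le_compat_l; lra).
  assert (HwM : (Cmod w <= M)%R) by nra.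
  pose proof (Cexp_second_order M w HwM) as HE.
  set (E := Cexp w - 1 - w) in *.
  assert (Ew : Cexp w = 1 + w + E) by (unfold E; ring).
  rewrite Ew.
  (* The linear terms cancel, and the four quadratic terms that remain give, in this order, the four
     coefficients of the bound. *)
  replace ((1 + w + E) * (z + INR k) / (z + s + INR k) - 1 - s * (l - / (z + INR k)))
    with (s ^ 2 * (/ (z + INR k) * / (z + s + INR k)) + E
          - (s * w * / (z + s + INR k) + E * (s * / (z + s + INR k))))
    by (unfold w; field; auto).
  assert (HiA : (/ Cmod (z + INR k) <= / c * q)%R).
  { unfold q. rewrite <- Rinv_mult. apply Rinv_le_contravar; auto. }
  assert (HiB : (/ Cmod (z + s + INR k) <= / c * q)%R).
  { unfold q. rewrite <- Rinv_mult. apply Rinv_le_contravar; auto. }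
  assert (HpA : (0 < / Cmod (z + INR k))%R)
    by (apply Rinv_0_lt_compat; lra).
  assert (HpB : (0 < / Cmod (z + s + INR k))%R)
    by (apply Rinv_0_lt_compat; lra).
  eapply Rle_trans; [apply Cmod_triangle_minus|].
  eapply Rle_trans; [apply Rplus_le_compat; apply Cmod_triangle|].
  rewrite !Cmod_mult, !Cmod_inv by auto. rewrite Cmod_pow.
  set (A := (/ Cmod (z + INR k))%R) in *.
  set (B := (/ Cmod (z + s + INR k))%R) in *.
  set (m := Cmod s) in *. set (eM := exp M) in *.
  assert (HeM : (0 < eM)%R) by apply exp_pos.
  assert (HE' : (Cmod E <= 4 * eM * m ^ 2 * q ^ 2)%R).
  { eapply Rle_trans; [exact HE|].
    replace (4 * eM * m ^ 2 * q ^ 2)%R with (4 * eM * (m * q) ^ 2)%R by ring.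
    apply Rmult_le_compat_l; [lra|].
    apply pow_incr. split; [apply Cmod_ge_0 | exact Hwq]. }
  assert (Eq : inv_sq k = (q ^ 2)%R) by (unfold inv_sq, q; field; lra).
  rewrite Eq.
  assert (Hic : (0 < / c)%R) by (apply Rinv_0_lt_compat; lra).
  assert (Hq2 : (0 <= q ^ 2)%R) by apply pow2_ge_0.
  assert (Hm2 : (0 <= m ^ 2)%R) by apply pow2_ge_0.
  assert (T1 : (m ^ 2 * (A * B) <= / c ^ 2 * m ^ 2 * q ^ 2)%R).
  { apply Rle_trans with (m ^ 2 * ((/ c * q) * (/ c * q)))%R.
    - apply Rmult_le_compat_l; [lra|]. apply Rmult_le_compat; lra.
    - right. field. lra. }
  assert (T3 : (m * Cmod w * B <= / c * m ^ 2 * q ^ 2)%R).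
  { apply Rle_trans with (m * (m * q) * (/ c * q))%R; [|right; field; lra].
    apply Rmult_le_compat; [|lra| |lra].
    - apply Rmult_le_pos; [lra | apply Cmod_ge_0].
    - apply Rmult_le_compat_l; lra. }
  assert (T4 : (Cmod E * (m * B) <= 4 * eM * M / c * m ^ 2 * q ^ 2)%R).
  { apply Rle_trans with (4 * eM * m ^ 2 * q ^ 2 * (M * / c))%R; [|right; field; lra].
    apply Rmult_le_compat; [apply Cmod_ge_0 | apply Rmult_le_pos; lra | exact HE' |].
    apply Rmult_le_compat; try lra.
    eapply Rle_trans; [exact HiB|]. rewrite <- (Rmult_1_r (/ c)) at 2.
    apply Rmult_le_compat_l; lra. }
  lra.
Qed.

Lemma is_lim_seq_inv_S : is_lim_seq (fun n => / (INR n + 1))%R 0%R.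
Proof.
  apply (is_lim_seq_ext (fun n => / INR (S n))%R); [intros n; now rewrite S_INR|].
  apply (is_lim_seq_incr_1 (fun n => / INR n)%R).
  replace (Finite 0) with (Rbar_inv p_infty) by reflexivity.
  apply is_lim_seq_inv; [apply is_lim_seq_INR | discriminate].
Qed.

Lemma Cexp_cv_1 (s : C) (r : nat -> R) :
  is_lim_seq r 0%R -> Ccv (fun n => Cexp (s * r n)) 1.
Proof.
  intros Hr.
  assert (Hw : is_lim_seq (fun n => Cmod (s * r n)) 0%R).
  { apply (is_lim_seq_ext (fun n => Cmod s * Rabs (r n))%R).
    - intros n. now rewrite Cmod_mult, Cmod_R.
    - apply is_lim_seq_scal_0. now apply (proj1 (is_lim_seq_abs_0 _)). }
  assert (Hb : exists M, forall n, (Cmod (s * r n) <= M)%R).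
  { destruct (Ccv_bounded (fun n => s * r n) 0) as [M [_ HM]].
    - apply (is_lim_seq_ext (fun n => Cmod (s * r n))); [|exact Hw].
      intros n. f_equal. ring.
    - now exists M. }
  destruct Hb as [M HM].
  apply (Ccv_squeeze _ _
    (fun n => Cmod (s * r n) + 4 * exp M * (Cmod (s * r n) * Cmod (s * r n)))%R).
  - intros n. specialize (HM n). set (w := s * r n) in *.
    replace (Cexp w - 1) with (w + (Cexp w - 1 - w)) by ring.
    eapply Rle_trans; [apply Cmod_triangle|].
    apply Rplus_le_compat_l.
    eapply Rle_trans; [apply (Cexp_second_order M), HM|]. right. ring.
  - apply is_lim_seq_plus_0; [exact Hw|]. apply is_lim_seq_scal_0.
    replace (Finite 0) with (Finite (0 * 0)) by (f_equal; ring).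
    now apply is_lim_seq_mult'.
Qed.

Lemma pochhammer_neq_0 (z : C) (n : nat) : not_Gamma_pole z -> pochhammer z n <> 0.
Proof.
  intros Hz. induction n as [|n IH]; simpl; [apply C1_nz|].
  apply Cmult_neq_0; [exact IH | now apply not_Gamma_pole_neq_0].
Qed.

Lemma Cprod_gauss_defect (z s : C) (n : nat) :
  not_Gamma_pole (z + s) ->
  Cprod (fun k => 1 + gauss_defect z s k) n
  = Cexp (s * ln (INR n + 1)) * pochhammer z n / pochhammer (z + s) n.
Proof.
  intros Hz. induction n as [|n IH].
  - simpl. rewrite Rplus_0_l, ln_1, Cmult_0_r, Cexp_0. field.
  - cbn [Cprod pochhammer]. rewrite IH, <- !Rsum_log_step. cbn [Rsum].
    rewrite RtoC_plus.
    replace (s * (Rsum log_step n + log_step n))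
      with (s * Rsum log_step n + s * log_step n) by ring.
    rewrite Cexp_plus. unfold gauss_defect. field.
    split; [now apply not_Gamma_pole_neq_0 | now apply pochhammer_neq_0].
Qed.

Definition gauss_seq (z : C) (n : nat) : C :=
  INR (fact n) * Cexp (z * ln (INR n)) / pochhammer z (S n).

(** [h] is the future quotient Gamma(z + s)/Gamma(z). That it differs from 0 is what makes [CGamma]
    nonzero off its poles, so that the logarithmic derivative can be formed. *)
Lemma gauss_quotient_cv (z s : C) :
  not_Gamma_pole z -> not_Gamma_pole (z + s) ->
  exists h : C, h <> 0 /\ Ccv (Cprod (fun k => 1 + gauss_defect z s k)) h.
Proof.
  assert (H : forall z s, not_Gamma_pole z -> not_Gamma_pole (z + s) ->
    exists h, Ccv (Cprod (fun k => 1 + gauss_defect z s k)) h).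
  { clear z s. intros z s Hz Hzs.
    destruct (not_Gamma_pole_lower_bound z Hz) as [c1 [Hc1 B1]].
    destruct (not_Gamma_pole_lower_bound _ Hzs) as [c2 [Hc2 B2]].
    set (c := Rmin c1 c2).
    assert (Hc : (0 < c)%R) by now apply Rmin_glb_lt.
    assert (Bc1 : forall k, (c * (INR k + 1) <= Cmod (z + INR k))%R).
    { intros k. eapply Rle_trans; [|apply B1]. pose proof (pos_INR k).
      apply Rmult_le_compat_r; [lra | apply Rmin_l]. }
    assert (Bc2 : forall k, (c * (INR k + 1) <= Cmod (z + s + INR k))%R).
    { intros k. eapply Rle_trans; [|apply B2]. pose proof (pos_INR k).
      apply Rmult_le_compat_r; [lra | apply Rmin_r]. }
    pose (K := ((/ c ^ 2 + 4 * exp (Cmod s) + / c + 4 * exp (Cmod s) * Cmod s / c)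
                * Cmod s ^ 2 + Cmod s * (1 + Cmod (z - 1) / c))%R).
    apply (Cprod_cv _ (fun k => K * inv_sq k)%R).
    - intros k.
      replace (gauss_defect z s k)
        with ((gauss_defect z s k - s * psi_term z k) + s * psi_term z k) by ring.
      eapply Rle_trans; [apply Cmod_triangle|]. unfold K.
      rewrite Rmult_plus_distr_r. apply Rplus_le_compat.
      + apply gauss_defect_bound; auto. apply Rle_refl.
      + rewrite Cmod_mult, Rmult_assoc. apply Rmult_le_compat_l; [apply Cmod_ge_0|].
        now apply psi_term_bound.
    - apply (ex_series_scal K inv_sq), ex_series_inv_sq. }
  intros Hz Hzs. destruct (H z s Hz Hzs) as [h Hh].
  assert (E : z + s + - s = z) by ring.
  destruct (H (z + s) (- s)) as [h' Hh']; [exact Hzs | now rewrite E |].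
  exists h. split; [|exact Hh].
  (* The quotient for [(z + s, - s)] is the inverse of the one for [(z, s)]. *)
  intros E0. apply C1_nz.
  rewrite <- (Cmult_0_l h'), <- E0.
  apply (Ccv_unique (fun n => Cprod (fun k => 1 + gauss_defect z s k) n
                     * Cprod (fun k => 1 + gauss_defect (z + s) (- s) k) n)).
  - apply (Ccv_ext (fun _ => 1)); [|apply Ccv_const].
    intros n. rewrite !Cprod_gauss_defect by (rewrite ?E; assumption). rewrite E.
    replace (- s * ln (INR n + 1)) with (- (s * ln (INR n + 1))) by ring.
    pose proof (Cexp_opp_l (s * ln (INR n + 1))) as He.
    rewrite <- He at 1. field.
    split; apply pochhammer_neq_0; assumption.
  - now apply Ccv_mult.
Qed.

Lemma gauss_seq_shift (z s h l : C) :
  not_Gamma_pole z -> not_Gamma_pole (z + s) ->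
  Ccv (Cprod (fun k => 1 + gauss_defect z s k)) h ->
  Ccv (gauss_seq z) l -> Ccv (gauss_seq (z + s)) (l * h).
Proof.
  intros Hz Hzs Hh Hl.
  (* Dropping [n = 0] avoids the logarithm of zero. At index n + 1 the finite product of length n +
     2 carries the power (n+3)^s where [gauss_seq] has (n+1)^s; the last factor below corrects this
     and tends to 1. *)
  apply Ccv_S.
  apply (Ccv_ext (fun n => gauss_seq z (S n)
     * Cprod (fun k => 1 + gauss_defect z s k) (S (S n))
     * Cexp (s * (- (log_step n + log_step (S n)))%R))).
  - intros n. rewrite Cprod_gauss_defect by assumption. unfold gauss_seq.
    replace ((z + s) * ln (INR (S n)))
      with (z * ln (INR (S n)) + (s * ln (INR (S (S n)) + 1)
            + s * (- (log_step n + log_step (S n)))%R)).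
    2: { rewrite <- Rsum_log_step. cbn [Rsum]. rewrite Rsum_log_step, <- S_INR.
         rewrite !RtoC_opp, !RtoC_plus. ring. }
    rewrite !Cexp_plus. field.
    split; apply pochhammer_neq_0; assumption.
  - replace (l * h) with (l * h * 1) by ring.
    apply Ccv_mult; [apply Ccv_mult|].
    + now apply (Ccv_S (gauss_seq z)).
    + apply -> (Ccv_S (fun n => Cprod (fun k => 1 + gauss_defect z s k) (S n))).
      now apply -> (Ccv_S (Cprod (fun k => 1 + gauss_defect z s k))).
    + apply Cexp_cv_1.
      apply (is_lim_seq_le_le (fun n => - (2 * / (INR n + 1)))%R _ (fun _ => 0%R)).
      * intros n. destruct (log_step_bounds n) as [H1 _].
        destruct (log_step_bounds (S n)) as [H2 _]. rewrite S_INR in H2.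
        assert (/ (INR n + 1 + 1) <= / (INR n + 1))%R.
        { pose proof (pos_INR n). apply Rinv_le_contravar; lra. }
        lra.
      * replace (Finite 0) with (Rbar_opp 0%R) by (simpl; f_equal; ring).
        apply -> is_lim_seq_opp. apply is_lim_seq_scal_0, is_lim_seq_inv_S.
      * apply is_lim_seq_const.
Qed.

Lemma not_Gamma_pole_RtoC (r : R) : (0 < r)%R -> not_Gamma_pole r.
Proof.
  intros Hr n E. rewrite <- RtoC_opp in E. apply RtoC_inj in E.
  pose proof (pos_INR n). lra.
Qed.

Lemma not_Gamma_pole_1 : not_Gamma_pole 1.
Proof. apply not_Gamma_pole_RtoC. lra. Qed.

Lemma pochhammer_1 (m : nat) : pochhammer 1 m = INR (fact m).
Proof.
  induction m as [|m IH]; [reflexivity|].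
  cbn [pochhammer]. rewrite IH, fact_simpl, mult_INR, S_INR, RtoC_mult, RtoC_plus. ring.
Qed.

Lemma gauss_seq_1 : Ccv (gauss_seq 1) 1.
Proof.
  apply Ccv_S.
  apply (Ccv_ext (fun n => RtoC (1 - / (INR (S n) + 1)))).
  - intros n. unfold gauss_seq. rewrite pochhammer_1, (fact_simpl (S n)), mult_INR.
    pose proof (INR_fact_neq_0 (S n)) as Hf. pose proof (pos_INR (S n)) as Hp.
    assert (Hs : (0 < INR (S n))%R) by (apply lt_0_INR; lia).
    replace (Cexp (1 * ln (INR (S n)))) with (RtoC (INR (S n))).
    + rewrite RtoC_mult, (S_INR (S n)), RtoC_minus, RtoC_inv, RtoC_plus by lra.
      assert (RtoC (INR (fact (S n))) <> 0) by (intros E; apply RtoC_inj in E; auto).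
      assert (RtoC (INR (S n)) + 1 <> 0)
        by (rewrite <- RtoC_plus; intros E; apply RtoC_inj in E; lra).
      field. auto.
    + rewrite Cmult_1_l. unfold Cexp. set (r := INR (S n)) in *. simpl Re; simpl Im.
      rewrite exp_ln, cos_0, sin_0 by lra.
      apply injective_projections; simpl; ring.
  - replace (RtoC 1) with (RtoC (1 - 0)) by (f_equal; ring).
    apply Ccv_RtoC, is_lim_seq_minus'; [apply is_lim_seq_const|].
    apply -> (is_lim_seq_incr_1 (fun n => / (INR n + 1))%R). apply is_lim_seq_inv_S.
Qed.

(** The Gauss sequence is explicit at 1, namely n/(n+1); the quotient product with [s = z - 1]
    transports this to [z] and gives a nonzero limit. *)
Lemma CGamma_cv (z : C) : not_Gamma_pole z ->
  CGamma z <> 0 /\ Ccv (gauss_seq z) (CGamma z).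
Proof.
  intros Hz.
  assert (E : z = 1 + (z - 1)) by ring.
  destruct (gauss_quotient_cv 1 (z - 1)) as [h [Hh0 Hh]].
  - apply not_Gamma_pole_1.
  - now rewrite <- E.
  - assert (H : Ccv (gauss_seq z) h).
    { rewrite E. replace h with (1 * h) by ring. apply gauss_seq_shift; auto.
      - apply not_Gamma_pole_1.
      - now rewrite <- E.
      - apply gauss_seq_1. }
    assert (HG : CGamma z = h) by (apply Ccv_C_Lim_seq; exact H).
    rewrite HG. auto.
Qed.

Lemma psi_term_cv (z : C) : not_Gamma_pole z -> exists l, Ccv (Csum (psi_term z)) l.
Proof.
  intros Hz. destruct (not_Gamma_pole_lower_bound z Hz) as [c [Hc B]].
  apply (Csum_abs_cv _ (fun k => (1 + Cmod (z - 1) / c) * inv_sq k)%R).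
  - intros k. now apply psi_term_bound.
  - apply (ex_series_scal (1 + Cmod (z - 1) / c) inv_sq)%R, ex_series_inv_sq.
Qed.

(** A remainder of order |s|^2 is at most eps |s| as soon as |s| <= eps/(|K| + 1). *)
Lemma is_derive_quadratic (f : C -> C) (z l : C) (K delta : R) :
  (0 < delta)%R ->
  (forall s, Cmod s <= delta -> Cmod (f (z + s)%C - f z - s * l)%C <= K * Cmod s ^ 2)%R ->
  is_derive f z l.
Proof.
  intros Hd H. split; [apply is_linear_scal_l|].
  intros x Hx. apply (is_filter_lim_locally_unique (V := AbsRing_NormedModule C_AbsRing)) in Hx.
  subst x.
  intros eps.
  assert (Hr : (0 < Rmin delta (eps / (Rabs K + 1)))%R).
  { apply Rmin_glb_lt; [exact Hd|]. apply Rdiv_lt_0_compat; [apply cond_pos|].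
    pose proof (Rabs_pos K). lra. }
  apply (locally_le_locally_norm (V := AbsRing_NormedModule C_AbsRing) z).
  exists (mkposreal _ Hr). intros y Hy.
  unfold ball_norm in Hy. simpl in Hy.
  change (norm (minus y z)) with (Cmod (y - z)) in Hy.
  change (Cmod (f y - f z - (y - z) * l) <= eps * Cmod (y - z))%R.
  set (s := y - z) in *. replace y with (z + s) by (unfold s; ring).
  assert (Hs1 : (Cmod s <= delta)%R)
    by (apply Rlt_le; eapply Rlt_le_trans; [exact Hy | apply Rmin_l]).
  assert (Hs2 : (Cmod s <= eps / (Rabs K + 1))%R)
    by (apply Rlt_le; eapply Rlt_le_trans; [exact Hy | apply Rmin_r]).
  eapply Rle_trans; [apply H, Hs1|].
  pose proof (Cmod_ge_0 s). pose proof (Rabs_pos K). pose proof (Rle_abs K).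
  assert (H3 : ((Rabs K + 1) * Cmod s <= eps)%R).
  { replace (pos eps) with ((Rabs K + 1) * (eps / (Rabs K + 1)))%R by (field; lra).
    apply Rmult_le_compat_l; lra. }
  assert (K * Cmod s <= eps)%R by nra. nra.
Qed.

(** The quotient Gamma(z + s)/Gamma(z) is the product of the factors [1 + gauss_defect z s k], which
    [infinite_product_derivative] differentiates at s = 0. Every later fact about [digamma] starts
    from this series. *)
Lemma digamma_cv (z : C) : not_Gamma_pole z -> Ccv (Csum (psi_term z)) (digamma z).
Proof.
  intros Hz.
  destruct (psi_term_cv z Hz) as [p Hp].
  destruct (CGamma_cv z Hz) as [HG0 HG].
  assert (HD : is_derive CGamma z (CGamma z * p)).
  2: { unfold digamma. rewrite (is_C_derive_unique _ _ _ HD).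
       replace (CGamma z * p / CGamma z) with p by (field; auto). exact Hp. }
  destruct (not_Gamma_pole_lower_bound z Hz) as [c [Hc B]].
  (* The radius c/2 keeps z + s + k at distance at least (c/2)(k + 1) from 0, hence z + s off the
     poles; the cap 1 is required by [infinite_product_derivative]. *)
  set (delta := Rmin (c / 2) 1).
  assert (Hd : (0 < delta <= 1)%R).
  { split; [apply Rmin_glb_lt; lra | apply Rmin_r]. }
  assert (B2 : forall s k, (Cmod s <= delta)%R ->
            (c / 2 * (INR k + 1) <= Cmod (z + s + INR k))%R).
  { intros s k Hs. specialize (B k). pose proof (pos_INR k).
    assert (Hs' : (Cmod s <= c / 2)%R) by (eapply Rle_trans; [exact Hs | apply Rmin_l]).
    pose proof (Cmod_triangle_rev (z + INR k) (- s)) as T. rewrite Cmod_opp in T.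
    replace (z + INR k - - s) with (z + s + INR k) in T by ring. nra. }
  assert (Bz : forall k, (c / 2 * (INR k + 1) <= Cmod (z + INR k))%R).
  { intros k. specialize (B k). pose proof (pos_INR k). nra. }
  assert (Hzs : forall s, (Cmod s <= delta)%R -> not_Gamma_pole (z + s)).
  { intros s Hs k E. specialize (B2 s k Hs). rewrite E in B2.
    replace (- INR k + INR k) with (RtoC 0) in B2 by ring. rewrite Cmod_0 in B2.
    pose proof (pos_INR k). nra. }
  pose (K1 := (/ (c / 2) ^ 2 + 4 * exp 1 + / (c / 2) + 4 * exp 1 * 1 / (c / 2))%R).
  pose (K2 := (1 + Cmod (z - 1) / (c / 2))%R).
  destruct (infinite_product_derivative (gauss_defect z) (psi_term z)
              (fun s => CGamma (z + s) / CGamma z) p (Rmax K1 K2) delta) as [K' HK'].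
  - exact Hd.
  - intros s k Hs.
    eapply Rle_trans; [apply (gauss_defect_bound z s (c / 2) 1)|]; auto; try lra.
    apply Rmult_le_compat_r; [apply Rlt_le, inv_sq_pos|].
    apply Rmult_le_compat_r; [apply pow2_ge_0 | apply Rmax_l].
  - intros k. eapply Rle_trans; [apply (psi_term_bound z (c / 2))|]; auto; try lra.
    apply Rmult_le_compat_r; [apply Rlt_le, inv_sq_pos | apply Rmax_r].
  - intros s Hs. destruct (gauss_quotient_cv z s Hz (Hzs s Hs)) as [h [_ Hh]].
    replace (CGamma (z + s) / CGamma z) with h; [exact Hh|].
    replace (CGamma (z + s)) with (CGamma z * h); [field; auto|].
    apply (Ccv_unique (gauss_seq (z + s))).
    + apply gauss_seq_shift; auto.
    + now apply CGamma_cv, Hzs.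
  - exact Hp.
  - apply (is_derive_quadratic _ _ _ (Cmod (CGamma z) * K') delta); [lra|].
    intros s Hs.
    replace (CGamma (z + s) - CGamma z - s * (CGamma z * p))
      with (CGamma z * (CGamma (z + s) / CGamma z - 1 - s * p)) by (field; auto).
    rewrite Cmod_mult, Rmult_assoc.
    apply Rmult_le_compat_l; [apply Cmod_ge_0 | now apply HK'].
Qed.

(** * Wallis integrals with complex frequency *)

(** Hyperbolic cosine and sine, written with [exp] so that derivatives and identities become algebra
    in [exp x] and [exp (- x)]. *)
Definition chR (x : R) : R := ((exp x + exp (- x)) / 2)%R.
Definition shR (x : R) : R := ((exp x - exp (- x)) / 2)%R.

Lemma Ccos_eq (z : C) :
  Ccos z = (cos (Re z) * chR (Im z), - (sin (Re z) * shR (Im z)))%R.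
Proof.
  unfold Ccos, Cexp, chR, shR. destruct z as [a b]. simpl.
  replace (0 * a - 1 * b)%R with (- b)%R by ring.
  replace (0 * b + 1 * a)%R with a by ring.
  replace (- - b)%R with b by ring.
  rewrite cos_neg, sin_neg.
  apply injective_projections; simpl; field.
Qed.

Lemma Csin_eq (z : C) :
  Csin z = (sin (Re z) * chR (Im z), cos (Re z) * shR (Im z))%R.
Proof.
  unfold Csin, Cexp, chR, shR. destruct z as [a b]. simpl.
  replace (0 * a - 1 * b)%R with (- b)%R by ring.
  replace (0 * b + 1 * a)%R with a by ring.
  replace (- - b)%R with b by ring.
  rewrite cos_neg, sin_neg.
  apply injective_projections; simpl; field.
Qed.

Definition wallis_re (a b : R) (n : nat) (t : R) : R :=
  (cos (a * t) * chR (b * t) * cos t ^ n)%R.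
Definition wallis_im (a b : R) (n : nat) (t : R) : R :=
  (sin (a * t) * shR (b * t) * cos t ^ n)%R.

(* Real and imaginary parts of the integral of [cos (w t) * (cos t)^n] over
   [0, PI/2], where [w = a + i b]. *)
Definition wallis (a b : R) (n : nat) : C :=
  (RInt (wallis_re a b n) 0 (PI / 2), - RInt (wallis_im a b n) 0 (PI / 2))%R.

Lemma continuous_wallis_re (a b : R) (n : nat) (t : R) : continuous (wallis_re a b n) t.
Proof.
  apply (ex_derive_continuous (wallis_re a b n)). unfold wallis_re, chR. auto_derive.
  trivial.
Qed.

Lemma continuous_wallis_im (a b : R) (n : nat) (t : R) : continuous (wallis_im a b n) t.
Proof.
  apply (ex_derive_continuous (wallis_im a b n)). unfold wallis_im, shR. auto_derive.
  trivial.
Qed.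

Lemma is_RInt_wallis_re (a b : R) (n : nat) :
  is_RInt (wallis_re a b n) 0 (PI / 2) (Re (wallis a b n)).
Proof.
  apply (RInt_correct (wallis_re a b n)), ex_RInt_continuous.
  intros; apply continuous_wallis_re.
Qed.

Lemma is_RInt_wallis_im (a b : R) (n : nat) :
  is_RInt (wallis_im a b n) 0 (PI / 2) (- Im (wallis a b n))%R.
Proof.
  simpl. rewrite Ropp_involutive.
  apply (RInt_correct (wallis_im a b n)), ex_RInt_continuous.
  intros; apply continuous_wallis_im.
Qed.

Lemma is_RInt_lin3 (f g h : R -> R) (p q r u v If Ig Ih : R) :
  is_RInt f u v If -> is_RInt g u v Ig -> is_RInt h u v Ih ->
  is_RInt (fun t => p * f t + q * g t + r * h t)%R u v (p * If + q * Ig + r * Ih)%R.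
Proof.
  intros Hf Hg Hh.
  apply (is_RInt_plus (fun t => p * f t + q * g t)%R (fun t => r * h t)%R).
  - apply (is_RInt_plus (fun t => p * f t)%R (fun t => q * g t)%R).
    + exact (is_RInt_scal f u v p If Hf).
    + exact (is_RInt_scal g u v q Ig Hg).
  - exact (is_RInt_scal h u v r Ih Hh).
Qed.

Lemma continuous_lin3 (f g h : R -> R) (p q r t : R) :
  continuous f t -> continuous g t -> continuous h t ->
  continuous (fun t => p * f t + q * g t + r * h t)%R t.
Proof.
  intros Hf Hg Hh.
  apply (continuous_plus (fun t => p * f t + q * g t)%R (fun t => r * h t)%R).
  - apply (continuous_plus (fun t => p * f t)%R (fun t => q * g t)%R).
    + exact (continuous_scal_r p f t Hf).
    + exact (continuous_scal_r q g t Hg).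
  - exact (continuous_scal_r r h t Hh).
Qed.

Lemma is_RInt_antiderivative (F f : R -> R) (u v I : R) :
  (forall t, is_derive F t (f t)) -> (forall t, continuous f t) ->
  is_RInt f u v I -> I = (F v - F u)%R.
Proof.
  intros HF Hc HI.
  assert (H : is_RInt f u v (F v - F u)%R).
  { apply (is_RInt_derive F f); intros; auto. }
  rewrite <- (is_RInt_unique (V := R_CompleteNormedModule) f u v I HI).
  exact (is_RInt_unique (V := R_CompleteNormedModule) f u v _ H).
Qed.

(** The two antiderivatives below are the real and imaginary parts of sin(wt), w = a + ib. The
    identity is multiplied through by w so that it also holds at w = 0. *)
Lemma wallis_0 (a b : R) :
  (a, b) * wallis a b 0 = Csin ((a, b) * (PI / 2)%R).
Proof.
  pose proof (is_RInt_wallis_re a b 0) as Hr.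
  pose proof (is_RInt_wallis_im a b 0) as Hi.
  set (W := wallis a b 0) in *.
  rewrite Csin_eq.
  assert (E1 : (a * Re W + b * (- Im W) + 0 * (- Im W)
     = sin (a * (PI / 2)) * chR (b * (PI / 2)) - sin (a * 0) * chR (b * 0))%R).
  { apply (is_RInt_antiderivative (fun t => sin (a * t) * chR (b * t))%R
      (fun t => a * wallis_re a b 0 t + b * wallis_im a b 0 t + 0 * wallis_im a b 0 t)%R).
    - intros t. unfold wallis_re, wallis_im, chR, shR. auto_derive; [trivial|]. field.
    - intros t.
      apply continuous_lin3; (apply continuous_wallis_re || apply continuous_wallis_im).
    - now apply is_RInt_lin3. }
  assert (E2 : (- a * (- Im W) + b * Re W + 0 * (- Im W)
     = cos (a * (PI / 2)) * shR (b * (PI / 2)) - cos (a * 0) * shR (b * 0))%R).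
  { apply (is_RInt_antiderivative (fun t => cos (a * t) * shR (b * t))%R
      (fun t => - a * wallis_im a b 0 t + b * wallis_re a b 0 t + 0 * wallis_im a b 0 t)%R).
    - intros t. unfold wallis_re, wallis_im, chR, shR. auto_derive; [trivial|]. field.
    - intros t.
      apply continuous_lin3; (apply continuous_wallis_re || apply continuous_wallis_im).
    - now apply is_RInt_lin3. }
  rewrite !Rmult_0_r, sin_0 in E1.
  rewrite !Rmult_0_r in E2. unfold shR at 2 in E2. rewrite Ropp_0 in E2.
  unfold Re, Im in *. destruct W as [W1 W2]. simpl in *.
  apply injective_projections; simpl.
  - replace (a * (PI / 2) - b * 0)%R with (a * (PI / 2))%R by ring.
    replace (a * 0 + b * (PI / 2))%R with (b * (PI / 2))%R by ring. lra.
  - replace (a * (PI / 2) - b * 0)%R with (a * (PI / 2))%R by ring.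
    replace (a * 0 + b * (PI / 2))%R with (b * (PI / 2))%R by ring. lra.
Qed.

Lemma wallis_1 (a b : R) :
  (1 - (a, b) ^ 2) * wallis a b 1 = Ccos ((a, b) * (PI / 2)%R).
Proof.
  pose proof (is_RInt_wallis_re a b 1) as Hr.
  pose proof (is_RInt_wallis_im a b 1) as Hi.
  set (W := wallis a b 1) in *.
  rewrite Ccos_eq.
  (* [F1] and [F2] are the real and imaginary parts of w sin(wt) cos t - cos(wt) sin t, whose
     derivative is (w^2 - 1) cos(wt) cos t. *)
  pose (F1 := (fun t => (a * (sin (a * t) * chR (b * t)) - b * (cos (a * t) * shR (b * t)))
                 * cos t - cos (a * t) * chR (b * t) * sin t)%R).
  pose (F2 := (fun t => (b * (sin (a * t) * chR (b * t)) + a * (cos (a * t) * shR (b * t)))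
                 * cos t + sin (a * t) * shR (b * t) * sin t)%R).
  assert (E1 : ((a ^ 2 - b ^ 2 - 1) * Re W + 2 * a * b * (- Im W) + 0 * (- Im W)
     = F1 (PI / 2) - F1 0)%R).
  { apply (is_RInt_antiderivative F1
      (fun t => (a ^ 2 - b ^ 2 - 1) * wallis_re a b 1 t + 2 * a * b * wallis_im a b 1 t
         + 0 * wallis_im a b 1 t)%R).
    - intros t. unfold F1, wallis_re, wallis_im, chR, shR.
      auto_derive; [trivial|]. field.
    - intros t.
      apply continuous_lin3; (apply continuous_wallis_re || apply continuous_wallis_im).
    - now apply is_RInt_lin3. }
  assert (E2 : (- (a ^ 2 - b ^ 2 - 1) * (- Im W) + 2 * a * b * Re W + 0 * (- Im W)
     = F2 (PI / 2) - F2 0)%R).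
  { apply (is_RInt_antiderivative F2
      (fun t => - (a ^ 2 - b ^ 2 - 1) * wallis_im a b 1 t + 2 * a * b * wallis_re a b 1 t
         + 0 * wallis_im a b 1 t)%R).
    - intros t. unfold F2, wallis_re, wallis_im, chR, shR.
      auto_derive; [trivial|]. field.
    - intros t.
      apply continuous_lin3; (apply continuous_wallis_re || apply continuous_wallis_im).
    - now apply is_RInt_lin3. }
  unfold F1, F2 in *. rewrite !Rmult_0_r, sin_0, cos_0, cos_PI2, sin_PI2 in E1.
  rewrite !Rmult_0_r, sin_0, cos_0, cos_PI2, sin_PI2 in E2.
  assert (Hs0 : shR 0 = 0%R) by (unfold shR; rewrite Ropp_0; field).
  rewrite Hs0 in *.
  unfold Re, Im in *. destruct W as [W1 W2]. simpl in *.
  replace (a * (PI / 2) - b * 0)%R with (a * (PI / 2))%R by ring.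
  replace (a * 0 + b * (PI / 2))%R with (b * (PI / 2))%R by ring.
  apply injective_projections; simpl; lra.
Qed.

(** Two integrations by parts. The boundary terms vanish: at PI/2 because a positive power of the
    cosine remains, at 0 because every term contains a sine or a hyperbolic sine. *)
Lemma wallis_SS (a b : R) (n : nat) :
  (INR (S (S n)) ^ 2 - (a, b) ^ 2) * wallis a b (S (S n))
  = INR (S (S n)) * INR (S n) * wallis a b n.
Proof.
  pose proof (is_RInt_wallis_re a b (S (S n))) as Hr.
  pose proof (is_RInt_wallis_im a b (S (S n))) as Hi.
  pose proof (is_RInt_wallis_re a b n) as Hr'.
  pose proof (is_RInt_wallis_im a b n) as Hi'.
  set (W := wallis a b (S (S n))) in *. set (V := wallis a b n) in *.
  set (N := INR (S (S n))).
  assert (HN : INR (S n) = (N - 1)%R) by (unfold N; rewrite !S_INR; ring).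
  (* Real and imaginary parts of w sin(wt) cos^N t - N cos(wt) cos^(N-1) t sin t. With sin^2 = 1 -
     cos^2 the derivative is (w^2 - N^2) cos(wt) cos^N t + N(N-1) cos(wt) cos^(N-2) t. *)
  pose (F1 := (fun t => (a * (sin (a * t) * chR (b * t)) - b * (cos (a * t) * shR (b * t)))
                 * cos t ^ S (S n) - N * (cos (a * t) * chR (b * t) * cos t ^ S n * sin t))%R).
  pose (F2 := (fun t => (b * (sin (a * t) * chR (b * t)) + a * (cos (a * t) * shR (b * t)))
                 * cos t ^ S (S n) + N * (sin (a * t) * shR (b * t) * cos t ^ S n * sin t))%R).
  assert (Hsc : forall t, (sin t * sin t = 1 - cos t * cos t)%R).
  { intros t. pose proof (sin2_cos2 t) as H. unfold Rsqr in H. lra. }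
  assert (E1 : ((a ^ 2 - b ^ 2 - N ^ 2) * Re W + 2 * a * b * (- Im W) + N * (N - 1) * Re V
     = F1 (PI / 2) - F1 0)%R).
  { apply (is_RInt_antiderivative F1
      (fun t => (a ^ 2 - b ^ 2 - N ^ 2) * wallis_re a b (S (S n)) t
         + 2 * a * b * wallis_im a b (S (S n)) t + N * (N - 1) * wallis_re a b n t)%R).
    - intros t. unfold F1, wallis_re, wallis_im, chR, shR.
      auto_derive; [trivial|].
      change (match n with O => 1 | S _ => INR n + 1 end)%R with (INR (S n)).
      rewrite HN.
      specialize (Hsc t). simpl pow. field [Hsc].
    - intros t.
      apply continuous_lin3; (apply continuous_wallis_re || apply continuous_wallis_im).
    - now apply is_RInt_lin3. }
  assert (E2 : (- (a ^ 2 - b ^ 2 - N ^ 2) * (- Im W) + 2 * a * b * Re W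
       + - (N * (N - 1)) * (- Im V) = F2 (PI / 2) - F2 0)%R).
  { apply (is_RInt_antiderivative F2
      (fun t => - (a ^ 2 - b ^ 2 - N ^ 2) * wallis_im a b (S (S n)) t
         + 2 * a * b * wallis_re a b (S (S n)) t + - (N * (N - 1)) * wallis_im a b n t)%R).
    - intros t. unfold F2, wallis_re, wallis_im, chR, shR.
      auto_derive; [trivial|].
      change (match n with O => 1 | S _ => INR n + 1 end)%R with (INR (S n)).
      rewrite HN.
      specialize (Hsc t). simpl pow. field [Hsc].
    - intros t.
      apply continuous_lin3; (apply continuous_wallis_re || apply continuous_wallis_im).
    - now apply is_RInt_lin3. }
  unfold F1, F2 in *.
  assert (Hs0 : shR 0 = 0%R) by (unfold shR; rewrite Ropp_0; field).
  rewrite !Rmult_0_r, sin_0, cos_PI2, Hs0 in E1. rewrite !Rmult_0_r, sin_0, cos_PI2, Hs0 in E2.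
  rewrite HN. clearbody N. clear -E1 E2.
  unfold Re, Im in *. destruct W as [W1 W2], V as [V1 V2]. simpl in *.
  apply injective_projections; simpl; lra.
Qed.

Definition wallis0 (n : nat) : R := RInt (fun t => cos t ^ n)%R 0 (PI / 2).

Lemma continuous_cos_pow (n : nat) (t : R) : continuous (fun t => cos t ^ n)%R t.
Proof. apply (ex_derive_continuous (fun t => cos t ^ n)%R). auto_derive. trivial. Qed.

Lemma is_RInt_wallis0 (n : nat) :
  is_RInt (fun t => cos t ^ n)%R 0 (PI / 2) (wallis0 n).
Proof.
  apply (RInt_correct (fun t => cos t ^ n)%R), ex_RInt_continuous.
  intros; apply continuous_cos_pow.
Qed.

(* [RInt_ext] and [is_RInt_ext] leave equations in the carrier of a normed module,
   which [ring] does not recognise as [R]. *)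
Ltac eq_in_R := match goal with |- ?u = ?v => change (@eq R u v) end.

Lemma wallis_0_0 (n : nat) : wallis 0 0 n = wallis0 n.
Proof.
  unfold wallis. apply injective_projections; simpl.
  - apply RInt_ext. intros t _. unfold wallis_re, chR.
    rewrite !Rmult_0_l, cos_0, Ropp_0, exp_0. eq_in_R. field.
  - rewrite (RInt_ext _ (fun _ => 0%R)).
    + rewrite RInt_const. unfold scal; simpl; unfold mult; simpl. ring.
    + intros t _. unfold wallis_im. rewrite !Rmult_0_l, sin_0. eq_in_R. ring.
Qed.

Lemma PI2_pos : (0 < PI / 2)%R.
Proof. pose proof PI_RGT_0. lra. Qed.

Lemma wallis0_pos (n : nat) : (0 < wallis0 n)%R.
Proof.
  apply RInt_gt_0.
  - apply PI2_pos.
  - intros t Ht. apply pow_lt, cos_gt_0; lra.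
  - intros t _. apply continuous_cos_pow.
Qed.

Lemma wallis0_SS (n : nat) :
  (INR (S (S n)) * wallis0 (S (S n)) = INR (S n) * wallis0 n)%R.
Proof.
  pose proof (wallis_SS 0 0 n) as H. rewrite !wallis_0_0 in H.
  replace ((0%R, 0%R) ^ 2) with (RtoC 0) in H
    by (apply injective_projections; simpl; ring).
  assert (Hp : (0 < INR (S (S n)))%R) by (apply lt_0_INR; lia).
  apply (f_equal Re) in H.
  rewrite <- RtoC_pow, <- RtoC_minus, <- !RtoC_mult, !re_RtoC in H.
  apply (Rmult_eq_reg_l (INR (S (S n)))); [|lra]. lra.
Qed.

(** This is t <= tan t cleared of its denominator, hence valid at PI/2 as well. *)
Lemma x_cos_le_sin (t : R) : (0 <= t <= PI / 2 -> 0 <= t * cos t <= sin t)%R.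
Proof.
  intros [H0 H1]. split.
  - apply Rmult_le_pos; [lra | apply cos_ge_0; lra].
  - destruct H0 as [H0 | <-]; [|rewrite sin_0; lra].
    destruct (MVT_gen (fun t => sin t - t * cos t)%R 0 t (fun t => t * sin t)%R)
      as [c [Hc E]].
    + intros u _. auto_derive; [trivial | ring].
    + intros u _. apply continuity_pt_filterlim.
      apply (ex_derive_continuous (fun t => sin t - t * cos t)%R). auto_derive. trivial.
    + rewrite Rmin_left, Rmax_right in Hc by lra. rewrite sin_0 in E.
      assert (0 <= c * sin c * (t - 0))%R.
      { apply Rmult_le_pos; [|lra]. apply Rmult_le_pos; [lra|].
        apply sin_ge_0; lra. }
      lra.
Qed.

(** The weight cos^(n+2) concentrates at 0. Since t cos t <= sin t, the function t^2 cos^(n+2) t is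
    at most (1 - cos^2 t) cos^n t, whose integral [wallis0 n - wallis0 (S (S n))] equals
    [wallis0 (S (S n))] divided by n + 1. *)
Lemma wallis_tail (f : R -> R) (K I : R) (n : nat) :
  (forall t, 0 <= t <= PI / 2 -> Rabs (f t) <= K * t ^ 2)%R ->
  is_RInt (fun t => f t * cos t ^ S (S n))%R 0 (PI / 2) I ->
  (Rabs I <= K * / (INR n + 1) * wallis0 (S (S n)))%R.
Proof.
  intros Hf HI. pose proof PI2_pos as Hpi.
  (* The summand with coefficient 0 pads the integrand to the three terms of [is_RInt_lin3]. *)
  assert (HB : is_RInt (fun t => K * cos t ^ n + - K * cos t ^ S (S n) + 0 * cos t ^ n)%R
            0 (PI / 2) (K * / (INR n + 1) * wallis0 (S (S n)))%R).
  { replace (K * / (INR n + 1) * wallis0 (S (S n)))%R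
      with (K * wallis0 n + - K * wallis0 (S (S n)) + 0 * wallis0 n)%R.
    - apply is_RInt_lin3; apply is_RInt_wallis0.
    - pose proof (wallis0_SS n) as H. rewrite !S_INR in H.
      pose proof (pos_INR n).
      replace (wallis0 n) with ((INR n + 1 + 1) * wallis0 (S (S n)) / (INR n + 1))%R
        by (rewrite H; field; lra).
      field. lra. }
  assert (Hpt : forall t, (0 < t < PI / 2)%R ->
    (Rabs (f t * cos t ^ S (S n)) <= K * cos t ^ n + - K * cos t ^ S (S n) + 0 * cos t ^ n)%R).
  { intros t Ht. rewrite Rabs_mult.
    assert (Hc : (0 <= cos t)%R) by (apply cos_ge_0; lra).
    rewrite (Rabs_pos_eq (cos t ^ S (S n))) by (now apply pow_le).
    specialize (Hf t). destruct (x_cos_le_sin t) as [Ha Hb]; [lra|].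
    assert (HK : (0 <= K)%R).
    { assert (Hf' : (Rabs (f t) <= K * t ^ 2)%R) by (apply Hf; lra).
      pose proof (Rabs_pos (f t)). assert (0 < t ^ 2)%R by (apply pow_lt; lra). nra. }
    apply Rle_trans with (K * t ^ 2 * cos t ^ S (S n))%R.
    - apply Rmult_le_compat_r; [now apply pow_le | apply Hf; lra].
    - assert (Hn : (0 <= cos t ^ n)%R) by (now apply pow_le).
      replace (K * cos t ^ n + - K * cos t ^ S (S n) + 0 * cos t ^ n)%R
        with (K * cos t ^ n * (1 - cos t * cos t))%R by (simpl; ring).
      replace (K * t ^ 2 * cos t ^ S (S n))%R
        with (K * cos t ^ n * (t * cos t) ^ 2)%R by (simpl; ring).
      apply Rmult_le_compat_l; [now apply Rmult_le_pos|].
      pose proof (sin2_cos2 t) as Hs. unfold Rsqr in Hs.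
      replace (1 - cos t * cos t)%R with (sin t ^ 2)%R by (simpl; lra).
      apply pow_incr. lra. }
  apply Rabs_le. split.
  - replace (- (K * / (INR n + 1) * wallis0 (S (S n))))%R
      with (opp (K * / (INR n + 1) * wallis0 (S (S n)))%R) by reflexivity.
    eapply is_RInt_le; [ | apply (is_RInt_opp _ _ _ _ HB) | exact HI | ]; [lra|].
    intros t Ht. specialize (Hpt t Ht). unfold opp; simpl opp.
    pose proof (Rle_abs (- (f t * cos t ^ S (S n)))) as H. rewrite Rabs_Ropp in H.
    simpl in *. lra.
  - eapply is_RInt_le; [ | exact HI | exact HB | ]; [lra|].
    intros t Ht. specialize (Hpt t Ht).
    eapply Rle_trans; [apply Rle_abs | exact Hpt].
Qed.

(** The linear terms of the exponentials of iwt and -iwt cancel. The constant contains exp(2|w|)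
    because t <= PI/2 <= 2. *)
Lemma Ccos_second_order (w : C) (t : R) :
  (0 <= t <= PI / 2 ->
   Cmod (Ccos (w * t) - 1)%C <= 4 * exp (2 * Cmod w) * Cmod w ^ 2 * t ^ 2)%R.
Proof.
  intros [H0 H1]. pose proof (Cmod_ge_0 w) as Hw.
  assert (Hpi : (PI / 2 <= 2)%R) by (pose proof PI_4; lra).
  unfold Ccos.
  assert (H : forall u, Cmod u = (Cmod w * t)%R ->
    (Cmod (Cexp u - 1 - u) <= 4 * exp (2 * Cmod w) * Cmod w ^ 2 * t ^ 2)%R).
  { intros u Hu. eapply Rle_trans; [apply (Cexp_second_order (2 * Cmod w))|].
    - rewrite Hu. nra.
    - rewrite Hu. right. ring. }
  assert (E : Cmod (Ci * (w * t)) = (Cmod w * t)%R).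
  { rewrite !Cmod_mult, Cmod_Ci, Cmod_R, Rabs_pos_eq by lra. ring. }
  pose proof (H (Ci * (w * t)) E) as A1.
  pose proof (H (- (Ci * (w * t)))) as A2. rewrite Cmod_opp in A2. specialize (A2 E).
  set (u := Ci * (w * t)) in *.
  replace ((Cexp u + Cexp (- u)) / 2 - 1)
    with (/ 2 * ((Cexp u - 1 - u) + (Cexp (- u) - 1 - - u))) by field.
  rewrite Cmod_mult, Cmod_inv, Cmod_R, Rabs_pos_eq by (try lra; intros X; apply RtoC_inj in X; lra).
  pose proof (Cmod_triangle (Cexp u - 1 - u) (Cexp (- u) - 1 - - u)). lra.
Qed.

(** The ratio is the mean of cos(wt) for the weight cos^n t on [0, PI/2]. As cos(wt) - 1 = O(t^2),
    [wallis_tail] makes its distance to 1 of order 1/n. *)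
Lemma wallis_ratio_cv (a b : R) : Ccv (fun n => wallis a b n / wallis0 n) 1.
Proof.
  set (w := (a, b) : C).
  set (K := (4 * exp (2 * Cmod w) * Cmod w ^ 2)%R).
  assert (Hc : forall t, Ccos (w * RtoC t)
     = (cos (a * t) * chR (b * t), - (sin (a * t) * shR (b * t)))%R).
  { intros t. rewrite Ccos_eq. unfold w. simpl.
    replace (a * t - b * 0)%R with (a * t)%R by ring.
    replace (a * 0 + b * t)%R with (b * t)%R by ring. reflexivity. }
  apply Ccv_S, (Ccv_S (fun n => wallis a b (S n) / wallis0 (S n))).
  apply (Ccv_squeeze _ _ (fun n => 2 * K * / (INR n + 1))%R).
  2: apply is_lim_seq_scal_0, is_lim_seq_inv_S.
  intros n. pose proof (wallis0_pos (S (S n))) as Hp.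
  assert (Hp' : RtoC (wallis0 (S (S n))) <> 0) by (intros E; apply RtoC_inj in E; lra).
  replace (wallis a b (S (S n)) / wallis0 (S (S n)) - 1)
    with ((wallis a b (S (S n)) - wallis0 (S (S n))) * / wallis0 (S (S n)))
    by (field; auto).
  rewrite Cmod_mult, Cmod_inv, Cmod_R, Rabs_pos_eq by (auto; lra).
  apply (Rmult_le_reg_r (wallis0 (S (S n)))); [exact Hp|].
  rewrite Rmult_assoc, Rinv_l, Rmult_1_r by lra.
  eapply Rle_trans; [apply Cmod_le_Re_Im|].
  assert (T1 : (Rabs (Re (wallis a b (S (S n)) - wallis0 (S (S n))))
     <= K * / (INR n + 1) * wallis0 (S (S n)))%R).
  { apply (wallis_tail (fun t => cos (a * t) * chR (b * t) - 1)%R).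
    - intros t Ht. eapply Rle_trans; [|apply (Ccos_second_order w t Ht)].
      rewrite Hc. eapply Rle_trans; [|apply re_le_Cmod]. right. reflexivity.
    - apply (is_RInt_ext (fun t => 1 * wallis_re a b (S (S n)) t
         + - (1) * cos t ^ S (S n) + 0 * cos t ^ n)%R).
      + intros t _. unfold wallis_re. eq_in_R. ring.
      + replace (Re (wallis a b (S (S n)) - wallis0 (S (S n))))
          with (1 * Re (wallis a b (S (S n))) + - (1) * wallis0 (S (S n)) + 0 * wallis0 n)%R
          by (unfold Re; simpl; ring).
        apply is_RInt_lin3; [apply is_RInt_wallis_re | |]; apply is_RInt_wallis0. }
  assert (T2 : (Rabs (Im (wallis a b (S (S n)) - wallis0 (S (S n))))
     <= K * / (INR n + 1) * wallis0 (S (S n)))%R).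
  { apply (wallis_tail (fun t => - (sin (a * t) * shR (b * t)))%R).
    - intros t Ht. eapply Rle_trans; [|apply (Ccos_second_order w t Ht)].
      rewrite Hc. eapply Rle_trans; [|apply im_le_Cmod]. right. f_equal. simpl. ring.
    - apply (is_RInt_ext (fun t => - (1) * wallis_im a b (S (S n)) t
         + 0 * cos t ^ S (S n) + 0 * cos t ^ n)%R).
      + intros t _. unfold wallis_im. eq_in_R. ring.
      + replace (Im (wallis a b (S (S n)) - wallis0 (S (S n))))
          with (- (1) * (- Im (wallis a b (S (S n)))) + 0 * wallis0 (S (S n)) + 0 * wallis0 n)%R
          by (unfold Im; simpl; ring).
        apply is_RInt_lin3; [apply is_RInt_wallis_im | |]; apply is_RInt_wallis0. }
  lra.
Qed.

(** The coefficient N(N-1) in the recurrence is the same at frequency w and at frequency 0, so it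
    cancels in the quotient and only 1 - w^2/N^2 survives. *)
Lemma wallis_ratio_SS (a b : R) (n : nat) :
  (1 - (a, b) ^ 2 / INR (S (S n)) ^ 2) * (wallis a b (S (S n)) / wallis0 (S (S n)))
  = wallis a b n / wallis0 n.
Proof.
  pose proof (wallis_SS a b n) as H1.
  pose proof (f_equal RtoC (wallis0_SS n)) as H2. rewrite !RtoC_mult in H2.
  pose proof (wallis0_pos n) as P0. pose proof (wallis0_pos (S (S n))) as P2.
  assert (N0 : RtoC (wallis0 n) <> 0) by (intros E; apply RtoC_inj in E; lra).
  assert (N2 : RtoC (wallis0 (S (S n))) <> 0) by (intros E; apply RtoC_inj in E; lra).
  assert (M1 : RtoC (INR (S n)) <> 0)
    by (intros E; apply RtoC_inj in E; apply (not_0_INR (S n)) in E; auto; lia).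
  assert (M2 : RtoC (INR (S (S n))) <> 0)
    by (intros E; apply RtoC_inj in E; apply (not_0_INR (S (S n))) in E; auto; lia).
  set (w := (a, b) : C) in *. set (N := RtoC (INR (S (S n)))) in *.
  set (V := wallis a b n) in *. set (W := wallis a b (S (S n))) in *.
  set (I0 := RtoC (wallis0 n)) in *. set (I2 := RtoC (wallis0 (S (S n)))) in *.
  set (N1 := RtoC (INR (S n))) in *.
  replace ((1 - w ^ 2 / N ^ 2) * (W / I2)) with ((N ^ 2 - w ^ 2) * W / (N * (N * I2)))
    by (field; auto).
  rewrite H1, H2. field. auto.
Qed.

(** * Euler products for the sine and the cosine *)

Definition sine_factor (z : C) (k : nat) : C := 1 - z ^ 2 / (INR k + 1) ^ 2.
Definition cosine_factor (z : C) (k : nat) : C := 1 - z ^ 2 / (INR k + 1 / 2) ^ 2.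

Lemma RtoC_INR_plus_neq_0 (k : nat) (r : R) : (0 < r)%R -> RtoC (INR k) + RtoC r <> 0.
Proof.
  intros Hr. rewrite <- RtoC_plus. intros E. apply RtoC_inj in E.
  pose proof (pos_INR k). lra.
Qed.

Lemma RtoC_half : RtoC 1 / RtoC 2 = RtoC (1 / 2).
Proof. rewrite RtoC_div by lra. reflexivity. Qed.

(** With w = 2z and N = 2n + 2, the factor 1 - w^2/N^2 is [sine_factor z n]. *)
Lemma wallis_even (z : C) (n : nat) :
  Cprod (sine_factor z) n
    * (wallis (2 * Re z) (2 * Im z) (2 * n) / wallis0 (2 * n))
  = wallis (2 * Re z) (2 * Im z) 0 / wallis0 0.
Proof.
  induction n as [|n IH]; [simpl; ring|].
  rewrite <- IH. cbn [Cprod].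
  replace (2 * S n)%nat with (S (S (2 * n))) by lia.
  rewrite <- (wallis_ratio_SS _ _ (2 * n)).
  replace (1 - ((2 * Re z)%R, (2 * Im z)%R) ^ 2 / INR (S (S (2 * n))) ^ 2)
    with (sine_factor z n); [ring|].
  unfold sine_factor.
  replace ((2 * Re z)%R, (2 * Im z)%R) with (2 * z)
    by (apply injective_projections; simpl; unfold Re, Im; ring).
  replace (RtoC (INR (S (S (2 * n))))) with (2 * (INR n + 1)).
  2: { rewrite !S_INR, mult_INR. simpl (INR 2).
       rewrite !RtoC_plus, RtoC_mult, RtoC_plus. ring. }
  field. apply (RtoC_INR_plus_neq_0 n 1). lra.
Qed.

(** With w = 2z and N = 2n + 3, the factor 1 - w^2/N^2 is [cosine_factor z (S n)]. The factor of
    index 0 is 1 - w^2, the one that [wallis_1] pairs with the integral for n = 1. *)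
Lemma wallis_odd (z : C) (n : nat) :
  Cprod (cosine_factor z) (S n)
    * (wallis (2 * Re z) (2 * Im z) (2 * n + 1) / wallis0 (2 * n + 1))
  = cosine_factor z 0 * (wallis (2 * Re z) (2 * Im z) 1 / wallis0 1).
Proof.
  induction n as [|n IH]; [simpl; ring|].
  rewrite <- IH. cbn [Cprod].
  replace (2 * S n + 1)%nat with (S (S (2 * n + 1))) by lia.
  rewrite <- (wallis_ratio_SS _ _ (2 * n + 1)).
  replace (1 - ((2 * Re z)%R, (2 * Im z)%R) ^ 2 / INR (S (S (2 * n + 1))) ^ 2)
    with (cosine_factor z (S n)); [ring|].
  unfold cosine_factor.
  replace ((2 * Re z)%R, (2 * Im z)%R) with (2 * z)
    by (apply injective_projections; simpl; unfold Re, Im; ring).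
  replace (RtoC (INR (S (S (2 * n + 1))))) with (2 * (INR (S n) + 1 / 2)).
  2: { rewrite !S_INR, plus_INR, mult_INR. simpl (INR 2). simpl (INR 1).
       rewrite !RtoC_plus, RtoC_mult, RtoC_plus. field. }
  field. rewrite S_INR, RtoC_plus.
  replace ((RtoC (INR n) + 1) * 2 + 1) with (2 * (INR n + RtoC (3 / 2)))
    by (rewrite RtoC_div by lra; field).
  apply Cmult_neq_0; [|apply RtoC_INR_plus_neq_0; lra].
  intros E; apply RtoC_inj in E; lra.
Qed.

Lemma square_ratio_bound (z : C) (k : nat) (r : R) :
  (1 / 2 <= r)%R -> (Cmod (- (z ^ 2 / (INR k + RtoC r) ^ 2)) <= 4 * Cmod z ^ 2 * inv_sq k)%R.
Proof.
  intros Hr. pose proof (pos_INR k) as Hk.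
  assert (Hn : (INR k + RtoC r) ^ 2 <> 0) by (apply Cpow_nz, RtoC_INR_plus_neq_0; lra).
  rewrite Cmod_opp, Cmod_div, !Cmod_pow by exact Hn.
  rewrite <- RtoC_plus, Cmod_R, Rabs_pos_eq by lra.
  unfold inv_sq, Rdiv.
  apply Rle_trans with (Cmod z ^ 2 * (4 * / (INR k + 1) ^ 2))%R; [|right; ring].
  apply Rmult_le_compat_l; [apply pow2_ge_0|].
  (* Since r >= 1/2, k + r is at least (k + 1)/2; this covers both r = 1 and r = 1/2. *)
  replace (4 * / (INR k + 1) ^ 2)%R with (/ ((INR k + 1) / 2) ^ 2)%R by (field; lra).
  apply Rinv_le_contravar; [apply pow_lt; lra|].
  apply pow_incr. lra.
Qed.

(** The limit [p] is sin(PI z)/(PI z); the multiplied form includes z = 0. *)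
Lemma sine_product (z : C) :
  exists p, Ccv (Cprod (sine_factor z)) p /\ PI * z * p = Csin (PI * z).
Proof.
  destruct (Cprod_cv (fun k => - (z ^ 2 / (INR k + RtoC 1) ^ 2))
              (fun k => 4 * Cmod z ^ 2 * inv_sq k)%R) as [p Hp].
  - intros k. apply square_ratio_bound. lra.
  - apply (ex_series_scal (4 * Cmod z ^ 2)%R inv_sq), ex_series_inv_sq.
  - assert (Hp' : Ccv (Cprod (sine_factor z)) p).
    { apply (Ccv_ext (Cprod (fun k => 1 + - (z ^ 2 / (INR k + RtoC 1) ^ 2)))); [|exact Hp].
      intros n. apply Cprod_ext. intros k _. unfold sine_factor. ring. }
    exists p. split; [exact Hp'|].
    set (a := (2 * Re z)%R). set (b := (2 * Im z)%R).
    assert (Hw : Ccv (fun n => Cprod (sine_factor z) n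
                  * (wallis a b (2 * n) / wallis0 (2 * n))) (p * 1)).
    { apply Ccv_mult; [exact Hp'|].
      apply (Ccv_subseq (fun n => wallis a b n / wallis0 n) 1 (fun n => 2 * n)%nat).
      - intros n; lia.
      - apply wallis_ratio_cv. }
    assert (E : p = wallis a b 0 / wallis0 0).
    { rewrite <- (Cmult_1_r p).
      apply (Ccv_unique _ _ _ Hw).
      apply (Ccv_ext (fun _ => wallis a b 0 / wallis0 0)); [|apply Ccv_const].
      intros n. symmetry. apply wallis_even. }
    assert (I0 : wallis0 0 = (PI / 2)%R).
    { unfold wallis0. simpl. rewrite RInt_const. unfold scal; simpl; unfold mult; simpl.
      ring. }
    rewrite E, I0. pose proof (wallis_0 a b) as H.
    replace ((a, b) : C) with (2 * z) in H
      by (apply injective_projections; simpl; unfold a, b, Re, Im; ring).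
    replace (PI * z) with (2 * z * (PI / 2)%R) at 2.
    + rewrite <- H. rewrite RtoC_div by lra.
      field. intros X; apply RtoC_inj in X; pose proof PI_RGT_0; lra.
    + rewrite RtoC_div by lra. field.
Qed.

Lemma cosine_product (z : C) : Ccv (Cprod (cosine_factor z)) (Ccos (PI * z)).
Proof.
  destruct (Cprod_cv (fun k => - (z ^ 2 / (INR k + RtoC (1 / 2)) ^ 2))
              (fun k => 4 * Cmod z ^ 2 * inv_sq k)%R) as [p Hp].
  - intros k. apply square_ratio_bound. lra.
  - apply (ex_series_scal (4 * Cmod z ^ 2)%R inv_sq), ex_series_inv_sq.
  - assert (Hp' : Ccv (Cprod (cosine_factor z)) p).
    { apply (Ccv_ext (Cprod (fun k => 1 + - (z ^ 2 / (INR k + RtoC (1 / 2)) ^ 2))));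
        [|exact Hp].
      intros n. apply Cprod_ext. intros k _. unfold cosine_factor.
      rewrite RtoC_half. ring. }
    set (a := (2 * Re z)%R). set (b := (2 * Im z)%R).
    assert (Hw : Ccv (fun n => Cprod (cosine_factor z) (S n)
                  * (wallis a b (2 * n + 1) / wallis0 (2 * n + 1))) (p * 1)).
    { apply Ccv_mult; [now apply -> (Ccv_S (Cprod (cosine_factor z)))|].
      apply (Ccv_subseq (fun n => wallis a b n / wallis0 n) 1 (fun n => 2 * n + 1)%nat).
      - intros n; lia.
      - apply wallis_ratio_cv. }
    assert (E : p = cosine_factor z 0 * (wallis a b 1 / wallis0 1)).
    { rewrite <- (Cmult_1_r p).
      apply (Ccv_unique _ _ _ Hw).
      apply (Ccv_ext (fun _ => cosine_factor z 0 * (wallis a b 1 / wallis0 1)));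
        [|apply Ccv_const].
      intros n. symmetry. apply wallis_odd. }
    assert (I1 : wallis0 1 = 1%R).
    { assert (X := is_RInt_wallis0 1).
      apply (is_RInt_antiderivative sin) in X.
      - rewrite X, sin_PI2, sin_0. ring.
      - intros t. auto_derive; [trivial | ring].
      - intros t. apply continuous_cos_pow. }
    replace (Ccos (PI * z)) with p; [exact Hp'|].
    rewrite E, I1. pose proof (wallis_1 a b) as H.
    replace ((a, b) : C) with (2 * z) in H
      by (apply injective_projections; simpl; unfold a, b, Re, Im; ring).
    replace (PI * z) with (2 * z * (PI / 2)%R).
    + rewrite <- H. unfold cosine_factor. simpl INR. field.
    + rewrite RtoC_div by lra. field.
Qed.

Lemma chR_pos (x : R) : (0 < chR x)%R.
Proof. unfold chR. pose proof (exp_pos x). pose proof (exp_pos (- x)). lra. Qed.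

Lemma shR_eq_0 (x : R) : shR x = 0%R -> x = 0%R.
Proof.
  unfold shR. intros H. assert (E : exp x = exp (- x)) by lra.
  apply exp_inv in E. lra.
Qed.

Lemma Csin_PI_neq_0 (x : C) : (forall k : Z, x <> IZR k) -> Csin (PI * x) <> 0.
Proof.
  intros Hx E. rewrite Csin_eq in E. destruct x as [a b]. simpl in E.
  replace (PI * a - 0 * b)%R with (PI * a)%R in E by ring.
  replace (PI * b + 0 * a)%R with (PI * b)%R in E by ring.
  injection E as E1 E2.
  pose proof (chR_pos (PI * b)). pose proof PI_RGT_0.
  assert (Hs : sin (PI * a) = 0%R) by (apply Rmult_integral in E1; lra).
  assert (Hc : cos (PI * a) <> 0%R).
  { intros Hc. pose proof (sin2_cos2 (PI * a)) as H2. rewrite Hs, Hc in H2.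
    unfold Rsqr in H2. lra. }
  apply Rmult_integral in E2. destruct E2 as [E2 | E2]; [contradiction|].
  apply shR_eq_0, Rmult_integral in E2.
  destruct (sin_eq_0_0 _ Hs) as [k Hk]. apply (Hx k).
  apply injective_projections; simpl; [|lra].
  apply (Rmult_eq_reg_l PI); lra.
Qed.

Lemma Ccos_PI_neq_0 (y : C) : (forall k : Z, y <> IZR k + 1 / 2) -> Ccos (PI * y) <> 0.
Proof.
  intros Hy E. rewrite Ccos_eq in E. destruct y as [a b]. simpl in E.
  replace (PI * a - 0 * b)%R with (PI * a)%R in E by ring.
  replace (PI * b + 0 * a)%R with (PI * b)%R in E by ring.
  injection E as E1 E2.
  pose proof (chR_pos (PI * b)). pose proof PI_RGT_0.
  assert (Hc : cos (PI * a) = 0%R) by (apply Rmult_integral in E1; lra).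
  assert (Hs : sin (PI * a) <> 0%R).
  { intros Hs. pose proof (sin2_cos2 (PI * a)) as H2. rewrite Hs, Hc in H2.
    unfold Rsqr in H2. lra. }
  assert (E3 : (sin (PI * a) * shR (PI * b) = 0)%R) by lra.
  apply Rmult_integral in E3. destruct E3 as [E3 | E3]; [contradiction|].
  apply shR_eq_0, Rmult_integral in E3.
  destruct (cos_eq_0_0 _ Hc) as [k Hk]. apply (Hy k).
  rewrite RtoC_half, <- RtoC_plus.
  apply injective_projections; simpl; [|lra].
  apply (Rmult_eq_reg_l PI); lra.
Qed.

(** * Tangent series and functional equations of digamma *)

Lemma is_derive_Ccos_PI (y : C) :
  is_derive (fun z => Ccos (PI * z)) y (- (PI * Csin (PI * y))).
Proof.
  set (E1 := Cexp (Ci * (PI * y))). set (E2 := Cexp (- (Ci * (PI * y)))).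
  apply (is_derive_quadratic _ _ _
    ((Cmod E1 + Cmod E2) / 2 * (4 * exp PI * PI ^ 2))%R 1); [lra|].
  intros s Hs. pose proof PI_RGT_0 as Hpi. pose proof (Cmod_ge_0 s) as Hs0.
  assert (H : forall u, Cmod u = (PI * Cmod s)%R ->
    (Cmod (Cexp u - 1 - u) <= 4 * exp PI * PI ^ 2 * Cmod s ^ 2)%R).
  { intros u Hu. eapply Rle_trans; [apply (Cexp_second_order PI)|].
    - rewrite Hu. nra.
    - rewrite Hu. right. ring. }
  assert (E : Cmod (Ci * (PI * s)) = (PI * Cmod s)%R).
  { rewrite !Cmod_mult, Cmod_Ci, Cmod_R, Rabs_pos_eq by lra. ring. }
  pose proof (H (Ci * (PI * s)) E) as A1.
  pose proof (H (- (Ci * (PI * s)))) as A2. rewrite Cmod_opp in A2. specialize (A2 E).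
  set (u := Ci * (PI * s)) in *.
  replace (Ccos (PI * (y + s)) - Ccos (PI * y) - s * - (PI * Csin (PI * y)))
    with (/ 2 * (E1 * (Cexp u - 1 - u) + E2 * (Cexp (- u) - 1 - - u))).
  - rewrite Cmod_mult, Cmod_inv, Cmod_R, Rabs_pos_eq
      by (try lra; intros X; apply RtoC_inj in X; lra).
    pose proof (Cmod_triangle (E1 * (Cexp u - 1 - u)) (E2 * (Cexp (- u) - 1 - - u))) as T.
    rewrite !Cmod_mult in T.
    pose proof (Cmod_ge_0 E1). pose proof (Cmod_ge_0 E2).
    assert (Cmod E1 * Cmod (Cexp u - 1 - u)
      <= Cmod E1 * (4 * exp PI * PI ^ 2 * Cmod s ^ 2))%R by (apply Rmult_le_compat_l; lra).
    assert (Cmod E2 * Cmod (Cexp (- u) - 1 - - u)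
      <= Cmod E2 * (4 * exp PI * PI ^ 2 * Cmod s ^ 2))%R by (apply Rmult_le_compat_l; lra).
    lra.
  - unfold Ccos, Csin.
    replace (Ci * (PI * (y + s))) with (Ci * (PI * y) + u) by (unfold u; ring).
    replace (- (Ci * (PI * y) + u)) with (- (Ci * (PI * y)) + - u) by ring.
    rewrite !Cexp_plus. fold E1 E2.
    replace (s * - (PI * ((E1 - E2) / (2 * Ci)))) with (u * (E1 - E2) / 2).
    + field.
    + replace ((E1 - E2) / (2 * Ci)) with ((E1 - E2) / 2 * / Ci) by (field; apply Ci_nz).
      rewrite Ci_inv. unfold u. field.
Qed.

Lemma Cdiv_neq_0 (a b : C) : a <> 0 -> b <> 0 -> a / b <> 0.
Proof.
  intros Ha Hb E. apply Ha. replace a with (a / b * b) by (field; auto).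
  rewrite E. ring.
Qed.

Lemma square_minus_neq_0 (a y : C) : a - y <> 0 -> a + y <> 0 -> a ^ 2 - y ^ 2 <> 0.
Proof.
  intros H1 H2. replace (a ^ 2 - y ^ 2) with ((a - y) * (a + y)) by ring.
  now apply Cmult_neq_0.
Qed.

Lemma half_integer_not_Gamma_pole (y : C) : (forall k : Z, y <> IZR k + 1 / 2) ->
  not_Gamma_pole (1 / 2 - y) /\ not_Gamma_pole (1 / 2 + y).
Proof.
  intros Hy. split; intros n E.
  - apply (Hy (Z.of_nat n)). rewrite <- INR_IZR_INZ.
    replace y with (1 / 2 - (1 / 2 - y)) by field. rewrite E. ring.
  - apply (Hy (- Z.of_nat n - 1)%Z). rewrite minus_IZR, opp_IZR, <- INR_IZR_INZ.
    replace y with (1 / 2 + y - 1 / 2) by field. rewrite E.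
    rewrite RtoC_minus, RtoC_opp. field.
Qed.

Lemma half_plus_neq_0 (k : nat) : RtoC (INR k) + 1 / 2 <> 0.
Proof. rewrite RtoC_half. apply RtoC_INR_plus_neq_0. lra. Qed.

Lemma cosine_factor_eq (z : C) (k : nat) :
  cosine_factor z k = ((INR k + 1 / 2) ^ 2 - z ^ 2) / (INR k + 1 / 2) ^ 2.
Proof.
  unfold cosine_factor. pose proof (half_plus_neq_0 k) as Hk.
  set (h := RtoC (INR k) + 1 / 2) in *. field. exact Hk.
Qed.

Lemma cosine_factor_neq_0 (y : C) (k : nat) :
  (forall k : Z, y <> IZR k + 1 / 2) -> cosine_factor y k <> 0.
Proof.
  intros Hy. destruct (half_integer_not_Gamma_pole y Hy) as [N1 N2].
  rewrite cosine_factor_eq. apply Cdiv_neq_0; [|apply Cpow_nz, half_plus_neq_0].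
  apply square_minus_neq_0.
  - replace (INR k + 1 / 2 - y) with (1 / 2 - y + INR k) by ring.
    now apply not_Gamma_pole_neq_0.
  - replace (INR k + 1 / 2 + y) with (1 / 2 + y + INR k) by ring.
    now apply not_Gamma_pole_neq_0.
Qed.

(** The derivative of cos(PI z) at [y] is computed twice: directly, and from the product for
    cos(PI(y+s))/cos(PI y). Uniqueness of the derivative identifies the sum of the series. *)
Lemma tangent_series (y : C) : (forall k : Z, y <> IZR k + 1 / 2) ->
  Ccv (Csum (fun k => / (1 / 2 - y + INR k) - / (1 / 2 + y + INR k)))
      (PI * Ctan (PI * y)).
Proof.
  intros Hy. destruct (half_integer_not_Gamma_pole y Hy) as [N1 N2].
  pose proof (fun k => not_Gamma_pole_neq_0 _ k N1) as Z1.
  pose proof (fun k => not_Gamma_pole_neq_0 _ k N2) as Z2.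
  destruct (not_Gamma_pole_lower_bound _ N1) as [c1 [Hc1 B1]].
  destruct (not_Gamma_pole_lower_bound _ N2) as [c2 [Hc2 B2]].
  pose proof (Ccos_PI_neq_0 y Hy) as Hcos.
  pose (d := fun k : nat => / ((1 / 2 - y + INR k) * (1 / 2 + y + INR k))).
  assert (Hd : forall k, (Cmod (d k) <= / (c1 * c2) * inv_sq k)%R).
  { intros k. unfold d. rewrite Cmod_inv by (apply Cmult_neq_0; auto).
    unfold inv_sq. rewrite <- Rinv_mult. rewrite Cmod_mult.
    specialize (B1 k). specialize (B2 k). pose proof (pos_INR k).
    assert (0 < c1 * (INR k + 1))%R by (apply Rmult_lt_0_compat; lra).
    assert (0 < c2 * (INR k + 1))%R by (apply Rmult_lt_0_compat; lra).
    apply Rinv_le_contravar.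
    - repeat apply Rmult_lt_0_compat; try lra.
    - replace (c1 * c2 * (INR k + 1) ^ 2)%R with
        (c1 * (INR k + 1) * (c2 * (INR k + 1)))%R by ring.
      apply Rmult_le_compat; lra. }
  pose proof cosine_factor_eq as Hcf. pose proof half_plus_neq_0 as Hk.
  pose proof (fun k => cosine_factor_neq_0 y k Hy) as Hcf0.
  (* [1 + a s k] is the quotient of [cosine_factor (y + s) k] by [cosine_factor y k], and [b k] is
     the coefficient of [s] in it. *)
  pose (a := fun (s : C) k => - (2 * y * s + s ^ 2) * d k).
  pose (b := fun k => - (2 * y) * d k).
  set (Z := (/ (c1 * c2))%R) in *.
  assert (HZ : (0 < Z)%R) by (apply Rinv_0_lt_compat, Rmult_lt_0_compat; lra).
  assert (Hb : forall k, (Cmod (b k) <= 2 * Cmod y * Z * inv_sq k)%R).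
  { intros k. unfold b. rewrite Cmod_mult, Cmod_opp, Cmod_mult, Cmod_R, Rabs_pos_eq by lra.
    rewrite (Rmult_assoc (2 * Cmod y)). apply Rmult_le_compat_l; [|apply Hd].
    pose proof (Cmod_ge_0 y). lra. }
  destruct (Csum_abs_cv b (fun k => 2 * Cmod y * Z * inv_sq k)%R Hb) as [B HB].
  { apply (ex_series_scal (2 * Cmod y * Z)%R inv_sq), ex_series_inv_sq. }
  set (K := Rmax Z (2 * Cmod y * Z)).
  destruct (infinite_product_derivative a b
      (fun s => Ccos (PI * (y + s)) / Ccos (PI * y)) B K 1) as [K' HK'].
  - lra.
  - intros s k _. unfold a, b.
    replace (- (2 * y * s + s ^ 2) * d k - s * (- (2 * y) * d k))
      with (- (s ^ 2 * d k)) by ring.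
    rewrite Cmod_opp, Cmod_mult, Cmod_pow.
    apply Rle_trans with (Cmod s ^ 2 * (Z * inv_sq k))%R.
    + apply Rmult_le_compat_l; [apply pow2_ge_0 | apply Hd].
    + apply Rle_trans with (Z * (Cmod s ^ 2 * inv_sq k))%R; [right; ring|].
      rewrite (Rmult_assoc K). apply Rmult_le_compat_r; [|apply Rmax_l].
      apply Rmult_le_pos; [apply pow2_ge_0 | apply Rlt_le, inv_sq_pos].
  - intros k. eapply Rle_trans; [apply Hb|].
    apply Rmult_le_compat_r; [apply Rlt_le, inv_sq_pos | apply Rmax_r].
  - intros s _.
    apply (Ccv_ext (fun n => Cprod (cosine_factor (y + s)) n * / Cprod (cosine_factor y) n)).
    + intros n. apply Ceq_minus.
      replace (Cprod (fun k => 1 + a s k) n)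
        with (Cprod (fun k => 1 + a s k) n * Cprod (cosine_factor y) n
              * / Cprod (cosine_factor y) n)
        by (field; apply Cprod_neq_0; auto).
      rewrite <- Cprod_mult.
      rewrite (Cprod_ext (fun k => (1 + a s k) * cosine_factor y k) (cosine_factor (y + s))).
      * ring.
      * intros k _. rewrite !Hcf. unfold a, d.
        replace ((1 / 2 - y + INR k) * (1 / 2 + y + INR k))
          with ((INR k + 1 / 2) ^ 2 - y ^ 2) by field.
        assert ((INR k + 1 / 2) ^ 2 - y ^ 2 <> 0).
        { apply square_minus_neq_0.
          - replace (INR k + 1 / 2 - y) with (1 / 2 - y + INR k) by ring. auto.
          - replace (INR k + 1 / 2 + y) with (1 / 2 + y + INR k) by ring. auto. }
        specialize (Hk k). set (h := RtoC (INR k) + 1 / 2) in *.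
        field. auto.
    + apply Ccv_mult; [apply cosine_product|].
      apply Ccv_inv; [exact Hcos | | apply cosine_product].
      intros n. apply Cprod_neq_0. auto.
  - exact HB.
  - assert (HD : is_derive (fun z => Ccos (PI * z)) y (Ccos (PI * y) * B)).
    { apply (is_derive_quadratic _ _ _ (Cmod (Ccos (PI * y)) * K') 1); [lra|].
      intros s Hs.
      replace (Ccos (PI * (y + s)) - Ccos (PI * y) - s * (Ccos (PI * y) * B))
        with (Ccos (PI * y) * (Ccos (PI * (y + s)) / Ccos (PI * y) - 1 - s * B))
        by (field; auto).
      rewrite Cmod_mult, Rmult_assoc.
      apply Rmult_le_compat_l; [apply Cmod_ge_0 | now apply HK']. }
    pose proof (is_C_derive_unique _ _ _ HD) as U1.
    rewrite (is_C_derive_unique _ _ _ (is_derive_Ccos_PI y)) in U1.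
    replace (PI * Ctan (PI * y)) with (- B).
    + apply (Ccv_ext (fun n => - Csum b n)); [|now apply Ccv_opp].
      intros n. replace (- Csum b n) with (- (1) * Csum b n) by ring.
      rewrite <- Csum_scal. apply Csum_ext. intros k _. unfold b, d.
      specialize (Z1 k). specialize (Z2 k).
      replace (2 * y) with ((1 / 2 + y + INR k) - (1 / 2 - y + INR k)) by ring.
      set (A1 := 1 / 2 - y + INR k) in *. set (A2 := 1 / 2 + y + INR k) in *.
      field. auto.
    + unfold Ctan.
      assert (U2 : Ccos (PI * y) * B = - (PI * Csin (PI * y))) by (symmetry; exact U1).
      replace (- B) with (- (Ccos (PI * y) * B) / Ccos (PI * y)) by (field; auto).
      rewrite U2. field. auto.
Qed.

(** * Recurrence, asymptotics and duplication of the digamma function *)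

Lemma not_Gamma_pole_plus (z : C) (n : nat) : not_Gamma_pole z -> not_Gamma_pole (z + INR n).
Proof.
  intros Hz k E. apply (Hz (k + n)%nat). rewrite plus_INR, RtoC_plus.
  replace z with (z + INR n - INR n) by ring. rewrite E. ring.
Qed.

Lemma Cinv_cv_0 (z : C) : not_Gamma_pole z -> Ccv (fun n => / (z + INR n)) 0.
Proof.
  intros Hz. destruct (not_Gamma_pole_lower_bound z Hz) as [c [Hc B]].
  apply (Ccv_squeeze _ _ (fun n => / c * / (INR n + 1))%R).
  - intros n. replace (/ (z + INR n) - 0) with (/ (z + INR n)) by ring.
    rewrite Cmod_inv by now apply not_Gamma_pole_neq_0.
    rewrite <- Rinv_mult. apply Rinv_le_contravar; [|apply B].
    pose proof (pos_INR n). apply Rmult_lt_0_compat; lra.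
  - apply is_lim_seq_scal_0, is_lim_seq_inv_S.
Qed.

Lemma digamma_succ (z : C) : not_Gamma_pole z -> digamma (z + 1) = digamma z + / z.
Proof.
  intros Hz.
  assert (Hz1 : not_Gamma_pole (z + 1)) by apply (not_Gamma_pole_plus z 1 Hz).
  apply (Ccv_unique (Csum (psi_term (z + 1)))); [now apply digamma_cv|].
  apply (Ccv_ext (fun n => Csum (psi_term z) n + (/ z - / (z + INR n)))).
  - intros n. induction n as [|n IH].
    + simpl. rewrite Cplus_0_r. ring.
    + cbn [Csum]. rewrite <- IH. unfold psi_term.
      replace (z + 1 + INR n) with (z + INR (S n)) by (rewrite S_INR, RtoC_plus; ring).
      ring.
  - apply Ccv_plus; [now apply digamma_cv|].
    apply (Ccv_limit_eq _ (/ z - 0)); [ring|].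
    apply Ccv_minus; [apply Ccv_const | now apply Cinv_cv_0].
Qed.

Lemma digamma_shift (z : C) (n : nat) : not_Gamma_pole z ->
  digamma (z + INR n) = digamma z - Csum (psi_term z) n + ln (INR n + 1).
Proof.
  intros Hz. induction n as [|n IH].
  - simpl. rewrite Rplus_0_l, ln_1, Cplus_0_r. ring.
  - rewrite S_INR, RtoC_plus, Cplus_assoc.
    rewrite digamma_succ by now apply not_Gamma_pole_plus.
    rewrite IH, <- !Rsum_log_step, <- S_INR, <- Rsum_log_step. cbn [Csum Rsum].
    unfold psi_term. rewrite RtoC_plus. ring.
Qed.

(** By the recurrence the difference is exactly the remainder of the digamma series after [n]
    terms. *)
Lemma digamma_asymptotic (z : C) : not_Gamma_pole z ->
  Ccv (fun n => digamma (z + INR n) - ln (INR n + 1)) 0.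
Proof.
  intros Hz. replace (RtoC 0) with (digamma z - digamma z) by ring.
  apply (Ccv_ext (fun n => digamma z - Csum (psi_term z) n)).
  - intros n. rewrite digamma_shift by assumption. ring.
  - apply Ccv_minus; [apply Ccv_const | now apply digamma_cv].
Qed.

(** In the first 2n terms of the series at 1 + 2y, even indices give half the reciprocals of the
    series at 1/2 + y and odd ones half those at 1 + y. The logarithms leave 2 (ln(2n+1) - ln(n+1)),
    which tends to 2 ln 2. *)
Lemma digamma_duplication (y : C) :
  not_Gamma_pole (1 + 2 * y) -> not_Gamma_pole (1 + y) -> not_Gamma_pole (1 / 2 + y) ->
  2 * digamma (1 + 2 * y) = digamma (1 / 2 + y) + digamma (1 + y) + 2 * ln 2.
Proof.
  intros H2 H1 Hh.
  apply (Ccv_unique (fun n => 2 * Csum (psi_term (1 + 2 * y)) (2 * n))).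
  - apply Ccv_scal.
    apply (Ccv_subseq (Csum (psi_term (1 + 2 * y))) _ (fun n => 2 * n)%nat); [intros; lia|].
    now apply digamma_cv.
  - apply (Ccv_ext (fun n => Csum (psi_term (1 / 2 + y)) n + Csum (psi_term (1 + y)) n
        + 2 * (ln (INR (2 * n) + 1) - ln (INR n + 1))%R)).
    + intros n. rewrite <- !Rsum_log_step.
      induction n as [|n IH]; [simpl; rewrite Rminus_0_r; ring|].
      replace (2 * S n)%nat with (S (S (2 * n))) by lia. cbn [Csum Rsum].
      replace (Csum (psi_term (1 + 2 * y)) (2 * n)) with (/ 2 *
        (2 * Csum (psi_term (1 + 2 * y)) (2 * n))) by field.
      rewrite <- IH. unfold psi_term.
      rewrite !RtoC_minus, !RtoC_plus.
      replace (1 + 2 * y + INR (2 * n)) with (2 * (1 / 2 + y + INR n))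
        by (rewrite mult_INR, RtoC_mult; change (INR 2) with 2%R; field).
      replace (1 + 2 * y + INR (S (2 * n))) with (2 * (1 + y + INR n))
        by (rewrite S_INR, mult_INR, RtoC_plus, RtoC_mult; change (INR 2) with 2%R; field).
      pose proof (not_Gamma_pole_neq_0 _ n H1). pose proof (not_Gamma_pole_neq_0 _ n Hh).
      set (A1 := 1 + y + INR n) in *. set (A2 := 1 / 2 + y + INR n) in *.
      field. auto.
    + apply Ccv_plus; [apply Ccv_plus; now apply digamma_cv|]. apply Ccv_scal, Ccv_RtoC.
      apply (is_lim_seq_le_le (fun n => ln 2 - / (INR n + 1))%R _ (fun _ => ln 2)).
      * intros n. pose proof (pos_INR n) as Hn. rewrite mult_INR. change (INR 2) with 2%R.
        split.
        -- assert (T : (ln ((INR n + 1) * 2) - ln (2 * INR n + 1) <= / (INR n + 1))%R).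
           { rewrite <- ln_div by lra.
             rewrite <- (ln_exp (/ (INR n + 1))).
             apply ln_le; [apply Rdiv_lt_0_compat; lra|].
             eapply Rle_trans; [|apply exp_ineq1_le].
             apply (Rmult_le_reg_r ((2 * INR n + 1) * (INR n + 1))); [nra|].
             field_simplify; [|lra|lra]. nra. }
           rewrite ln_mult in T by lra. lra.
        -- assert (T : (ln (2 * INR n + 1) <= ln ((INR n + 1) * 2))%R)
             by (apply ln_le; lra).
           rewrite ln_mult in T by lra. lra.
      * replace (Finite (ln 2)) with (Finite (ln 2 - 0)) by (f_equal; ring).
        apply is_lim_seq_minus'; [apply is_lim_seq_const | apply is_lim_seq_inv_S].
      * apply is_lim_seq_const.
Qed.

Lemma digamma_1 : digamma 1 = - Euler_gamma.
Proof.
  pose proof (digamma_cv 1 not_Gamma_pole_1) as H.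
  apply Ccv_opp, Ccv_Re in H.
  assert (E : forall n, Re (- Csum (psi_term 1) n)
     = (sum_n_m (fun k => / INR k) 1 n - ln (INR n + 1))%R).
  { intros n. rewrite <- Rsum_log_step. induction n as [|n IH].
    - simpl. rewrite sum_n_m_zero by lia. unfold zero; simpl. ring.
    - cbn [Csum Rsum]. rewrite sum_n_Sm by lia.
      change (plus (sum_n_m (fun k => / INR k) 1 n) (/ INR (S n)))%R
        with (sum_n_m (fun k => / INR k) 1 n + / INR (S n))%R.
      replace (sum_n_m (fun k => / INR k) 1 n)%R
        with (Re (- Csum (psi_term 1) n) + Rsum log_step n)%R by (rewrite IH; ring).
      set (s := Csum (psi_term 1) n). unfold psi_term. rewrite <- RtoC_plus, <- RtoC_inv.
      2: pose proof (pos_INR n); lra.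
      replace (1 + INR n)%R with (INR (S n)) by (rewrite S_INR; ring).
      rewrite <- RtoC_minus. set (r := (/ INR (S n))%R).
      replace (Re (- (s + (log_step n - r)%R)))
        with (Re (- s) - (log_step n - r))%R
        by (unfold Re; simpl; ring).
      ring. }
  assert (L : is_lim_seq (fun n => sum_n_m (fun k => / INR k) 1 n - ln (INR n))%R
                (Re (- digamma 1))).
  { apply is_lim_seq_incr_1.
    (* The partial sum of length n + 1 subtracts ln(n+2) where the sequence of [Euler_gamma]
       subtracts ln(n+1); [log_step n] makes up the difference and tends to 0. *)
    apply (is_lim_seq_ext (fun n => Re (- Csum (psi_term 1) (S n)) + log_step n)%R).
    - intros n. rewrite E, <- Rsum_log_step. cbn [Rsum].
      rewrite Rsum_log_step, <- S_INR. ring.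
    - replace (Finite (Re (- digamma 1))) with (Finite (Re (- digamma 1) + 0))
        by (f_equal; ring).
      apply is_lim_seq_plus'.
      + now apply -> (is_lim_seq_incr_1 (fun n => Re (- Csum (psi_term 1) n))).
      + apply (is_lim_seq_le_le (fun _ => 0%R) _ (fun n => / (INR n + 1))%R).
        * intros n. apply log_step_bounds.
        * apply is_lim_seq_const.
        * apply is_lim_seq_inv_S. }
  unfold Euler_gamma. rewrite (is_lim_seq_unique _ _ L). cbn [real].
  (* The limit above settles the real part only; the imaginary part vanishes because all the partial
     sums are real. *)
  assert (Hi : Im (digamma 1) = 0%R).
  { pose proof (Ccv_Im _ _ (digamma_cv 1 not_Gamma_pole_1)) as HI.
    apply is_lim_seq_unique in HI.
    rewrite (Lim_seq_ext _ (fun _ => 0%R)), Lim_seq_const in HI; [now injection HI|].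
    intros n. induction n as [|n IH]; [reflexivity|].
    cbn [Csum]. set (s := Csum (psi_term 1) n) in *. unfold psi_term.
    rewrite <- RtoC_plus, <- RtoC_inv, <- RtoC_minus.
    - unfold Im in *. simpl. rewrite IH. ring.
    - pose proof (pos_INR n); lra. }
  clear - Hi. revert Hi. generalize (digamma 1). intros [d1 d2]. simpl. intros ->.
  apply injective_projections; simpl; ring.
Qed.

(** * The summand *)

Definition x_prod (x : C) : nat -> C :=
  Cprod (fun k => ((INR k + 1 / 2) ^ 2 - x ^ 2) / ((INR k + 1) ^ 2 - x ^ 2)).

Definition y_prod (y : C) : nat -> C :=
  Cprod (fun k => ((INR k + 1) ^ 2 - y ^ 2) / ((INR k + 3 / 2) ^ 2 - y ^ 2)).

Definition term (x y : C) (m : nat) : C :=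
  y ^ 2 / (1 - 4 * y ^ 2) * y_prod y m
  * (x_prod x m / (2 * INR m + 1) + x_prod x (S m) / (2 * INR m + 2)).

Lemma RtoC_neq_0 (r : R) : r <> 0%R -> RtoC r <> 0.
Proof. intros H E. now apply RtoC_inj in E. Qed.

Lemma non_integer_plus (x : C) (j : Z) :
  (forall k : Z, x <> IZR k) -> x + IZR j <> 0.
Proof.
  intros Hx E. apply (Hx (- j)%Z). rewrite opp_IZR, RtoC_opp.
  replace x with (x + IZR j - IZR j) by ring. rewrite E. ring.
Qed.

Lemma non_integer_plus_INR (x : C) (n : nat) (j : Z) :
  (forall k : Z, x <> IZR k) -> x + INR n + IZR j <> 0.
Proof.
  intros Hx. rewrite <- Cplus_assoc, <- RtoC_plus, INR_IZR_INZ, <- plus_IZR.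
  now apply non_integer_plus.
Qed.

Lemma non_integer_minus_INR (x : C) (n : nat) (j : Z) :
  (forall k : Z, x <> IZR k) -> INR n + IZR j - x <> 0.
Proof.
  intros Hx E. apply (non_integer_plus x (- (Z.of_nat n + j))%Z Hx).
  rewrite opp_IZR, plus_IZR, <- INR_IZR_INZ, RtoC_opp, RtoC_plus.
  replace (x + - (INR n + IZR j)) with (- (INR n + IZR j - x)) by ring.
  rewrite E. ring.
Qed.

(* Solves [E <> 0] from a hypothesis [A <> 0] with [A = c * E], [c] a small rational. *)
Ltac neq0_scaled c :=
  match goal with
  | H : ?A <> RtoC 0 |- ?E <> RtoC 0 =>
      let X := fresh in
      solve [intros X; apply H; replace A with (c * E) by (cbv beta; field);
             rewrite X; ring]
  end.
Ltac neq0 :=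
  cbv beta; first [assumption | neq0_scaled (RtoC 1) | neq0_scaled (1 / 2) | neq0_scaled (1 / 4)
         | neq0_scaled (RtoC 2) | neq0_scaled (RtoC 4)
         | neq0_scaled (- RtoC 1) | neq0_scaled (- (1 / 2)) | neq0_scaled (- (1 / 4))
         | (apply RtoC_neq_0; lra)].
Ltac neq0s := repeat match goal with |- _ /\ _ => split end; try neq0.

Lemma x_denominator_neq_0 (x : C) (n : nat) :
  (forall k : Z, x <> IZR k) -> (INR n + 1) ^ 2 - x ^ 2 <> 0.
Proof.
  intros Hx. apply square_minus_neq_0.
  - exact (non_integer_minus_INR x n 1 Hx).
  - replace (INR n + 1 + x) with (x + INR n + IZR 1) by ring.
    now apply non_integer_plus_INR.
Qed.

Lemma half_integer_plus (y : C) (n : nat) (j : Z) :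
  (forall k : Z, y <> IZR k + 1 / 2) -> INR n + (IZR j + 1 / 2) + y <> 0.
Proof.
  intros Hy E. apply (Hy (- (Z.of_nat n + j) - 1)%Z).
  rewrite minus_IZR, opp_IZR, plus_IZR, <- INR_IZR_INZ, RtoC_minus, RtoC_opp, RtoC_plus.
  apply Ceq_minus. replace (RtoC 0) with (INR n + (IZR j + 1 / 2) + y). field.
Qed.

Lemma half_integer_minus (y : C) (n : nat) (j : Z) :
  (forall k : Z, y <> IZR k + 1 / 2) -> INR n + (IZR j + 1 / 2) - y <> 0.
Proof.
  intros Hy E. apply (Hy (Z.of_nat n + j)%Z).
  rewrite plus_IZR, <- INR_IZR_INZ, RtoC_plus.
  apply Ceq_minus. replace (RtoC 0) with (- (INR n + (IZR j + 1 / 2) - y)).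
  - ring.
  - rewrite E. ring.
Qed.

Lemma y_denominator_neq_0 (y : C) (n : nat) :
  (forall k : Z, y <> IZR k + 1 / 2) -> (INR n + 3 / 2) ^ 2 - y ^ 2 <> 0.
Proof.
  intros Hy. replace (3 / 2) with (IZR 1 + 1 / 2) by field. apply square_minus_neq_0.
  - now apply half_integer_minus.
  - now apply half_integer_plus.
Qed.

Lemma y_denominator_half_neq_0 (y : C) (n : nat) :
  (forall k : Z, y <> IZR k + 1 / 2) -> (INR n + 1 / 2) ^ 2 - y ^ 2 <> 0.
Proof.
  intros Hy. replace (1 / 2) with (IZR 0 + 1 / 2) by field. apply square_minus_neq_0.
  - now apply half_integer_minus.
  - now apply half_integer_plus.
Qed.

Lemma four_y2_neq_0 (y : C) :
  (forall k : Z, y <> IZR k + 1 / 2) -> 1 - 4 * y ^ 2 <> 0.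
Proof.
  intros Hy. pose proof (y_denominator_half_neq_0 y 0 Hy) as H. simpl INR in H. neq0.
Qed.

Lemma pochhammer_pair (a x : C) (m : nat) :
  pochhammer (a - x) m * pochhammer (a + x) m = Cprod (fun k => (a + INR k) ^ 2 - x ^ 2) m.
Proof.
  induction m as [|m IH]; simpl pochhammer; cbn [Cprod]; [ring|]. rewrite <- IH. ring.
Qed.

Lemma pochhammer_succ (a : C) (m : nat) :
  pochhammer (a + 1) m * a = pochhammer a m * (a + INR m).
Proof.
  induction m as [|m IH]; [simpl; ring|]. cbn [pochhammer].
  replace (pochhammer (a + 1) m * (a + 1 + INR m) * a)
    with (pochhammer (a + 1) m * a * (a + 1 + INR m)) by ring.
  rewrite IH, S_INR, RtoC_plus. ring.
Qed.

Lemma Cprod_square_shift (a x : C) (m : nat) :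
  Cprod (fun k => (a + 1 + INR k) ^ 2 - x ^ 2) m * (a ^ 2 - x ^ 2)
  = Cprod (fun k => (a + INR k) ^ 2 - x ^ 2) (S m).
Proof.
  induction m as [|m IH]; [simpl; ring|].
  cbn [Cprod] in *.
  transitivity (Cprod (fun k => (a + 1 + INR k) ^ 2 - x ^ 2) m * (a ^ 2 - x ^ 2)
     * ((a + 1 + INR m) ^ 2 - x ^ 2)); [ring|].
  rewrite IH, S_INR, RtoC_plus. ring.
Qed.

Lemma Cprod_div (f g : nat -> C) (m : nat) :
  (forall k, (k < m)%nat -> g k <> 0) ->
  Cprod (fun k => f k / g k) m = Cprod f m / Cprod g m.
Proof.
  induction m as [|m IH]; intros Hg; cbn [Cprod]; [field|].
  rewrite IH by (intros; apply Hg; lia). field.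
  split; [apply Hg; lia | apply Cprod_neq_0; intros; apply Hg; lia].
Qed.

Lemma x_prod_eq (x : C) (m : nat) : (forall k : Z, x <> IZR k) ->
  x_prod x m = pochhammer (1 / 2 - x) m * pochhammer (1 / 2 + x) m
               / (pochhammer (1 - x) m * pochhammer (1 + x) m).
Proof.
  intros Hx. rewrite !pochhammer_pair. unfold x_prod.
  rewrite Cprod_div by (intros; now apply x_denominator_neq_0).
  f_equal; apply Cprod_ext; intros; ring.
Qed.

Lemma y_prod_eq (y : C) (m : nat) : (forall k : Z, y <> IZR k + 1 / 2) ->
  y_prod y m = pochhammer (1 - y) m * pochhammer (1 + y) m
               / (pochhammer (3 / 2 - y) m * pochhammer (3 / 2 + y) m).
Proof.
  intros Hy. rewrite !pochhammer_pair. unfold y_prod.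
  rewrite Cprod_div by (intros; now apply y_denominator_neq_0).
  f_equal; apply Cprod_ext; intros; ring.
Qed.

Lemma not_Gamma_pole_non_integer (x : C) (j : Z) : (forall k : Z, x <> IZR k) ->
  not_Gamma_pole (IZR j + x) /\ not_Gamma_pole (IZR j - x).
Proof.
  intros Hx. split; intros n E.
  - apply (non_integer_plus_INR x n j Hx).
    replace (x + INR n + IZR j) with (IZR j + x + INR n) by ring. rewrite E. ring.
  - apply (non_integer_minus_INR x n j Hx).
    replace (INR n + IZR j - x) with (IZR j - x + INR n) by ring. rewrite E. ring.
Qed.

Lemma not_Gamma_pole_half_integer (y : C) :
  (forall k : Z, y <> IZR k + 1 / 2) ->
  not_Gamma_pole (3 / 2 + y) /\ not_Gamma_pole (3 / 2 - y).
Proof.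
  intros Hy. split; intros n E.
  - apply (half_integer_plus y n 1 Hy).
    replace (INR n + (1 + 1 / 2) + y) with (3 / 2 + y + INR n) by field. rewrite E. ring.
  - apply (half_integer_minus y n 1 Hy).
    replace (INR n + (1 + 1 / 2) - y) with (3 / 2 - y + INR n) by field. rewrite E. ring.
Qed.

(** [pochhammer 1 m] cancels the factorial, and the quotient of [pochhammer (1 / 2) m] by
    [pochhammer (3 / 2) m] telescopes to 1/(2m+1). *)
Lemma F_odd_eq (x y : C) (m : nat) :
  (forall k : Z, x <> IZR k) -> (forall k : Z, y <> IZR k + 1 / 2) ->
  F_odd x y m = y ^ 2 / (1 - 4 * y ^ 2) * y_prod y m * (x_prod x m / (2 * INR m + 1)).
Proof.
  intros Hx Hy. rewrite x_prod_eq, y_prod_eq by assumption. unfold F_odd.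
  destruct (not_Gamma_pole_non_integer x 1 Hx) as [N1 N2].
  destruct (not_Gamma_pole_half_integer y Hy) as [N3 N4].
  pose proof (pochhammer_neq_0 _ m N1). pose proof (pochhammer_neq_0 _ m N2).
  pose proof (pochhammer_neq_0 _ m N3). pose proof (pochhammer_neq_0 _ m N4).
  pose proof (four_y2_neq_0 y Hy).
  assert (P3 : pochhammer (3 / 2) m <> 0).
  { apply pochhammer_neq_0. rewrite <- RtoC_div by lra. apply not_Gamma_pole_RtoC. lra. }
  assert (Hm : 2 * INR m + 1 <> 0).
  { rewrite <- RtoC_mult, <- RtoC_plus. apply RtoC_neq_0. pose proof (pos_INR m). lra. }
  assert (P1 : pochhammer (1 / 2) m = pochhammer (3 / 2) m / (2 * INR m + 1)).
  { replace (3 / 2) with (1 / 2 + 1) by field.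
    replace (pochhammer (1 / 2 + 1) m / (2 * INR m + 1))
      with (pochhammer (1 / 2 + 1) m * (1 / 2) * (2 / (2 * INR m + 1))) by (field; neq0s).
    rewrite pochhammer_succ. field. neq0s. }
  rewrite P1, pochhammer_1. clear P1.
  assert (RtoC (INR (fact m)) <> 0) by (apply RtoC_neq_0, INR_fact_neq_0).
  generalize dependent (pochhammer (1 - x) m). generalize dependent (pochhammer (1 + x) m).
  generalize dependent (pochhammer (3 / 2 - y) m). generalize dependent (pochhammer (3 / 2 + y) m).
  generalize dependent (pochhammer (3 / 2) m).
  generalize dependent (RtoC (INR (fact m))).
  generalize (pochhammer (1 / 2 - x) m) (pochhammer (1 / 2 + x) m) (pochhammer (1 - y) m)
    (pochhammer (1 + y) m).
  generalize dependent (RtoC (INR m)). intros. field. neq0s.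
Qed.

(** The x-dependent part of the prefactor is, up to a constant, the factor of index 0 of
    [x_prod x (S m)]; the symbols at 1 and 2 together with the factorial leave 1/(m+1). *)
Lemma F_even_eq (x y : C) (m : nat) :
  (forall k : Z, x <> IZR k) -> (forall k : Z, y <> IZR k + 1 / 2) ->
  F_even x y m = y ^ 2 / (1 - 4 * y ^ 2) * y_prod y m * (x_prod x (S m) / (2 * INR m + 2)).
Proof.
  intros Hx Hy. rewrite x_prod_eq, y_prod_eq by assumption. unfold F_even.
  destruct (not_Gamma_pole_non_integer x 1 Hx) as [N1 N2].
  destruct (not_Gamma_pole_non_integer x 2 Hx) as [N5 N6].
  destruct (not_Gamma_pole_half_integer y Hy) as [N3 N4].
  pose proof (pochhammer_neq_0 _ (S m) N1). pose proof (pochhammer_neq_0 _ (S m) N2).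
  pose proof (pochhammer_neq_0 _ m N3). pose proof (pochhammer_neq_0 _ m N4).
  pose proof (pochhammer_neq_0 _ m N5). pose proof (pochhammer_neq_0 _ m N6).
  pose proof (four_y2_neq_0 y Hy).
  assert (Hx1 : 1 - x ^ 2 <> 0).
  { pose proof (x_denominator_neq_0 x 0 Hx) as H'. simpl INR in H'. neq0. }
  assert (Hm : 2 * INR m + 2 <> 0).
  { rewrite <- RtoC_mult, <- RtoC_plus. apply RtoC_neq_0. pose proof (pos_INR m). lra. }
  assert (E2 : pochhammer 2 m = INR (fact m) * (INR m + 1)).
  { rewrite <- pochhammer_1.
    replace (RtoC 2) with (1 + 1) by ring.
    rewrite <- (Cmult_1_r (pochhammer (1 + 1) m)), pochhammer_succ. ring. }
  (* Both sides are compared through pairs, to absorb the shifts [1 -> 2], [1/2 -> 3/2]. *)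
  assert (S1 : pochhammer (1 - x) (S m) * pochhammer (1 + x) (S m)
     = (pochhammer (2 - x) m * pochhammer (2 + x) m) * (1 - x ^ 2)).
  { rewrite !pochhammer_pair, <- (Cprod_square_shift 1 x m).
    replace (1 ^ 2) with (RtoC 1) by ring. f_equal. apply Cprod_ext. intros; ring. }
  assert (S2 : pochhammer (1 / 2 - x) (S m) * pochhammer (1 / 2 + x) (S m)
     = (pochhammer (3 / 2 - x) m * pochhammer (3 / 2 + x) m) * (1 / 4 - x ^ 2)).
  { rewrite !pochhammer_pair, <- (Cprod_square_shift (1 / 2) x m).
    f_equal; [|field]. apply Cprod_ext. intros; field. }
  rewrite S1, S2, E2, pochhammer_1.
  assert (RtoC (INR (fact m)) <> 0) by (apply RtoC_neq_0, INR_fact_neq_0).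
  clear S1 S2 E2.
  generalize dependent (pochhammer (2 - x) m). generalize dependent (pochhammer (2 + x) m).
  generalize dependent (pochhammer (3 / 2 - y) m). generalize dependent (pochhammer (3 / 2 + y) m).
  generalize dependent (RtoC (INR (fact m))).
  generalize (pochhammer (3 / 2 - x) m) (pochhammer (3 / 2 + x) m) (pochhammer (1 - y) m)
    (pochhammer (1 + y) m).
  generalize dependent (RtoC (INR m)). intros. field. neq0s.
Qed.

Lemma F_sum_eq (x y : C) (m : nat) :
  (forall k : Z, x <> IZR k) -> (forall k : Z, y <> IZR k + 1 / 2) ->
  F_even x y m + F_odd x y m = term x y m.
Proof.
  intros Hx Hy. rewrite F_even_eq, F_odd_eq by assumption. unfold term. ring.
Qed.

Lemma non_integer_succ (x : C) : (forall k : Z, x <> IZR k) -> forall k : Z, x + 1 <> IZR k.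
Proof.
  intros Hx k E. apply (Hx (k - 1)%Z). rewrite minus_IZR, RtoC_minus, <- E. ring.
Qed.

(** Adding 1 to [x] moves the factors in k - x and those in k + x by one index in opposite
    directions. The length [S m] on the left aligns the former with those of [x_prod x m]; only end
    factors survive. *)
Lemma x_prod_succ (x : C) (m : nat) : (forall k : Z, x <> IZR k) ->
  x_prod (x + 1) (S m) = x_prod x m
    * ((x + 1) * (INR m + 1 / 2 + x) * (INR m + 3 / 2 + x)
       / (x * (INR m + 1 + x) * (INR m + 2 + x))).
Proof.
  intros Hx. pose proof (Hx 0%Z) as H0.
  assert (H1 : x + 1 <> 0) by exact (non_integer_plus x 1 Hx).
  induction m as [|m IH].
  - assert (H2 : x + 2 <> 0) by exact (non_integer_plus x 2 Hx).
    assert (H3 : (0 + 1) ^ 2 - (x + 1) ^ 2 <> 0).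
    { replace ((0 + 1) ^ 2 - (x + 1) ^ 2) with (- (x * (x + 2))) by ring.
      intros E. apply (Cmult_neq_0 x (x + 2)); auto.
      replace (x * (x + 2)) with (- - (x * (x + 2))) by ring. rewrite E. ring. }
    unfold x_prod. cbn [Cprod]. simpl INR. field. neq0s.
  - unfold x_prod in *. cbn [Cprod]. cbn [Cprod] in IH. rewrite IH. rewrite S_INR, RtoC_plus.
    pose proof (non_integer_plus_INR x m 1 Hx). pose proof (non_integer_plus_INR x m 2 Hx).
    pose proof (non_integer_plus_INR x m 3 Hx).
    pose proof (non_integer_minus_INR x m 1 Hx).
    pose proof (x_denominator_neq_0 x m Hx).
    pose proof (x_denominator_neq_0 (x + 1) (S m) (non_integer_succ x Hx)) as HS.
    rewrite S_INR, RtoC_plus in HS.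
    generalize dependent (RtoC (INR m)). intros n. intros.
    field. neq0s.
Qed.

(** * Telescoping in x *)

(* Gosper's algorithm, applied to [term (x + 1) y m - term x y m], returns the
   rational function of [m] below. *)
Definition cert (x y m : C) : C :=
  ((1 / 4 - y ^ 2 / 4 + 5 * x / 4 - x * y ^ 2 + 9 * x ^ 2 / 4 - x ^ 2 * y ^ 2
      + 2 * x ^ 3 + x ^ 4)
   + (y ^ 2 - x - x ^ 2 - 1 / 2) * (m / 2 + m ^ 2))
  / (x * ((x + 1) ^ 2 - y ^ 2) * (x ^ 2 - y ^ 2)).

(** Gosper's antidifference at m + 1, written with the products of index [m] so that its limit can
    be read off from [x_prod_y_prod]. *)
Definition boundary (x y : C) (m : nat) : C :=
  y ^ 2 / (1 - 4 * y ^ 2) * x_prod x m * y_prod y m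
  * (cert x y (INR m + 1) * (INR m + 1 / 2 + x) * ((INR m + 1) ^ 2 - y ^ 2)
     / ((INR m + 2 + x) * ((INR m + 1) ^ 2 - x ^ 2))).

(** The contribution of the lower end of the telescoped sum. It is also the part of the increment of
    the closed form that is free of cot(PI x) tan(PI y). *)
Definition rational_part (x y : C) : C :=
  1 / 16 * (/ (x + 1 + y) + / (x + 1 - y) + / (x + y) + / (x - y))
  - 1 / 8 * (/ x + / (x + 1)).

Lemma telescoped_sum (x y : C) (M : nat) :
  (forall k : Z, x <> IZR k) -> (forall k : Z, y <> IZR k + 1 / 2) ->
  not_Gamma_pole (x + y) -> not_Gamma_pole (x - y) ->
  Csum (fun m => term (x + 1) y m - term x y m) (S M)
  = boundary x y M + rational_part x y.
Proof.
  intros Hx Hy Hp Hm.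
  pose proof (not_Gamma_pole_neq_0 _ 0 Hp) as A1. pose proof (not_Gamma_pole_neq_0 _ 0 Hm) as A2.
  pose proof (not_Gamma_pole_neq_0 _ 1 Hp) as A3. pose proof (not_Gamma_pole_neq_0 _ 1 Hm) as A4.
  simpl INR in A1, A2, A3, A4.
  assert (B1 : x ^ 2 - y ^ 2 <> 0) by (apply square_minus_neq_0; neq0).
  assert (B2 : (x + 1) ^ 2 - y ^ 2 <> 0) by (apply square_minus_neq_0; neq0).
  pose proof (four_y2_neq_0 y Hy) as B3.
  pose proof (Hx 0%Z) as B4. pose proof (non_integer_plus x 1 Hx) as B5.
  pose proof (non_integer_plus x 2 Hx) as B6.
  induction M as [|M IH].
  - pose proof (y_denominator_neq_0 y 0 Hy) as B7.
    pose proof (x_denominator_neq_0 x 0 Hx) as B8.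
    cbn [Csum]. unfold term, boundary, rational_part, cert. rewrite x_prod_succ by assumption.
    unfold x_prod, y_prod. cbn [Cprod]. simpl INR. simpl INR in B7, B8.
    field. neq0s.
  - change (Csum (fun m => term (x + 1) y m - term x y m) (S (S M)))
      with (Csum (fun m => term (x + 1) y m - term x y m) (S M)
            + (term (x + 1) y (S M) - term x y (S M))).
    rewrite IH.
    (* Once every product is expressed through [x_prod x M] and [y_prod y M], these factor out and
       an identity of rational functions in M, x and y remains. *)
    cut (term (x + 1) y (S M) - term x y (S M) = boundary x y (S M) - boundary x y M).
    { intros E. rewrite E. ring. }
    pose proof (non_integer_plus_INR x M 1 Hx) as C1.
    pose proof (non_integer_plus_INR x M 2 Hx) as C2.
    pose proof (non_integer_plus_INR x M 3 Hx) as C3.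
    pose proof (x_denominator_neq_0 x M Hx) as C4.
    pose proof (x_denominator_neq_0 x (S M) Hx) as C5.
    pose proof (y_denominator_neq_0 y M Hy) as C6.
    pose proof (y_denominator_neq_0 y (S M) Hy) as C7.
    assert (C8 : 2 * (RtoC (INR M) + 1) + 1 <> 0).
    { rewrite <- RtoC_plus, <- RtoC_mult, <- RtoC_plus. apply RtoC_neq_0.
      pose proof (pos_INR M). lra. }
    assert (C9 : 2 * (RtoC (INR M) + 1) + 2 <> 0).
    { rewrite <- RtoC_plus, <- RtoC_mult, <- RtoC_plus. apply RtoC_neq_0.
      pose proof (pos_INR M). lra. }
    unfold term, boundary, cert. rewrite !x_prod_succ by assumption.
    change (x_prod x (S (S M))) with (x_prod x (S M) *
      (((INR (S M) + 1 / 2) ^ 2 - x ^ 2) / ((INR (S M) + 1) ^ 2 - x ^ 2))).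
    change (x_prod x (S M)) with (x_prod x M *
      (((INR M + 1 / 2) ^ 2 - x ^ 2) / ((INR M + 1) ^ 2 - x ^ 2))).
    change (y_prod y (S M)) with (y_prod y M *
      (((INR M + 1) ^ 2 - y ^ 2) / ((INR M + 3 / 2) ^ 2 - y ^ 2))).
    rewrite S_INR, RtoC_plus in *.
    generalize dependent (x_prod x M). generalize dependent (y_prod y M).
    clear IH Hx Hy Hp Hm.
    generalize dependent (RtoC (INR M)). intros n. intros.
    clear B6 A1 A2 A3 A4.
    field. neq0s.
Qed.

(** * Limit of the boundary term *)

Lemma sine_factor_eq (z : C) (k : nat) :
  sine_factor z k = ((INR k + 1) ^ 2 - z ^ 2) / (INR k + 1) ^ 2.
Proof.
  unfold sine_factor. assert (Hk : RtoC (INR k) + 1 <> 0)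
    by (apply (RtoC_INR_plus_neq_0 k 1); lra).
  set (h := RtoC (INR k) + 1) in *. field. exact Hk.
Qed.

Lemma sine_factor_neq_0 (x : C) (k : nat) :
  (forall k : Z, x <> IZR k) -> sine_factor x k <> 0.
Proof.
  intros Hx. rewrite sine_factor_eq. apply Cdiv_neq_0.
  - now apply x_denominator_neq_0.
  - apply Cpow_nz. apply (RtoC_INR_plus_neq_0 k 1); lra.
Qed.

(** The normalising squares (k+1/2)^2/(k+1)^2 and (k+1)^2/(k+3/2)^2 multiply to (k+1/2)^2/(k+3/2)^2,
    which telescopes. The last factor decays like 1/m^2 and is balanced by the quadratic polynomial
    in [cert]. *)
Lemma x_prod_y_prod (x y : C) (m : nat) :
  (forall k : Z, x <> IZR k) -> (forall k : Z, y <> IZR k + 1 / 2) ->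
  x_prod x m * y_prod y m
  = Cprod (cosine_factor x) m * / Cprod (sine_factor x) m
    * (Cprod (sine_factor y) m * / Cprod (cosine_factor y) m)
    * ((1 / 4 - y ^ 2) / ((INR m + 1 / 2) ^ 2 - y ^ 2)).
Proof.
  intros Hx Hy. induction m as [|m IH].
  - unfold x_prod, y_prod. cbn [Cprod]. simpl INR.
    pose proof (four_y2_neq_0 y Hy). field. neq0s.
  - unfold x_prod, y_prod in *. cbn [Cprod] in *.
    set (px := Cprod (fun k => ((INR k + 1 / 2) ^ 2 - x ^ 2) / ((INR k + 1) ^ 2 - x ^ 2)) m) in *.
    set (py := Cprod (fun k => ((INR k + 1) ^ 2 - y ^ 2) / ((INR k + 3 / 2) ^ 2 - y ^ 2)) m) in *.
    transitivity (px * py * (((INR m + 1 / 2) ^ 2 - x ^ 2) / ((INR m + 1) ^ 2 - x ^ 2)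
      * (((INR m + 1) ^ 2 - y ^ 2) / ((INR m + 3 / 2) ^ 2 - y ^ 2)))); [ring|].
    rewrite IH.
    assert (S1 : Cprod (sine_factor x) m <> 0)
      by (apply Cprod_neq_0; intros; now apply sine_factor_neq_0).
    assert (S2 : Cprod (cosine_factor y) m <> 0)
      by (apply Cprod_neq_0; intros; now apply cosine_factor_neq_0).
    rewrite !sine_factor_eq, !cosine_factor_eq, S_INR, RtoC_plus.
    pose proof (x_denominator_neq_0 x m Hx) as D1.
    pose proof (y_denominator_neq_0 y m Hy) as D2.
    pose proof (y_denominator_half_neq_0 y m Hy) as D3.
    pose proof (half_plus_neq_0 m) as D4.
    assert (D5 : RtoC (INR m) + 1 <> 0) by (apply (RtoC_INR_plus_neq_0 m 1); lra).
    clear IH px py.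
    generalize dependent (Cprod (sine_factor x) m).
    generalize dependent (Cprod (cosine_factor y) m).
    generalize (Cprod (sine_factor y) m) (Cprod (cosine_factor x) m).
    generalize dependent (RtoC (INR m)). intros. field. neq0s.
Qed.

Definition limit_part (x y : C) : C :=
  1 / 16 * (Ccot (PI * x) * Ctan (PI * y))
  * (/ (x + 1 + y) - / (x + 1 - y) + / (x + y) - / (x - y)).

Ltac Ccv_tac H :=
  repeat lazymatch goal with
  | |- Ccv (fun m => @?f m - @?g m) (?a - ?b) => apply (Ccv_minus f g a b)
  | |- Ccv (fun m => @?f m + @?g m) (?a + ?b) => apply (Ccv_plus f g a b)
  | |- Ccv (fun m => @?f m * @?g m) (?a * ?b) => apply (Ccv_mult f g a b)
  | |- _ => first [exact H | apply Ccv_const]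
  end.

(** The denominator has degree five in [m] and leading coefficient 1; [q] is the coefficient of
    degree five of the numerator. Dividing both by (m+1)^5 turns them into polynomials in
    1/(m+1). *)
Lemma rational_cv (q n0 x y : C) :
  (forall k : Z, x <> IZR k) -> (forall k : Z, y <> IZR k + 1 / 2) ->
  Ccv (fun m => (n0 + q * ((INR m + 1) / 2 + (INR m + 1) ^ 2))
         * (INR m + 1 / 2 + x) * ((INR m + 1) ^ 2 - y ^ 2)
         / (((INR m + 1 / 2) ^ 2 - y ^ 2) * (INR m + 2 + x) * ((INR m + 1) ^ 2 - x ^ 2))) q.
Proof.
  intros Hx Hy.
  assert (Hu : Ccv (fun m => / (RtoC (INR m) + 1)) 0).
  { apply (Ccv_ext (fun m => / (1 + INR m))); [intros n; f_equal; ring|].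
    apply Cinv_cv_0, not_Gamma_pole_1. }
  set (u := fun m => / (RtoC (INR m) + 1)) in Hu.
  set (den := fun m => ((1 - 1 / 2 * u m) * (1 - 1 / 2 * u m) - y ^ 2 * (u m * u m))
      * (1 + (1 + x) * u m) * (1 - x ^ 2 * (u m * u m))).
  set (num := fun m => (n0 * (u m * u m) + q * (1 / 2 * u m + 1))
      * (1 + (x - 1 / 2) * u m) * (1 - y ^ 2 * (u m * u m))).
  assert (Hn : Ccv num q).
  { replace q with ((n0 * (0 * 0) + q * (1 / 2 * 0 + 1))
      * (1 + (x - 1 / 2) * 0) * (1 - y ^ 2 * (0 * 0))) by ring.
    unfold num. Ccv_tac Hu. }
  assert (Hd : Ccv den 1).
  { replace (RtoC 1) with (((1 - 1 / 2 * 0) * (1 - 1 / 2 * 0) - y ^ 2 * (0 * 0))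
      * (1 + (1 + x) * 0) * (1 - x ^ 2 * (0 * 0))) by ring.
    unfold den. Ccv_tac Hu. }
  assert (Hm : forall m, RtoC (INR m) + 1 <> 0)
    by (intros m; apply (RtoC_INR_plus_neq_0 m 1); lra).
  assert (Hden : forall m, den m = (((INR m + 1 / 2) ^ 2 - y ^ 2) * (INR m + 2 + x)
      * ((INR m + 1) ^ 2 - x ^ 2)) * (/ (INR m + 1)) ^ 5).
  { intros m. unfold den, u. specialize (Hm m). field. exact Hm. }
  assert (Hden0 : forall m, ((INR m + 1 / 2) ^ 2 - y ^ 2) * (INR m + 2 + x)
      * ((INR m + 1) ^ 2 - x ^ 2) <> 0).
  { intros m. apply Cmult_neq_0; [apply Cmult_neq_0|].
    - now apply y_denominator_half_neq_0.
    - pose proof (non_integer_plus_INR x m 2 Hx). neq0.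
    - now apply x_denominator_neq_0. }
  assert (Hd0 : forall m, den m <> 0).
  { intros m. rewrite Hden. apply Cmult_neq_0; [apply Hden0|].
    apply Cpow_nz. intros E. apply C1_nz.
    rewrite <- (Cinv_r (RtoC (INR m) + 1)) by apply Hm. rewrite E. ring. }
  apply (Ccv_ext (fun m => num m * / den m)).
  - intros m. rewrite Hden. unfold num, u. specialize (Hm m). specialize (Hden0 m).
    set (D := ((INR m + 1 / 2) ^ 2 - y ^ 2) * (INR m + 2 + x) * ((INR m + 1) ^ 2 - x ^ 2)) in *.
    field. neq0s.
  - replace q with (q * / 1) by field. apply Ccv_mult; [exact Hn|].
    apply Ccv_inv; [apply C1_nz | exact Hd0 | exact Hd].
Qed.

Lemma boundary_cv (x y : C) :
  (forall k : Z, x <> IZR k) -> (forall k : Z, y <> IZR k + 1 / 2) ->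
  not_Gamma_pole (x + y) -> not_Gamma_pole (x - y) ->
  Ccv (boundary x y) (limit_part x y).
Proof.
  intros Hx Hy Hp Hm.
  pose proof (not_Gamma_pole_neq_0 _ 0 Hp) as A1. pose proof (not_Gamma_pole_neq_0 _ 0 Hm) as A2.
  pose proof (not_Gamma_pole_neq_0 _ 1 Hp) as A3. pose proof (not_Gamma_pole_neq_0 _ 1 Hm) as A4.
  simpl INR in A1, A2, A3, A4.
  assert (B1 : x ^ 2 - y ^ 2 <> 0) by (apply square_minus_neq_0; neq0).
  assert (B2 : (x + 1) ^ 2 - y ^ 2 <> 0) by (apply square_minus_neq_0; neq0).
  pose proof (four_y2_neq_0 y Hy) as B3. pose proof (Hx 0%Z) as B4.
  destruct (sine_product x) as [sx [Hsx Esx]]. destruct (sine_product y) as [sy [Hsy Esy]].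
  pose proof (Csin_PI_neq_0 x Hx) as Hsin. pose proof (Ccos_PI_neq_0 y Hy) as Hcos.
  assert (Hpi : RtoC PI <> 0) by (apply RtoC_neq_0; pose proof PI_RGT_0; lra).
  assert (Hsx0 : sx <> 0).
  { intros E. apply Hsin. rewrite <- Esx, E. ring. }
  set (D := x * ((x + 1) ^ 2 - y ^ 2) * (x ^ 2 - y ^ 2)).
  assert (HD : D <> 0) by (repeat apply Cmult_neq_0; assumption).
  set (q := y ^ 2 - x - x ^ 2 - 1 / 2).
  set (n0 := 1 / 4 - y ^ 2 / 4 + 5 * x / 4 - x * y ^ 2 + 9 * x ^ 2 / 4 - x ^ 2 * y ^ 2
      + 2 * x ^ 3 + x ^ 4).
  (* The factor 1/4 - y^2 from [x_prod_y_prod] cancels 1 - 4 y^2 and leaves the 4 in the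
     denominator. *)
  apply (Ccv_ext (fun m => y ^ 2 / (4 * D)
     * (Cprod (cosine_factor x) m * / Cprod (sine_factor x) m
        * (Cprod (sine_factor y) m * / Cprod (cosine_factor y) m))
     * ((n0 + q * ((INR m + 1) / 2 + (INR m + 1) ^ 2))
         * (INR m + 1 / 2 + x) * ((INR m + 1) ^ 2 - y ^ 2)
         / (((INR m + 1 / 2) ^ 2 - y ^ 2) * (INR m + 2 + x) * ((INR m + 1) ^ 2 - x ^ 2))))).
  - intros m. unfold boundary.
    rewrite <- (Cmult_assoc (y ^ 2 / (1 - 4 * y ^ 2))).
    rewrite x_prod_y_prod by assumption. unfold cert. fold D q n0.
    generalize (Cprod (cosine_factor x) m * / Cprod (sine_factor x) m
        * (Cprod (sine_factor y) m * / Cprod (cosine_factor y) m)).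
    pose proof (y_denominator_half_neq_0 y m Hy). pose proof (x_denominator_neq_0 x m Hx).
    pose proof (non_integer_plus_INR x m 2 Hx).
    clearbody D q n0. generalize dependent (RtoC (INR m)). intros. field. neq0s.
  - replace (limit_part x y)
      with (y ^ 2 / (4 * D) * (Ccos (PI * x) * / sx * (sy * / Ccos (PI * y))) * q).
    + apply Ccv_mult; [apply Ccv_scal, Ccv_mult; apply Ccv_mult|].
      * apply cosine_product.
      * apply Ccv_inv; [exact Hsx0 | | exact Hsx].
        intros n. apply Cprod_neq_0. intros. now apply sine_factor_neq_0.
      * exact Hsy.
      * apply Ccv_inv; [exact Hcos | | apply cosine_product].
        intros n. apply Cprod_neq_0. intros. now apply cosine_factor_neq_0.
      * now apply rational_cv.
    (* Writing both sines as PI times argument times product makes the two factors PI cancel; what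
       is left is a partial fraction decomposition. *)
    + unfold limit_part, Ccot, Ctan. rewrite <- Esx, <- Esy. unfold D, q.
      set (cx := Ccos (PI * x)) in *. set (cy := Ccos (PI * y)) in *.
      clear Hsx Hsy Esx Esy Hsin HD n0 D q.
      field. neq0s.
Qed.

Definition closed_form (x y : C) : C :=
  1 / 8 * digamma (1 + x + y) + 1 / 8 * digamma (1 + x - y)
  - 1 / 4 * digamma (1 + x) + 1 / 4 * digamma (1 + y)
  - 1 / 2 * digamma (1 + 2 * y) + 1 / (8 * x) - Euler_gamma / 4
  + PI / 8 * Ctan (PI * y)
  + (Ccot (PI * x) * Ctan (PI * y) - 1) / (16 * (x - y))
  - (Ccot (PI * x) * Ctan (PI * y) + 1) / (16 * (x + y))
  + 1 / 8 * (Ccot (PI * x) * Ctan (PI * y))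
    * (digamma (1 + x + y) - digamma (1 + x - y)).

Lemma Ccot_PI_succ (x : C) : (forall k : Z, x <> IZR k) ->
  Ccot (PI * (x + 1)) = Ccot (PI * x).
Proof.
  intros Hx. unfold Ccot. pose proof (Csin_PI_neq_0 x Hx) as H.
  assert (E1 : Ccos (PI * (x + 1)) = - Ccos (PI * x)).
  { rewrite !Ccos_eq. destruct x as [a b]. simpl.
    replace (PI * (a + 1) - 0 * (b + 0))%R with (PI * a + PI)%R by ring.
    replace (PI * (b + 0) + 0 * (a + 1))%R with (PI * b)%R by ring.
    replace (PI * a - 0 * b)%R with (PI * a)%R by ring.
    replace (PI * b + 0 * a)%R with (PI * b)%R by ring.
    rewrite neg_cos, neg_sin. apply injective_projections; simpl; ring. }
  assert (E2 : Csin (PI * (x + 1)) = - Csin (PI * x)).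
  { rewrite !Csin_eq. destruct x as [a b]. simpl.
    replace (PI * (a + 1) - 0 * (b + 0))%R with (PI * a + PI)%R by ring.
    replace (PI * (b + 0) + 0 * (a + 1))%R with (PI * b)%R by ring.
    replace (PI * a - 0 * b)%R with (PI * a)%R by ring.
    replace (PI * b + 0 * a)%R with (PI * b)%R by ring.
    rewrite neg_cos, neg_sin. apply injective_projections; simpl; ring. }
  rewrite E1, E2. field. neq0s.
Qed.

Lemma closed_form_succ (x y : C) :
  (forall k : Z, x <> IZR k) -> not_Gamma_pole (x + y) -> not_Gamma_pole (x - y) ->
  closed_form (x + 1) y = closed_form x y + (limit_part x y + rational_part x y).
Proof.
  intros Hx Hp Hm. unfold closed_form, limit_part, rational_part.
  rewrite Ccot_PI_succ by assumption.
  assert (P1 : not_Gamma_pole (1 + x + y)).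
  { replace (1 + x + y) with (x + y + INR 1) by (simpl INR; ring).
    now apply not_Gamma_pole_plus. }
  assert (P2 : not_Gamma_pole (1 + x - y)).
  { replace (1 + x - y) with (x - y + INR 1) by (simpl INR; ring).
    now apply not_Gamma_pole_plus. }
  replace (1 + (x + 1) + y) with (1 + x + y + 1) by ring.
  replace (1 + (x + 1) - y) with (1 + x - y + 1) by ring.
  replace (1 + (x + 1)) with (1 + x + 1) by ring.
  rewrite (digamma_succ (1 + x + y) P1), (digamma_succ (1 + x - y) P2).
  rewrite (digamma_succ (1 + x)) by exact (proj1 (not_Gamma_pole_non_integer x 1 Hx)).
  pose proof (not_Gamma_pole_neq_0 _ 0 Hp) as A1. pose proof (not_Gamma_pole_neq_0 _ 0 Hm) as A2.
  pose proof (not_Gamma_pole_neq_0 _ 1 Hp) as A3. pose proof (not_Gamma_pole_neq_0 _ 1 Hm) as A4.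
  simpl INR in A1, A2, A3, A4.
  pose proof (Hx 0%Z) as B4. pose proof (non_integer_plus x 1 Hx) as B5.
  generalize (Ccot (PI * x)) (Ctan (PI * y)).
  generalize (digamma (1 + x + y)) (digamma (1 + x - y)) (digamma (1 + x))
    (digamma (1 + y)) (digamma (1 + 2 * y)). intros.
  field. neq0s.
Qed.

(** * Uniform bounds *)

Lemma Cmod_le_sq (a b : C) : (Cmod a ^ 2 <= Cmod b ^ 2)%R -> (Cmod a <= Cmod b)%R.
Proof.
  intros H. apply Rnot_lt_le. intros Hlt. pose proof (Cmod_ge_0 b).
  nra.
Qed.

(** |w + 1/2|^2 - |w|^2 = Re w + 1/4, so -1/4 is the threshold here and in [Cmod_half_left]. *)
Lemma Cmod_half_right (w : C) : (- (1 / 4) <= Re w)%R -> (Cmod w <= Cmod (w + 1 / 2))%R.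
Proof.
  intros H. apply Cmod_le_sq. rewrite !Cmod2_alt, RtoC_half.
  unfold Re, Im in *. simpl. nra.
Qed.

Lemma Cmod_half_left (w : C) : (Re w <= - (1 / 4))%R -> (Cmod (w + 1 / 2) <= Cmod w)%R.
Proof.
  intros H. apply Cmod_le_sq. rewrite !Cmod2_alt, RtoC_half.
  unfold Re, Im in *. simpl. nra.
Qed.

(** The ratio (2l+1)/(2l-1) is chosen because it telescopes over consecutive [l]. *)
Lemma Cmod_half_ratio (w : C) (l : R) : (1 <= l <= Re w)%R ->
  (Cmod (w + 1 / 2) ^ 2 * (2 * l - 1) <= Cmod w ^ 2 * (2 * l + 1))%R.
Proof.
  intros H. rewrite !Cmod2_alt, RtoC_half. unfold Re, Im in *. simpl.
  destruct w as [a b]. simpl in *.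
  assert ((a + 1 / 4) * (2 * l - 1) <= (a + 1 / 4) * (2 * a - 1))%R
    by (apply Rmult_le_compat_l; lra).
  nra.
Qed.

(** Both differences of squares are factored. For [0 <= Re x] only the first ratio can exceed 1: the
    real part of its argument x + N - k decreases through zero as k grows, while the second ratio
    stays below 1. *)
Lemma x_factor_split (x : C) (N k : nat) :
  (forall j : Z, x <> IZR j) ->
  Cmod (((INR k + 1 / 2) ^ 2 - (x + INR (S N)) ^ 2) / ((INR k + 1) ^ 2 - (x + INR (S N)) ^ 2))
  = (Cmod (x + (INR N - INR k) + 1 / 2) / Cmod (x + (INR N - INR k))
     * (Cmod (x + INR N + INR k + 3 / 2) / Cmod (x + INR N + INR k + 3 / 2 + 1 / 2)))%R.
Proof.
  intros Hx.
  assert (H1 : x + (INR N - INR k) <> 0).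
  { pose proof (non_integer_plus_INR x N (- Z.of_nat k) Hx) as H.
    rewrite opp_IZR, <- INR_IZR_INZ, RtoC_opp in H. neq0. }
  assert (H2 : x + INR N + INR k + 3 / 2 + 1 / 2 <> 0).
  { pose proof (non_integer_plus_INR x (N + k) 2 Hx) as H.
    rewrite plus_INR, RtoC_plus in H. neq0. }
  rewrite <- !Cmod_div, <- Cmod_mult by assumption. f_equal.
  rewrite S_INR, RtoC_plus.
  replace ((INR k + 1) ^ 2 - (x + (INR N + 1)) ^ 2)
    with (- ((x + (INR N - INR k)) * (x + INR N + INR k + 3 / 2 + 1 / 2))) by field.
  replace ((INR k + 1 / 2) ^ 2 - (x + (INR N + 1)) ^ 2)
    with (- ((x + (INR N - INR k) + 1 / 2) * (x + INR N + INR k + 3 / 2))) by field.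
  set (A1 := x + (INR N - INR k)) in *. set (A2 := x + INR N + INR k + 3 / 2 + 1 / 2) in *.
  set (A3 := A1 + 1 / 2). set (A4 := x + INR N + INR k + 3 / 2). field. neq0s.
Qed.

Lemma outer_ratio_le_1 (x : C) (N k : nat) : (0 <= Re x)%R ->
  (0 <= Cmod (x + INR N + INR k + 3 / 2) / Cmod (x + INR N + INR k + 3 / 2 + 1 / 2) <= 1)%R.
Proof.
  intros Hx. pose proof (pos_INR N). pose proof (pos_INR k).
  set (w := x + INR N + INR k + 3 / 2).
  assert (Hw : (3 / 2 <= Re w)%R).
  { unfold w. replace (3 / 2) with (RtoC (3 / 2)) by (rewrite RtoC_div by lra; reflexivity).
    unfold Re in *. simpl. lra. }
  assert (Hm : (Cmod w <= Cmod (w + 1 / 2))%R) by (apply Cmod_half_right; lra).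
  assert (Hp : (0 < Cmod w)%R).
  { pose proof (re_le_Cmod w). pose proof (Rle_abs (Re w)). lra. }
  split.
  - apply Rdiv_le_0_compat; lra.
  - apply (Rmult_le_reg_r (Cmod (w + 1 / 2))); [lra|]. unfold Rdiv.
    rewrite Rmult_assoc, Rinv_l by lra. lra.
Qed.

(** The step from [m] to [S m] applies [Cmod_half_ratio] with l = N - m >= 1, so the squared moduli
    telescope to (2N+1)/(2(N-m)+1). *)
Lemma x_prod_bound_below (x : C) (N m : nat) :
  (forall j : Z, x <> IZR j) -> (0 <= Re x)%R -> (m <= N)%nat ->
  (Cmod (x_prod (x + INR (S N)) m) ^ 2 * (2 * (INR N - INR m) + 1) <= 2 * INR N + 1)%R.
Proof.
  intros Hx Hre. induction m as [|m IH]; intros Hm.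
  - unfold x_prod. cbn [Cprod]. rewrite Cmod_1. simpl INR. lra.
  - specialize (IH ltac:(lia)). unfold x_prod in *. cbn [Cprod].
    rewrite Cmod_mult, x_factor_split by assumption.
    set (p := Cmod (Cprod _ m)) in *.
    pose proof (outer_ratio_le_1 x N m Hre) as H2.
    set (t := (Cmod (x + INR N + INR m + 3 / 2) / Cmod (x + INR N + INR m + 3 / 2 + 1 / 2))%R) in *.
    apply le_INR in Hm. rewrite S_INR in *.
    assert (HR : (1 <= INR N - INR m <= Re (x + (INR N - INR m)))%R).
    { split; [lra|]. rewrite <- RtoC_minus. unfold Re in *. simpl. lra. }
    pose proof (Cmod_half_ratio _ _ HR) as H1.
    set (l := (INR N - INR m)%R) in *.
    replace (x + (INR N - INR m)) with (x + l) in * by (unfold l; now rewrite RtoC_minus).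
    set (v := Cmod (x + l)) in *. set (u := Cmod (x + l + 1 / 2)) in *.
    assert (Hv : (0 < v)%R).
    { pose proof (re_le_Cmod (x + l)). pose proof (Rle_abs (Re (x + l))). fold v in H. lra. }
    assert (Hu : (0 <= u)%R) by apply Cmod_ge_0.
    assert (E1 : ((u / v) ^ 2 * (2 * l - 1) <= 2 * l + 1)%R).
    { apply (Rmult_le_reg_r (v ^ 2)); [nra|].
      replace ((u / v) ^ 2 * (2 * l - 1) * v ^ 2)%R with (u ^ 2 * (2 * l - 1))%R by (field; lra).
      lra. }
    replace (2 * (INR N - (INR m + 1)) + 1)%R with (2 * l - 1)%R by (unfold l; ring).
    assert (E2 : (0 <= (u / v) ^ 2 * (2 * l - 1))%R).
    { apply Rmult_le_pos; [apply pow2_ge_0 | lra]. }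
    assert (E3 : (0 <= t ^ 2 <= 1)%R) by (split; [apply pow2_ge_0 | nra]).
    replace ((p * (u / v * t)) ^ 2 * (2 * l - 1))%R
      with (p ^ 2 * ((u / v) ^ 2 * (2 * l - 1)) * t ^ 2)%R by ring.
    apply Rle_trans with (p ^ 2 * ((u / v) ^ 2 * (2 * l - 1)))%R.
    + rewrite <- (Rmult_1_r (p ^ 2 * ((u / v) ^ 2 * (2 * l - 1)))) at 2.
      apply Rmult_le_compat_l; [|lra]. apply Rmult_le_pos; [apply pow2_ge_0 | lra].
    + eapply Rle_trans; [|exact IH]. apply Rmult_le_compat_l; [apply pow2_ge_0 | lra].
Qed.

Fixpoint Rprod (f : nat -> R) (n : nat) : R :=
  match n with O => 1 | S k => Rprod f k * f k end.

Lemma Rprod_ge_0 (f : nat -> R) (n : nat) : (forall k, 0 <= f k)%R -> (0 <= Rprod f n)%R.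
Proof.
  intros Hf. induction n as [|n IH]; simpl; [lra | now apply Rmult_le_pos].
Qed.

Lemma Rprod_bounded (f : nat -> R) (k0 : nat) :
  (forall k, 0 <= f k)%R -> (forall k, (k0 <= k)%nat -> f k <= 1)%R ->
  exists K, (1 <= K)%R /\ forall n, (Rprod f n <= K)%R.
Proof.
  intros H0 H1.
  assert (H : forall n0, exists K, (1 <= K)%R /\ forall n, (n <= n0)%nat -> (Rprod f n <= K)%R).
  { induction n0 as [|n0 [K [HK IH]]].
    - exists 1%R. split; [lra|]. intros n Hn. replace n with O by lia. simpl. lra.
    - exists (Rmax K (Rprod f (S n0))). split; [eapply Rle_trans; [exact HK | apply Rmax_l]|].
      intros n Hn. destruct (Nat.eq_dec n (S n0)) as [-> | Hne]; [apply Rmax_r|].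
      eapply Rle_trans; [apply IH; lia | apply Rmax_l]. }
  destruct (H k0) as [K [HK Hb]]. exists K. split; [exact HK|].
  intros n. destruct (Nat.le_ge_cases n k0) as [Hn | Hn]; [now apply Hb|].
  induction Hn as [|n Hn IH]; [apply Hb; lia|].
  simpl. pose proof (Rprod_ge_0 f n H0). specialize (H1 n Hn). specialize (H0 n). nra.
Qed.

(** Up to index N the telescoped bound is at most 2m + 1. Beyond it, the factor of index N + j is at
    most |x - j + 1/2|/|x - j|, which does not depend on N and is at most 1 for large j; this is why
    one constant serves every N. *)
Lemma x_prod_bound (x : C) :
  (forall j : Z, x <> IZR j) -> (0 <= Re x)%R ->
  exists K, (0 < K)%R /\ forall N m,
    (Cmod (x_prod (x + INR (S N)) m) <= K * sqrt (INR m + 1))%R.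
Proof.
  intros Hx Hre.
  set (f := fun i : nat => (Cmod (x - INR i + 1 / 2) / Cmod (x - INR i))%R).
  assert (Hpos : forall i, (0 < Cmod (x - INR i))%R).
  { intros i. apply Cmod_gt_0. pose proof (non_integer_plus x (- Z.of_nat i) Hx) as H.
    rewrite opp_IZR, <- INR_IZR_INZ, RtoC_opp in H. neq0. }
  (* Every i > k0 satisfies Re x - i <= -1/4, the range of [Cmod_half_left]. *)
  destruct (nfloor_ex (Re x + 1 / 4)) as [k0 [_ Hk0]]; [lra|].
  destruct (Rprod_bounded f (S k0)) as [K [HK Hf]].
  - intros i. apply Rdiv_le_0_compat; [apply Cmod_ge_0 | apply Hpos].
  - intros i Hi. apply le_INR in Hi. rewrite S_INR in Hi. unfold f.
    apply (Rmult_le_reg_r (Cmod (x - INR i))); [apply Hpos|]. unfold Rdiv.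
    rewrite Rmult_assoc, Rinv_l, Rmult_1_r, Rmult_1_l by (apply Rgt_not_eq, Hpos).
    apply Cmod_half_left. unfold Re in *. simpl. lra.
  - exists (2 * K)%R. split; [lra|]. intros N m.
    pose proof (pos_INR m) as Hm0. pose proof (pos_INR N) as HN0.
    assert (Hsq : (Cmod (x_prod (x + INR (S N)) m) ^ 2 <= K ^ 2 * (2 * INR m + 1))%R).
    { destruct (Nat.le_ge_cases m N) as [Hm | Hm].
      - pose proof (x_prod_bound_below x N m Hx Hre Hm) as H.
        apply le_INR in Hm.
        set (P := (Cmod (x_prod (x + INR (S N)) m) ^ 2)%R) in *.
        assert (HP : (0 <= P)%R) by apply pow2_ge_0.
        assert (P <= 2 * INR m + 1)%R.
        (* (2m + 1)(2(N - m) + 1) = 2N + 1 + 4m(N - m). *)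
        { apply (Rmult_le_reg_r (2 * (INR N - INR m) + 1)); [lra|].
          eapply Rle_trans; [exact H|]. nra. }
        assert (1 <= K ^ 2)%R by nra. nra.
      - assert (Hj : exists j, m = (N + j)%nat) by (exists (m - N)%nat; lia).
        destruct Hj as [j Hj].
        assert (HE : (Cmod (x_prod (x + INR (S N)) m)
                   <= Cmod (x_prod (x + INR (S N)) N) * Rprod f j)%R).
        { subst m. clear Hm Hm0. induction j as [|j IH].
          - rewrite Nat.add_0_r. simpl Rprod. lra.
          - replace (N + S j)%nat with (S (N + j)) by lia.
            unfold x_prod in *. cbn [Cprod Rprod].
            rewrite Cmod_mult, x_factor_split by assumption.
            pose proof (outer_ratio_le_1 x N (N + j) Hre) as H2.
            set (t := (Cmod (x + INR N + INR (N + j) + 3 / 2)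
                       / Cmod (x + INR N + INR (N + j) + 3 / 2 + 1 / 2))%R) in *.
            replace (x + (INR N - INR (N + j))) with (x - INR j)
              by (rewrite plus_INR, RtoC_plus; ring).
            fold (f j). rewrite <- Rmult_assoc.
            assert (Hfj : (0 <= f j)%R)
              by (apply Rdiv_le_0_compat; [apply Cmod_ge_0 | apply Hpos]).
            set (p := Cmod (Cprod _ (N + j))) in *. set (p0 := Cmod (Cprod _ N)) in *.
            assert (Hp : (0 <= p)%R) by apply Cmod_ge_0.
            apply Rle_trans with (p * f j)%R.
            + rewrite <- (Rmult_1_r (p * f j)) at 2. apply Rmult_le_compat_l; [|lra].
              now apply Rmult_le_pos.
            + rewrite <- Rmult_assoc. apply Rmult_le_compat_r; [exact Hfj | exact IH]. }
        pose proof (x_prod_bound_below x N N Hx Hre (Nat.le_refl N)) as H.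
        replace (2 * (INR N - INR N) + 1)%R with 1%R in H by ring. rewrite Rmult_1_r in H.
        apply Rle_trans with ((Cmod (x_prod (x + INR (S N)) N) * Rprod f j) ^ 2)%R.
        + apply pow_incr. split; [apply Cmod_ge_0 | exact HE].
        + rewrite Rpow_mult_distr, Rmult_comm. apply Rmult_le_compat; try apply pow2_ge_0.
          * apply pow_incr. split; [|apply Hf]. apply Rprod_ge_0.
            intros i. apply Rdiv_le_0_compat; [apply Cmod_ge_0 | apply Hpos].
          * apply le_INR in Hm. lra. }
    assert (Hs : (0 <= sqrt (INR m + 1))%R) by apply sqrt_pos.
    rewrite <- (Rabs_pos_eq (Cmod _)) by apply Cmod_ge_0.
    rewrite <- (Rabs_pos_eq (2 * K * sqrt (INR m + 1))) by (apply Rmult_le_pos; lra).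
    apply Rsqr_le_abs_0. rewrite !Rsqr_pow2.
    replace ((2 * K * sqrt (INR m + 1)) ^ 2)%R
      with (4 * K ^ 2 * (sqrt (INR m + 1) * sqrt (INR m + 1)))%R by ring.
    rewrite sqrt_sqrt by lra. assert (1 <= K ^ 2)%R by nra. nra.
Qed.

(** Up to the bounded sine and inverse cosine products, [y_prod] is the product of the numbers
    ((k+1)/(k+3/2))^2. Each is at most (k+1)/(k+2), since (k+1)(k+2) <= (k+3/2)^2, and these
    telescope to 1/(m+1). *)
Lemma y_prod_bound (y : C) : (forall k : Z, y <> IZR k + 1 / 2) ->
  exists K, (0 < K)%R /\ forall m, (Cmod (y_prod y m) <= K * / (INR m + 1))%R.
Proof.
  intros Hy. destruct (sine_product y) as [s [Hs _]].
  destruct (Ccv_bounded _ _ Hs) as [B1 [HB1 Hb1]].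
  assert (Hc0 : forall n, Cprod (cosine_factor y) n <> 0)
    by (intros n; apply Cprod_neq_0; intros; now apply cosine_factor_neq_0).
  destruct (Ccv_bounded _ _ (Ccv_inv _ _ (Ccos_PI_neq_0 y Hy) Hc0 (cosine_product y)))
    as [B2 [HB2 Hb2]].
  set (r := fun k : nat => (((INR k + 1) / (INR k + 3 / 2)) ^ 2)%R).
  assert (Hr0 : forall k, (0 <= r k)%R) by (intros; apply pow2_ge_0).
  assert (Hr : forall m, (Rprod r m <= / (INR m + 1))%R).
  { induction m as [|m IH]; [simpl; lra|].
    cbn [Rprod]. rewrite S_INR. pose proof (pos_INR m).
    apply Rle_trans with (/ (INR m + 1) * ((INR m + 1) / (INR m + 1 + 1)))%R.
    - apply Rmult_le_compat; auto; [now apply Rprod_ge_0|].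
      unfold r. apply (Rmult_le_reg_r ((INR m + 3 / 2) ^ 2 * (INR m + 1 + 1))).
      + apply Rmult_lt_0_compat; [apply pow_lt|]; lra.
      + field_simplify; [|lra|lra]. nra.
    - right. field. lra. }
  assert (E : forall m, y_prod y m * Cprod (cosine_factor y) (S m)
     = RtoC (Rprod r m) * Cprod (sine_factor y) m * cosine_factor y 0).
  { induction m as [|m IH].
    - unfold y_prod. simpl Cprod. simpl Rprod. ring.
    - change (y_prod y (S m)) with (y_prod y m *
        (((INR m + 1) ^ 2 - y ^ 2) / ((INR m + 3 / 2) ^ 2 - y ^ 2))).
      change (Cprod (cosine_factor y) (S (S m)))
        with (Cprod (cosine_factor y) (S m) * cosine_factor y (S m)).
      change (Cprod (sine_factor y) (S m))
        with (Cprod (sine_factor y) m * sine_factor y m).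
      transitivity (y_prod y m * Cprod (cosine_factor y) (S m) *
        (((INR m + 1) ^ 2 - y ^ 2) / ((INR m + 3 / 2) ^ 2 - y ^ 2) * cosine_factor y (S m)));
        [ring|].
      rewrite IH. cbn [Rprod]. rewrite RtoC_mult.
      replace (((INR m + 1) ^ 2 - y ^ 2) / ((INR m + 3 / 2) ^ 2 - y ^ 2) * cosine_factor y (S m))
        with (RtoC (r m) * sine_factor y m); [ring|].
      rewrite cosine_factor_eq, sine_factor_eq. unfold r. pose proof (pos_INR m).
      rewrite S_INR, !RtoC_plus, RtoC_pow, RtoC_div, !RtoC_plus, RtoC_div by lra.
      pose proof (y_denominator_neq_0 y m Hy) as D1.
      assert (D2 : RtoC (INR m) + 1 <> 0) by (apply (RtoC_INR_plus_neq_0 m 1); lra).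
      assert (D3 : RtoC (INR m) + RtoC (3 / 2) <> 0) by (apply RtoC_INR_plus_neq_0; lra).
      rewrite RtoC_div in D3 by lra.
      generalize dependent (RtoC (INR m)). intros. field. neq0s. }
  exists (B1 * Cmod (cosine_factor y 0) * B2)%R.
  assert (Hcf : (0 < Cmod (cosine_factor y 0))%R)
    by now apply Cmod_gt_0, cosine_factor_neq_0.
  split; [repeat apply Rmult_lt_0_compat; assumption|].
  intros m.
  replace (y_prod y m) with (y_prod y m * Cprod (cosine_factor y) (S m)
     * / Cprod (cosine_factor y) (S m)) by (field; apply Hc0).
  rewrite E, !Cmod_mult, Cmod_R, Rabs_pos_eq by now apply Rprod_ge_0.
  specialize (Hb2 (S m)). specialize (Hb1 m). specialize (Hr m).
  replace (B1 * Cmod (cosine_factor y 0) * B2 * / (INR m + 1))%R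
    with (/ (INR m + 1) * B1 * Cmod (cosine_factor y 0) * B2)%R by ring.
  pose proof (Rprod_ge_0 r m Hr0).
  apply Rmult_le_compat; try apply Cmod_ge_0; [| | exact Hb2].
  { repeat apply Rmult_le_pos; try apply Cmod_ge_0; lra. }
  apply Rmult_le_compat_r; [lra|].
  apply Rmult_le_compat; try apply Cmod_ge_0; lra.
Qed.

(** (m+1)^(-3/2): sqrt(m+1) from [x_prod], 1/(m+1) from [y_prod], and one more 1/(m+1) from the
    denominators of [term]. *)
Definition dominant (m : nat) : R := (/ ((INR m + 1) * sqrt (INR m + 1)))%R.

Lemma ex_series_dominant : ex_series dominant.
Proof.
  (* With a, b the square roots of k+1 and k+2, the increment is 6/(ab(a+b)); as b <= 2a, it is at
     least 1/a^3. *)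
  apply (ex_series_telescope _ (fun k => 6 / sqrt (INR k + 1))%R).
  - intros k. unfold dominant. rewrite S_INR. pose proof (pos_INR k) as Hk.
    assert (Ha : (0 < sqrt (INR k + 1))%R) by (apply sqrt_lt_R0; lra).
    assert (Hb : (0 < sqrt (INR k + 1 + 1))%R) by (apply sqrt_lt_R0; lra).
    assert (Ea : (sqrt (INR k + 1) * sqrt (INR k + 1) = INR k + 1)%R) by (apply sqrt_sqrt; lra).
    assert (Eb : (sqrt (INR k + 1 + 1) * sqrt (INR k + 1 + 1) = INR k + 1 + 1)%R)
      by (apply sqrt_sqrt; lra).
    set (a := sqrt (INR k + 1)) in *. set (b := sqrt (INR k + 1 + 1)) in *.
    split; [apply Rlt_le, Rinv_0_lt_compat; nra|].
    assert (Hab : (b <= 2 * a)%R) by nra.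
    assert (Hba : (b - a = / (a + b))%R).
    { apply (Rmult_eq_reg_r (a + b)); [|lra]. rewrite Rinv_l by lra. nra. }
    replace (6 / a - 6 / b)%R with (6 * (b - a) / (a * b))%R by (field; lra).
    rewrite Hba. rewrite <- Ea.
    replace (6 * / (a + b) / (a * b))%R with (/ (a * b * (a + b) / 6))%R by (field; lra).
    apply Rinv_le_contravar.
    + apply Rdiv_lt_0_compat; [|lra]. repeat apply Rmult_lt_0_compat; lra.
    + assert (a * b * (a + b) <= a * (2 * a) * (a + 2 * a))%R.
      { apply Rmult_le_compat; try nra. }
      lra.
  - intros k. apply Rlt_le, Rdiv_lt_0_compat; [lra|].
    apply sqrt_lt_R0. pose proof (pos_INR k). lra.
Qed.

Lemma term_bound (x y : C) :
  (forall j : Z, x <> IZR j) -> (0 <= Re x)%R -> (forall k : Z, y <> IZR k + 1 / 2) ->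
  exists K, forall N m, (Cmod (term (x + INR (S N)) y m) <= K * dominant m)%R.
Proof.
  intros Hx Hre Hy.
  destruct (x_prod_bound x Hx Hre) as [K1 [HK1 B1]].
  destruct (y_prod_bound y Hy) as [K2 [HK2 B2]].
  set (c := y ^ 2 / (1 - 4 * y ^ 2)).
  exists (Cmod c * K2 * (3 * K1))%R. intros N m.
  pose proof (B1 N m) as P1. pose proof (B1 N (S m)) as P2. specialize (B2 m).
  unfold term. fold c. set (X := x + INR (S N)) in *.
  rewrite !Cmod_mult. rewrite S_INR in P2. pose proof (pos_INR m) as Hm.
  set (t := INR m) in *.
  assert (Hs : (0 < sqrt (t + 1))%R) by (apply sqrt_lt_R0; lra).
  assert (Es : (sqrt (t + 1) * sqrt (t + 1) = t + 1)%R) by (apply sqrt_sqrt; lra).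
  assert (Hs2 : (sqrt (t + 1 + 1) <= 2 * sqrt (t + 1))%R).
  { apply Rsqr_incr_0_var; [|lra]. unfold Rsqr. rewrite sqrt_sqrt by lra. nra. }
  set (s := sqrt (t + 1)) in *.
  assert (T : (Cmod (x_prod X m / (2 * t + 1) + x_prod X (S m) / (2 * t + 2))
     <= 3 * K1 * / s)%R).
  { eapply Rle_trans; [apply Cmod_triangle|].
    assert (N1 : 2 * RtoC t + 1 <> 0)
      by (rewrite <- RtoC_mult, <- RtoC_plus; apply RtoC_neq_0; lra).
    assert (N2 : 2 * RtoC t + 2 <> 0)
      by (rewrite <- RtoC_mult, <- RtoC_plus; apply RtoC_neq_0; lra).
    rewrite !Cmod_div by assumption.
    rewrite <- !RtoC_mult, <- !RtoC_plus, !Cmod_R, !Rabs_pos_eq by lra.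
    assert (Q1 : (Cmod (x_prod X m) / (2 * t + 1) <= K1 * / s)%R).
    { apply (Rmult_le_reg_r (2 * t + 1)); [lra|]. unfold Rdiv.
      rewrite Rmult_assoc, Rinv_l, Rmult_1_r by lra.
      eapply Rle_trans; [exact P1|]. rewrite Rmult_assoc.
      apply Rmult_le_compat_l; [lra|].
      apply (Rmult_le_reg_l s); [lra|].
      rewrite <- Rmult_assoc, Rinv_r, Rmult_1_l by lra. lra. }
    assert (Q2 : (Cmod (x_prod X (S m)) / (2 * t + 2) <= K1 * / s)%R).
    { apply (Rmult_le_reg_r (2 * t + 2)); [lra|]. unfold Rdiv.
      rewrite Rmult_assoc, Rinv_l, Rmult_1_r by lra.
      eapply Rle_trans; [exact P2|]. rewrite Rmult_assoc.
      apply Rmult_le_compat_l; [lra|].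
      apply (Rmult_le_reg_l s); [lra|].
      rewrite <- Rmult_assoc, Rinv_r, Rmult_1_l by lra. nra. }
    assert (0 < K1 * / s)%R by (apply Rmult_lt_0_compat; [lra | now apply Rinv_0_lt_compat]).
    lra. }
  unfold dominant. fold t. fold s. rewrite Rinv_mult.
  replace (Cmod c * K2 * (3 * K1) * (/ (t + 1) * / s))%R
    with (Cmod c * (K2 * / (t + 1)) * (3 * K1 * / s))%R by ring.
  apply Rmult_le_compat; try apply Cmod_ge_0; [| |exact T].
  - apply Rmult_le_pos; apply Cmod_ge_0.
  - apply Rmult_le_compat_l; [apply Cmod_ge_0 | exact B2].
Qed.

(** * Conclusion *)

Lemma Csum_cv_0 (f : nat -> nat -> C) (M : nat) :
  (forall m, Ccv (fun N => f N m) 0) -> Ccv (fun N => Csum (f N) M) 0.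
Proof.
  intros Hf. induction M as [|M IH]; cbn [Csum]; [apply Ccv_const|].
  replace (RtoC 0) with (RtoC 0 + RtoC 0) by ring. now apply Ccv_plus.
Qed.

(** Tannery's theorem for termwise limit 0, the case of a difference of two series: the tails are
    small uniformly in N, and the finitely many remaining terms tend to 0. *)
Lemma tannery (f : nat -> nat -> C) (s : nat -> C) (c : nat -> R) :
  (forall N m, Cmod (f N m) <= c m)%R -> ex_series c ->
  (forall m, Ccv (fun N => f N m) 0) -> (forall N, Ccv (Csum (f N)) (s N)) ->
  Ccv s 0.
Proof.
  intros Hf Hc Hm Hs.
  assert (Hc0 : forall m, (0 <= c m)%R)
    by (intros m; eapply Rle_trans; [apply Cmod_ge_0 | apply (Hf O)]).
  assert (Htail : forall N M, (Cmod (s N - Csum (f N) M) <= Series c - Rsum c M)%R).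
  { intros N M.
    apply (Ccv_bounded_by (fun n => Csum (f N) (M + n) - Csum (f N) M)).
    - apply Ccv_minus; [|apply Ccv_const].
      apply (Ccv_subseq (Csum (f N)) (s N) (fun n => M + n)%nat); [intros; lia | apply Hs].
    - intros n.
      assert (H : (Cmod (Csum (f N) (M + n) - Csum (f N) M) <= Rsum c (M + n) - Rsum c M)%R).
      { induction n as [|n IH].
        - rewrite Nat.add_0_r. replace (Csum (f N) M - Csum (f N) M) with (RtoC 0) by ring.
          rewrite Cmod_0. lra.
        - rewrite Nat.add_succ_r. cbn [Csum Rsum].
          replace (Csum (f N) (M + n) + f N (M + n)%nat - Csum (f N) M)
            with ((Csum (f N) (M + n) - Csum (f N) M) + f N (M + n)%nat) by ring.
          eapply Rle_trans; [apply Cmod_triangle|]. specialize (Hf N (M + n)%nat). lra. }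
      pose proof (Rsum_le_Series c (M + n) Hc0 Hc). lra. }
  assert (Hser : is_lim_seq (Rsum c) (Series c)).
  { apply is_lim_seq_incr_1. apply (is_lim_seq_ext (sum_n c)).
    - intros n. symmetry. apply Rsum_sum_n.
    - now apply Series_correct in Hc. }
  apply is_lim_seq_spec. intros eps.
  apply is_lim_seq_spec in Hser. destruct (Hser (pos_div_2 eps)) as [M HM].
  specialize (HM M (Nat.le_refl M)). simpl in HM. apply Rabs_def2 in HM.
  pose proof (Csum_cv_0 f M Hm) as H0. apply is_lim_seq_spec in H0.
  destruct (H0 (pos_div_2 eps)) as [N0 HN]. exists N0. intros N HNN.
  specialize (HN N HNN). simpl in HN.
  rewrite Rminus_0_r, Rabs_pos_eq in HN by apply Cmod_ge_0.
  rewrite Rminus_0_r, Rabs_pos_eq by apply Cmod_ge_0.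
  replace (s N - 0) with ((s N - Csum (f N) M) + (Csum (f N) M - 0)) by ring.
  eapply Rle_lt_trans; [apply Cmod_triangle|].
  specialize (Htail N M). lra.
Qed.

Lemma non_integer_plus_nat (x : C) (n : nat) :
  (forall k : Z, x <> IZR k) -> forall k : Z, x + INR n <> IZR k.
Proof.
  intros Hx k E. apply (Hx (k - Z.of_nat n)%Z).
  rewrite minus_IZR, <- INR_IZR_INZ, RtoC_minus, <- E. ring.
Qed.

Lemma x_prod_cv_1 (x : C) (m : nat) : (forall k : Z, x <> IZR k) ->
  Ccv (fun N => x_prod (x + INR (S N)) m) 1.
Proof.
  intros Hx. apply -> (Ccv_S (fun N => x_prod (x + INR N) m)).
  unfold x_prod. induction m as [|m IH]; cbn [Cprod]; [apply Ccv_const|].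
  apply (Ccv_limit_eq _ (1 * (1 + (INR m + 3 / 4) * (0 * 0)))); [ring|].
  apply Ccv_mult; [exact IH|].
  assert (P1 : not_Gamma_pole (x - (INR m + 1))).
  { intros n E. apply (non_integer_minus_INR x m (1 - Z.of_nat n) Hx).
    rewrite minus_IZR, <- INR_IZR_INZ, RtoC_minus.
    replace (INR m + (1 - INR n) - x) with (- (x - (INR m + 1)) - INR n) by ring.
    rewrite E. ring. }
  assert (P2 : not_Gamma_pole (x + (INR m + 1))).
  { intros n E. apply (non_integer_plus_INR x m (1 + Z.of_nat n) Hx).
    rewrite plus_IZR, <- INR_IZR_INZ, RtoC_plus.
    replace (x + INR m + (1 + INR n)) with (x + (INR m + 1) + INR n) by ring.
    rewrite E. ring. }
  (* m + 3/4 is (m+1)^2 - (m+1/2)^2, so each factor differs from 1 by a quantity of order 1/N^2. *)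
  apply (Ccv_ext (fun N => 1 + (INR m + 3 / 4)
    * (/ (x - (INR m + 1) + INR N) * / (x + (INR m + 1) + INR N)))).
  - intros N. pose proof (not_Gamma_pole_neq_0 _ N P1) as N1.
    pose proof (not_Gamma_pole_neq_0 _ N P2) as N2.
    replace ((INR m + 1) ^ 2 - (x + INR N) ^ 2)
      with (- ((x - (INR m + 1) + INR N) * (x + (INR m + 1) + INR N))) by ring.
    replace ((INR m + 1 / 2) ^ 2 - (x + INR N) ^ 2)
      with (- ((x - (INR m + 1) + INR N) * (x + (INR m + 1) + INR N)) - (INR m + 3 / 4))
      by field.
    set (A1 := x - (INR m + 1) + INR N) in *. set (A2 := x + (INR m + 1) + INR N) in *.
    field. neq0s.
  - apply Ccv_plus; [apply Ccv_const|]. apply Ccv_scal, Ccv_mult; now apply Cinv_cv_0.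
Qed.

(** For fixed [m], both terms have the same limit, obtained by setting [x_prod] to 1. It cancels in
    the difference, so its sum over [m] does not have to be evaluated. *)
Lemma term_sums_asymptotically_equal (x x' y : C) (s s' : nat -> C) :
  (forall k : Z, x <> IZR k) -> (0 <= Re x)%R ->
  (forall k : Z, x' <> IZR k) -> (0 <= Re x')%R ->
  (forall k : Z, y <> IZR k + 1 / 2) ->
  (forall N, Ccv (Csum (term (x + INR (S N)) y)) (s N)) ->
  (forall N, Ccv (Csum (term (x' + INR (S N)) y)) (s' N)) ->
  Ccv (fun N => s N - s' N) 0.
Proof.
  intros Hx Hre Hx' Hre' Hy Hs Hs'.
  destruct (term_bound x y Hx Hre Hy) as [K HK].
  destruct (term_bound x' y Hx' Hre' Hy) as [K' HK'].
  apply (tannery (fun N m => term (x + INR (S N)) y m - term (x' + INR (S N)) y m) _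
    (fun m => (K + K') * dominant m)%R).
  - intros N m. eapply Rle_trans; [apply Cmod_triangle_minus|].
    specialize (HK N m). specialize (HK' N m). lra.
  - apply (ex_series_scal (K + K')%R dominant), ex_series_dominant.
  - intros m. unfold term.
    set (L := y ^ 2 / (1 - 4 * y ^ 2) * y_prod y m
              * (1 * / (2 * INR m + 1) + 1 * / (2 * INR m + 2))).
    apply (Ccv_limit_eq _ (L - L)); [ring|]. unfold L.
    apply Ccv_minus; (apply Ccv_scal, Ccv_plus; (apply Ccv_mult; [|apply Ccv_const]);
      now apply x_prod_cv_1).
  - intros N. apply (Ccv_ext (fun n => Csum (term (x + INR (S N)) y) n
                                      - Csum (term (x' + INR (S N)) y) n)).
    + intros n. symmetry. apply Csum_minus.
    + now apply Ccv_minus.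
Qed.

Definition admissible (x y : C) : Prop :=
  (forall k : Z, x <> IZR k) /\ not_Gamma_pole (x + y) /\ not_Gamma_pole (x - y).

Lemma admissible_plus (x y : C) (n : nat) : admissible x y -> admissible (x + INR n) y.
Proof.
  intros [Hx [Hp Hm]]. repeat split.
  - now apply non_integer_plus_nat.
  - replace (x + INR n + y) with (x + y + INR n) by ring. now apply not_Gamma_pole_plus.
  - replace (x + INR n - y) with (x - y + INR n) by ring. now apply not_Gamma_pole_plus.
Qed.

(** The difference of the two series converges to the increment of the closed form, so the defect
    [d] is preserved. The equivalence is used in both directions: upwards to reach large shifts,
    downwards to recover convergence at the original point. *)
Lemma term_sum_succ (x y d : C) :
  admissible x y -> (forall k : Z, y <> IZR k + 1 / 2) ->
  Ccv (Csum (term x y)) (closed_form x y + d) <->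
  Ccv (Csum (term (x + 1) y)) (closed_form (x + 1) y + d).
Proof.
  intros [Hx [Hp Hm]] Hy. rewrite (closed_form_succ x y Hx Hp Hm).
  set (rho := limit_part x y + rational_part x y).
  assert (H : Ccv (fun n => Csum (term (x + 1) y) n - Csum (term x y) n) rho).
  { apply Ccv_S. apply (Ccv_ext (fun n => boundary x y n + rational_part x y)).
    - intros n. rewrite <- Csum_minus. symmetry. now apply telescoped_sum.
    - apply Ccv_plus; [now apply boundary_cv | apply Ccv_const]. }
  split; intros Hs.
  - replace (closed_form x y + rho + d) with (closed_form x y + d + rho) by ring.
    apply (Ccv_ext (fun n => Csum (term x y) n
      + (Csum (term (x + 1) y) n - Csum (term x y) n))); [intros; ring|].
    now apply Ccv_plus.
  - replace (closed_form x y + d) with (closed_form x y + rho + d - rho) by ring.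
    apply (Ccv_ext (fun n => Csum (term (x + 1) y) n
      - (Csum (term (x + 1) y) n - Csum (term x y) n))); [intros; ring|].
    now apply Ccv_minus.
Qed.

Lemma term_sum_shift (x y d : C) (n : nat) :
  admissible x y -> (forall k : Z, y <> IZR k + 1 / 2) ->
  Ccv (Csum (term x y)) (closed_form x y + d) <->
  Ccv (Csum (term (x + INR n) y)) (closed_form (x + INR n) y + d).
Proof.
  intros Ha Hy. induction n as [|n IH].
  - simpl INR. rewrite Cplus_0_r. reflexivity.
  - rewrite IH, S_INR, RtoC_plus, Cplus_assoc.
    apply term_sum_succ; [now apply admissible_plus | exact Hy].
Qed.

Lemma Ccot_PI_plus (x : C) (n : nat) : (forall k : Z, x <> IZR k) ->
  Ccot (PI * (x + INR n)) = Ccot (PI * x).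
Proof.
  intros Hx. induction n as [|n IH].
  - simpl INR. now rewrite Cplus_0_r.
  - rewrite <- IH, S_INR, RtoC_plus, Cplus_assoc.
    apply Ccot_PI_succ. now apply non_integer_plus_nat.
Qed.

Definition closed_form_limit (y : C) : C :=
  1 / 4 * digamma (1 + y) - 1 / 2 * digamma (1 + 2 * y) - Euler_gamma / 4
  + PI / 8 * Ctan (PI * y).

(** The coefficients 1/8, 1/8 and -1/4 of the digamma values that move with [n] add up to 0, so
    their logarithms cancel, as they do in the difference multiplied by cot(PI x) tan(PI y). *)
Lemma closed_form_cv (x y : C) : admissible x y ->
  Ccv (fun n => closed_form (x + INR n) y) (closed_form_limit y).
Proof.
  intros [Hx [Hp Hm]].
  assert (P1 : not_Gamma_pole (1 + x + y)).
  { replace (1 + x + y) with (x + y + INR 1) by (simpl INR; ring).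
    now apply not_Gamma_pole_plus. }
  assert (P2 : not_Gamma_pole (1 + x - y)).
  { replace (1 + x - y) with (x - y + INR 1) by (simpl INR; ring).
    now apply not_Gamma_pole_plus. }
  destruct (not_Gamma_pole_non_integer x 1 Hx) as [P3 _].
  destruct (not_Gamma_pole_non_integer x 0 Hx) as [P4 _].
  replace (0 + x) with x in P4 by ring.
  set (ct := Ccot (PI * x) * Ctan (PI * y)).
  pose (a := fun n => digamma (1 + x + y + INR n) - ln (INR n + 1)).
  pose (b := fun n => digamma (1 + x - y + INR n) - ln (INR n + 1)).
  pose (c := fun n => digamma (1 + x + INR n) - ln (INR n + 1)).
  assert (Ha : Ccv a 0) by exact (digamma_asymptotic _ P1).
  assert (Hb : Ccv b 0) by exact (digamma_asymptotic _ P2).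
  assert (Hc : Ccv c 0) by exact (digamma_asymptotic _ P3).
  apply (Ccv_ext (fun n => 1 / 8 * a n + 1 / 8 * b n - 1 / 4 * c n + closed_form_limit y
     + 1 / 8 * / (x + INR n) + (ct - 1) / 16 * / (x - y + INR n)
     - (ct + 1) / 16 * / (x + y + INR n) + 1 / 8 * ct * (a n - b n))).
  - intros n. unfold closed_form. rewrite Ccot_PI_plus by assumption. fold ct.
    replace (1 + (x + INR n) + y) with (1 + x + y + INR n) by ring.
    replace (1 + (x + INR n) - y) with (1 + x - y + INR n) by ring.
    replace (1 + (x + INR n)) with (1 + x + INR n) by ring.
    replace (x + INR n - y) with (x - y + INR n) by ring.
    replace (x + INR n + y) with (x + y + INR n) by ring.
    unfold a, b, c, closed_form_limit.
    pose proof (not_Gamma_pole_neq_0 _ n Hp) as N1. pose proof (not_Gamma_pole_neq_0 _ n Hm) as N2.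
    pose proof (not_Gamma_pole_neq_0 _ n P4) as N3.
    generalize dependent (x + y + INR n). generalize dependent (x - y + INR n).
    generalize dependent (x + INR n).
    generalize (digamma (1 + x + y + INR n)) (digamma (1 + x - y + INR n))
      (digamma (1 + x + INR n)) (digamma (1 + y)) (digamma (1 + 2 * y)) ct (Ctan (PI * y)).
    intros. field. neq0s.
  - clearbody a b c. generalize (closed_form_limit y). intros L.
    apply (Ccv_limit_eq _ (1 / 8 * 0 + 1 / 8 * 0 - 1 / 4 * 0 + L
       + 1 / 8 * 0 + (ct - 1) / 16 * 0 - (ct + 1) / 16 * 0 + 1 / 8 * ct * (0 - 0))); [ring|].
    apply Ccv_plus; [apply Ccv_minus; [apply Ccv_plus; [apply Ccv_plus; [apply Ccv_plus;
      [apply Ccv_minus; [apply Ccv_plus|]|]|]|]|]|]; try apply Ccv_const; apply Ccv_scal;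
      try assumption; try (now apply Cinv_cv_0).
    now apply Ccv_minus.
Qed.

Lemma digamma_reflection (y : C) : (forall k : Z, y <> IZR k + 1 / 2) ->
  PI * Ctan (PI * y) = digamma (1 / 2 + y) - digamma (1 / 2 - y).
Proof.
  intros Hy. destruct (half_integer_not_Gamma_pole y Hy) as [N1 N2].
  apply (Ccv_unique _ _ _ (tangent_series y Hy)).
  apply (Ccv_ext (fun n => Csum (psi_term (1 / 2 + y)) n - Csum (psi_term (1 / 2 - y)) n)).
  - intros n. rewrite <- Csum_minus. apply Csum_ext. intros k _. unfold psi_term. ring.
  - apply Ccv_minus; now apply digamma_cv.
Qed.

Lemma not_Gamma_pole_half : not_Gamma_pole (1 / 2).
Proof. rewrite RtoC_half. apply not_Gamma_pole_RtoC. lra. Qed.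

Lemma digamma_half : digamma (1 / 2) = - Euler_gamma - 2 * ln 2.
Proof.
  assert (E1 : 1 + 2 * 0 = 1) by ring. assert (E2 : 1 + 0 = 1) by ring.
  assert (E3 : 1 / 2 + 0 = 1 / 2) by ring.
  pose proof (digamma_duplication 0) as H. rewrite E1, E2, E3 in H.
  specialize (H not_Gamma_pole_1 not_Gamma_pole_1 not_Gamma_pole_half).
  rewrite digamma_1 in H.
  replace (digamma (1 / 2)) with (digamma (1 / 2) + - Euler_gamma + 2 * ln 2
    - (- Euler_gamma + 2 * ln 2)) by ring.
  rewrite <- H. ring.
Qed.

(** The cotangent vanishes at PI/2. Duplication removes the value at 1 + 2y and reflection the
    tangent; the remaining digamma values, ln 2 and the Euler constant then cancel, leaving a
    rational function of [y]. *)
Lemma closed_form_half (y : C) : (forall k : Z, y <> IZR k + 1 / 2) ->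
  not_Gamma_pole (1 + y) -> not_Gamma_pole (1 + 2 * y) ->
  closed_form (1 / 2) y = y ^ 2 / (1 - 4 * y ^ 2).
Proof.
  intros Hy H1 H2. destruct (half_integer_not_Gamma_pole y Hy) as [N1 N2].
  assert (Hcot : Ccot (PI * (1 / 2)) = 0).
  { unfold Ccot. replace (Ccos (PI * (1 / 2))) with (RtoC 0); [unfold Cdiv; ring|].
    rewrite RtoC_half, <- RtoC_mult, Ccos_eq. simpl.
    replace (PI * (1 / 2))%R with (PI / 2)%R by field. rewrite cos_PI2, sin_PI2.
    unfold shR. rewrite Ropp_0. apply injective_projections; simpl; field. }
  unfold closed_form. rewrite Hcot.
  replace (1 + 1 / 2 + y) with (1 / 2 + y + 1) by ring.
  replace (1 + 1 / 2 - y) with (1 / 2 - y + 1) by ring.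
  replace (1 + 1 / 2) with (1 / 2 + 1) by ring.
  rewrite (digamma_succ (1 / 2 + y) N2), (digamma_succ (1 / 2 - y) N1),
    (digamma_succ (1 / 2) not_Gamma_pole_half), digamma_half.
  pose proof (digamma_duplication y H2 H1 N2) as Hd.
  replace (digamma (1 + 2 * y)) with (/ 2 * (2 * digamma (1 + 2 * y))) by field.
  rewrite Hd.
  replace (PI / 8 * Ctan (PI * y)) with (1 / 8 * (PI * Ctan (PI * y))) by field.
  rewrite digamma_reflection by assumption.
  pose proof (not_Gamma_pole_neq_0 _ 0 N1) as M1. pose proof (not_Gamma_pole_neq_0 _ 0 N2) as M2.
  simpl INR in M1, M2. pose proof (four_y2_neq_0 y Hy) as M3.
  generalize (digamma (1 / 2 + y)) (digamma (1 / 2 - y)) (digamma (1 + y)) (RtoC (ln 2))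
    (RtoC Euler_gamma) (Ctan (PI * y)).
  intros. field. neq0s.
Qed.

(* At [x = 1/2] every [x_prod] of positive index vanishes: only the first term survives. *)
Lemma term_sum_half (y : C) : (forall k : Z, y <> IZR k + 1 / 2) ->
  Ccv (Csum (term (1 / 2) y)) (y ^ 2 / (1 - 4 * y ^ 2)).
Proof.
  intros Hy. apply Ccv_S.
  assert (Z : forall m, x_prod (1 / 2) (S m) = 0).
  { induction m as [|m IH].
    - unfold x_prod. cbn [Cprod]. simpl INR.
      replace ((0 + 1 / 2) ^ 2 - (1 / 2) ^ 2) with (RtoC 0) by ring. unfold Cdiv. ring.
    - change (x_prod (1 / 2) (S (S m))) with (x_prod (1 / 2) (S m) *
        (((INR (S m) + 1 / 2) ^ 2 - (1 / 2) ^ 2) / ((INR (S m) + 1) ^ 2 - (1 / 2) ^ 2))).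
      rewrite IH. ring. }
  apply (Ccv_ext (fun _ => y ^ 2 / (1 - 4 * y ^ 2))); [|apply Ccv_const].
  intros n. induction n as [|n IH].
  - cbn [Csum]. unfold term. rewrite Z. unfold x_prod, y_prod. cbn [Cprod]. simpl INR.
    pose proof (four_y2_neq_0 y Hy). field. neq0s.
  - change (y ^ 2 / (1 - 4 * y ^ 2)
      = Csum (term (1 / 2) y) (S n) + term (1 / 2) y (S n)).
    rewrite <- IH. unfold term. rewrite !Z. unfold Cdiv. ring.
Qed.

Lemma half_non_integer (k : Z) : 1 / 2 <> IZR k.
Proof.
  rewrite RtoC_half. intros E. apply RtoC_inj in E.
  assert (H : (1 = IZR (2 * k))%R) by (rewrite mult_IZR; lra).
  apply eq_IZR in H. lia.
Qed.

Lemma term_sum (x y : C) : admissible x y -> (forall k : Z, y <> IZR k + 1 / 2) ->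
  not_Gamma_pole (1 + y) -> not_Gamma_pole (1 + 2 * y) ->
  Ccv (Csum (term x y)) (closed_form x y).
Proof.
  intros Ha Hy H1 H2.
  (* Shifting by more than |Re x| reaches the half-plane where [term_bound] applies. *)
  destruct (nfloor_ex (Rabs (Re x))) as [n0 [_ Hn0]]; [apply Rabs_pos|].
  set (x' := x + INR (S n0)).
  assert (Ha' : admissible x' y) by now apply admissible_plus.
  assert (Hre : (0 <= Re x')%R).
  { unfold x'. rewrite S_INR. unfold Re in *. simpl.
    pose proof (Rle_abs (- fst x)) as H. rewrite Rabs_Ropp in H. lra. }
  pose proof (proj1 Ha') as Hx'.
  destruct (term_bound x' y Hx' Hre Hy) as [K HK].
  destruct (Csum_abs_cv (term (x' + INR 1) y) (fun m => K * dominant m)%R (HK O)) as [l Hl].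
  { apply (ex_series_scal K dominant), ex_series_dominant. }
  (* The bound gives convergence at x' + 1, the first shift it covers; [d] is the defect of the
     claimed value there, and the shift lemma makes it the defect at every integer translate. *)
  set (d := l - closed_form (x' + INR 1) y).
  assert (Hl' : Ccv (Csum (term x' y)) (closed_form x' y + d)).
  { apply (term_sum_shift x' y d 1 Ha' Hy).
    now replace (closed_form (x' + INR 1) y + d) with l by (unfold d; ring). }
  destruct (half_integer_not_Gamma_pole y Hy) as [N1 N2].
  assert (Hah : admissible (1 / 2) y) 
    by (repeat split; [apply half_non_integer | exact N2 | exact N1]).
  assert (Hhalf : Ccv (Csum (term (1 / 2) y)) (closed_form (1 / 2) y + 0)).
  { rewrite closed_form_half, Cplus_0_r by assumption. now apply term_sum_half. }
  (* The difference of the sums at x' + N + 1 and 1/2 + N + 1 has two limits: [d] by the asymptotics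
     of the closed form, which do not depend on the starting point, and 0 by Tannery's theorem. At
     1/2 the defect is already known to be 0. *)
  assert (Hd : d = 0).
  { apply (Ccv_unique (fun N => (closed_form (x' + INR (S N)) y + d)
                               - (closed_form (1 / 2 + INR (S N)) y + 0))).
    - apply (Ccv_limit_eq _ (closed_form_limit y + d - (closed_form_limit y + 0))); [ring|].
      apply Ccv_minus; (apply Ccv_plus; [|apply Ccv_const]).
      + apply -> (Ccv_S (fun N => closed_form (x' + INR N) y)). now apply closed_form_cv.
      + apply -> (Ccv_S (fun N => closed_form (1 / 2 + INR N) y)). now apply closed_form_cv.
    - apply (term_sums_asymptotically_equal x' (1 / 2) y
        (fun N => closed_form (x' + INR (S N)) y + d)
        (fun N => closed_form (1 / 2 + INR (S N)) y + 0)); auto.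
      + apply half_non_integer.
      + rewrite RtoC_half. simpl. lra.
      + intros N. now apply term_sum_shift.
      + intros N. now apply term_sum_shift. }
  rewrite Hd in Hl'. rewrite <- (Cplus_0_r (closed_form x y)).
  now apply (term_sum_shift x y 0 (S n0) Ha Hy).
Qed.

Theorem theorem4p1 (x y : C)
    (hx : forall k : Z, x <> IZR k)
    (hy : forall k : Z, y <> IZR k + 1 / 2)
    (hxy : x - y <> 0)
    (hxy' : x + y <> 0)
    (hpsi1 : not_Gamma_pole (1 + x + y))
    (hpsi2 : not_Gamma_pole (1 + x - y))
    (hpsi3 : not_Gamma_pole (1 + x))
    (hpsi4 : not_Gamma_pole (1 + y))
    (hpsi5 : not_Gamma_pole (1 + 2 * y)) :
  is_series (fun m : nat => F_even x y m + F_odd x y m)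
    (1 / 8 * digamma (1 + x + y) + 1 / 8 * digamma (1 + x - y)
     - 1 / 4 * digamma (1 + x) + 1 / 4 * digamma (1 + y)
     - 1 / 2 * digamma (1 + 2 * y) + 1 / (8 * x) - Euler_gamma / 4
     + PI / 8 * Ctan (PI * y)
     + (Ccot (PI * x) * Ctan (PI * y) - 1) / (16 * (x - y))
     - (Ccot (PI * x) * Ctan (PI * y) + 1) / (16 * (x + y))
     + 1 / 8 * (Ccot (PI * x) * Ctan (PI * y))
       * (digamma (1 + x + y) - digamma (1 + x - y))).
Proof.
  (* The conditions on 1 + x + y and 1 + x - y leave out the pole at 0 of x + y and x - y; [hxy']
     and [hxy] supply it. *)
  assert (Hpole : forall z : C, z <> 0 -> not_Gamma_pole (1 + z) -> not_Gamma_pole z).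
  { intros z Hz H [|n] E.
    - apply Hz. rewrite E. simpl INR. ring.
    - apply (H n). rewrite E, S_INR, RtoC_plus. ring. }
  assert (Ha : admissible x y).
  { repeat split; [exact hx | |]; apply Hpole; auto.
    - now replace (1 + (x + y)) with (1 + x + y) by ring.
    - now replace (1 + (x - y)) with (1 + x - y) by ring. }
  apply Ccv_is_series.
  apply (Ccv_ext (Csum (term x y))).
  - intros n. apply Csum_ext. intros k _. symmetry. now apply F_sum_eq.
  - now apply term_sum.
Qed.
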